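(* Let $r_l,r_h\in(0,\frac12]$ with $r_l<r_h$ and let $0<\gamma\le1$. Assume the two-level regularity, capacity and noise assumptions described in the context (with exceptional index set $E$), and let the local sample sizes be $n_j=\lfloor\frac nm\rfloor$ for $j=1,\dots,m$. Choose $$\lambda_n\simeq\Big(\frac1n\Big)^{\frac{1}{2r_h+1+\gamma}}$$ and let the number $m=m_n$ of sets of the partition satisfy $$m\lesssim n^\alpha,\qquad \alpha\le\frac{2r_h}{2r_h+1+\gamma}.$$ Then the partitioned kernel regularized least squares estimator $\hat f_{\mathcal D}^{\lambda_n}$ satisfies $$\mathbb E\big[\mathcal E(\hat f_{\mathcal D}^{\lambda_n})-\mathcal E(f_\rho)\big]\;\lesssim\;R_h^2\Big(\frac1n\Big)^{\frac{2r_h+1}{2r_h+1+\gamma}}.$$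
   Context: Notation. For positive sequences, $a_n\lesssim b_n$ means $a_n\le C b_n$ for a constant $C<\infty$ not depending on $n$ or $m$ (it may depend on the fixed model parameters: $r_l,r_h,\gamma$, kernel bound $\kappa$, $\sigma,M,R_l,R_h$ and the constants in the assumptions); $a_n\simeq b_n$ means $a_n\lesssim b_n$ and $b_n\lesssim a_n$. For $f$ in a Hilbert space, $f\otimes f$ is the operator $h\mapsto\langle h,f\rangle f$. Learning setting. $\mathcal X$ is a standard Borel space, $\rho$ a probability measure on $\mathcal X\times\mathbb R$ with marginal $\nu$ on $\mathcal X$ and conditional distributions $\rho(\cdot|x)$. Put $\mathcal E(f)=\int (f(x)-y)^2\,d\rho(x,y)$ and $f_\rho(x)=\int y\,d\rho(y|x)$. Partition and kernels. $\{\mathcal X_1,\dots,\mathcal X_m\}$ is a partition of $\mathcal X$ into nonempty disjoint measurable sets with $p_j=\nu(\mathcal X_j)>0$, and $\nu_j(A)=p_j^{-1}\nu(A\cap\mathcal X_j)$. The partition, and so $m=m_n$, may depend on $n$; the constants $r_l,r_h,\gamma,R_l,R_h,\sigma,M,\kappa$ do not. For each $j$, $\mathcal H_j$ is a separable RKHS on $\mathcal X_j$ with measurable positive semi-definite kernel $K_j$ with $\sup_x K_j(x,x)\le\kappa_j^2$, $\kappa_j\le\kappa<\infty$. Functions in $\mathcal H_j$ are extended by zero to $\mathcal X$, giving the RKHS $\hat{\mathcal H}_j$ (same norm) with kernel $\hat K_j$ equal to $K_j$ on $\mathcal X_j\times\mathcal X_j$ and zero elsewhere. The direct sum $\mathcal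 H=\bigoplus_{j=1}^m\hat{\mathcal H}_j$ with norm $\|f_1+\dots+f_m\|_{\mathcal H}^2=\sum_j p_j\|f_j\|_{\hat{\mathcal H}_j}^2$ is an RKHS with kernel $K(x,x')=\sum_j p_j^{-1}\hat K_j(x,x')$. Covariance operators: $T=\mathbb E_{X\sim\nu}[K_X\otimes K_X]$ on $\mathcal H$, with $K_x=K(x,\cdot)$, and $T_j=\mathbb E_{X\sim\nu_j}[\hat K_j(X,\cdot)\otimes\hat K_j(X,\cdot)]$ on $\hat{\mathcal H}_j$. Effective dimension: $\mathcal N(A,\lambda)=\mathrm{Trace}[(A+\lambda)^{-1}A]$. Two-level regularity assumption. $f_\rho\in\mathcal H$, so $f_\rho=f_1+\dots+f_m$ uniquely with $f_j\in\hat{\mathcal H}_j$. There are a set of indices $E\subset\{1,\dots,m\}$ (complement $E^c$) and constants $R_l,R_h<\infty$ with $$\|T_j^{-r_l}f_j\|_{\hat{\mathcal H}_j}\le R_l\ \ \forall j\in E,\qquad \|T_j^{-r_h}f_j\|_{\hat{\mathcal H}_j}\le R_h\ \ \forall j\in E^c$$ ($\|T_j^{-r}f\|\le R$ means $f=T_j^{r}h$ with $\|h\|_{\hat{\mathcal H}_j}\le R$). Furthermore, for all $n$ sufficiently large, $\sum_{j\in E}p_j\lesssim (R_h/R_l)^2\lambda_n^{2(r_h-r_l)}$, where $\lambda_n$ is the regularization parameter in the claim. Capacity assumption. (1) $m\sum_{j=1}^m p_j\,\mathcal N(T_j,\lambda)=O(\mathcal N(T,m\lambda))$; (2) $\mathcal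 N(T,\lambda)\lesssim\lambda^{-\gamma}$ for some $0<\gamma\le1$ (constants uniform in $\lambda>0$ and $n$). Noise assumption (Bernstein). For some $\sigma,M>0$ and every integer $k\ge2$: $\mathbb E[|Y-f_\rho(X)|^k\,|\,X]\le\frac12 k!\,\sigma^2M^{k-2}$ $\nu$-a.s. Data and estimator. The data $\mathcal D=\{(x_i,y_i)\}_{i=1}^n$ are i.i.d. from $\rho$ and split into $\mathcal D_j=\{(x_i,y_i):i\in I_j\}$, $I_j=\{i:x_i\in\mathcal X_j\}$, $n_j=|I_j|$. The local sizes $n_j$ are taken as fixed, so $\mathcal D_j$ consists of $n_j$ i.i.d. draws from $\rho$ conditioned on $x\in\mathcal X_j$ (inputs distributed as $\nu_j$), independent over $j$. For $\lambda>0$, $\hat f_{\mathcal D_j}^\lambda=\sum_{i\in I_j}\alpha_j^{(i)}\hat K_j(x_i,\cdot)$ with $\alpha_j=(\mathbf K_j+n_j\lambda I)^{-1}\mathbf y_j$, where $\mathbf K_j=(K_j(x_i,x_k))_{i,k\in I_j}$, $\mathbf y_j=(y_i)_{i\in I_j}$; and $\hat f_{\mathcal D}^\lambda=\sum_{j=1}^m\hat f_{\mathcal D_j}^\lambda$. *)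

(* Defs.v *)
From HB Require Import structures.
From mathcomp Require Import all_boot all_order all_algebra.
From mathcomp Require Import all_classical all_reals all_analysis.

Set Implicit Arguments.
Unset Strict Implicit.
Unset Printing Implicit Defensive.
Import Order.TTheory GRing.Theory Num.Theory.
Import numFieldNormedType.Exports.
Local Open Scope classical_set_scope.
Local Open Scope ring_scope.

(* Raw data of a reproducing kernel Hilbert space of real functions on [T];
   the inner product is meaningful only between members, and the axioms are in
   [is_rkhs]. *)
Record rkhs (R : realType) (T : Type) := Rkhs {
  rk_car : set (T -> R) ;
  rk_ip : (T -> R) -> (T -> R) -> R ;
  rk_ker : T -> T -> R }.

Section hilbert_function_spaces.
Context {R : realType}.

Definition rk_norm T (H : rkhs R T) (f : T -> R) : R := Num.sqrt (rk_ip H f f).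

(* Symmetry and positive semi-definiteness of the kernel follow from
   [rk_reproducing]. *)
Record is_rkhs T (H : rkhs R T) : Prop := IsRkhs {
  rk_zero : rk_car H (fun=> 0) ;
  rk_lin : forall (a : R) f g, rk_car H f -> rk_car H g ->
    rk_car H (fun x => a * f x + g x) ;
  rk_ip_lin : forall (a : R) f g h,
    rk_car H f -> rk_car H g -> rk_car H h ->
    rk_ip H (fun x => a * f x + g x) h = a * rk_ip H f h + rk_ip H g h ;
  rk_ip_sym : forall f g, rk_car H f -> rk_car H g ->
    rk_ip H f g = rk_ip H g f ;
  rk_ip_ge0 : forall f, rk_car H f -> 0 <= rk_ip H f f ;
  rk_ip_def : forall f, rk_car H f -> rk_ip H f f = 0 -> f = (fun=> 0) ;
  rk_complete : forall u : nat -> T -> R, (forall i, rk_car H (u i)) ->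
    (forall eps : R, 0 < eps -> exists N, forall i j,
      (N <= i)%N -> (N <= j)%N -> rk_norm H (u i \- u j) < eps) ->
    exists2 f, rk_car H f & rk_norm H (u i \- f) @[i --> \oo] --> (0 : R) ;
  rk_ker_car : forall x, rk_car H (rk_ker H x) ;
  rk_reproducing : forall f x, rk_car H f -> rk_ip H f (rk_ker H x) = f x }.

Definition rk_separable T (H : rkhs R T) : Prop :=
  exists u : nat -> T -> R, (forall i, rk_car H (u i)) /\
    forall f (eps : R), rk_car H f -> 0 < eps ->
      exists i, rk_norm H (f \- u i) < eps.

(* Bases are indexed by a set [D] of naturals, so as to cover both finite and
   infinite (separable) dimension. *)
Definition orthonormal_basis T (H : rkhs R T) (D : set nat) (e : nat -> T -> R) :=
  [/\ forall i, D i -> rk_car H (e i),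
      forall i k, D i -> D k -> rk_ip H (e i) (e k) = (i == k)%:R &
      forall f, rk_car H f -> (forall i, D i -> rk_ip H f (e i) = 0) ->
        f = (fun=> 0)].

(* The trace is computed in an arbitrarily chosen orthonormal basis; it is
   only used for positive operators, for which the choice is immaterial. *)
Definition op_trace T (H : rkhs R T) (B : (T -> R) -> (T -> R)) : \bar R :=
  xget 0%E [set t | exists D e, orthonormal_basis H D e /\
    t = (\esum_(i in D) (rk_ip H (B (e i)) (e i))%:E)%E].

(* A^{-1}, with an arbitrary preimage if A is not injective and 0 off the
   range *)
Definition op_inv T (H : rkhs R T) (A : (T -> R) -> (T -> R)) :
    (T -> R) -> (T -> R) :=
  fun g => xget (fun=> 0) [set f | rk_car H f /\ A f = g].

(* N(A, lam) = Trace[(A + lam)^{-1} A] *)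
Definition effective_dim T (H : rkhs R T) (A : (T -> R) -> (T -> R)) (lam : R) :
    \bar R :=
  op_trace H (fun h => op_inv H (fun f x => A f x + lam * f x) (A h)).

(* f = A^r h, where A^r is given by the spectral calculus of a positive compact
   self-adjoint A: A^r h = sum_i mu_i^r <h, e_i> e_i for an orthonormal basis
   (e_i) of eigenvectors with eigenvalues mu_i. *)
Definition is_op_power T (H : rkhs R T) (A : (T -> R) -> (T -> R)) (r : R)
    (h f : T -> R) : Prop :=
  rk_car H f /\ exists D e (mu : nat -> R),
  [/\ orthonormal_basis H D e,
      forall i, D i -> 0 <= mu i /\ A (e i) = (fun x => mu i * e i x) &
      forall i, D i -> rk_ip H f (e i) = mu i `^ r * rk_ip H h (e i)].

(* ||A^{-r} f|| <= B *)
Definition source_condition T (H : rkhs R T) (A : (T -> R) -> (T -> R))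
    (r B : R) (f : T -> R) : Prop :=
  exists h, [/\ rk_car H h, rk_norm H h <= B & is_op_power H A r h f].

(* f (x) f *)
Definition tensor T (H : rkhs R T) (f : T -> R) : (T -> R) -> (T -> R) :=
  fun h x => rk_ip H h f * f x.

(* Expectation of an H-valued map xi under mu, as a weak (Pettis) integral: the
   element v of H with <v, g> = \int <xi(x), g> dmu(x) for all g in H. *)
Definition expectation_in d (X : measurableType d) T (H : rkhs R T)
    (mu : set X -> \bar R) (xi : X -> T -> R) : T -> R :=
  xget (fun=> 0) [set v | rk_car H v /\ forall g, rk_car H g ->
    rk_ip H v g = fine (\int[mu]_x (rk_ip H (xi x) g)%:E)%E].

(* h |-> E_{X ~ mu}[(K_X (x) K_X) h] *)
Definition covariance_op d (X : measurableType d) (H : rkhs R X)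
    (mu : set X -> \bar R) : (X -> R) -> (X -> R) :=
  fun h => expectation_in H mu (fun x => tensor H (rk_ker H x) h).

End hilbert_function_spaces.

Section probability_notions.
Context {R : realType}.

(* Borel space of a Polish space *)
Definition standard_borel d (X : measurableType d) : Prop :=
  exists dist : X -> X -> R,
  [/\ [/\ forall x y, 0 <= dist x y,
          forall x y, dist x y = 0 <-> x = y,
          forall x y, dist x y = dist y x &
          forall x y z, dist x z <= dist x y + dist y z],
      forall u : nat -> X,
        (forall eps : R, 0 < eps -> exists N, forall i j,
          (N <= i)%N -> (N <= j)%N -> dist (u i) (u j) < eps) ->
        exists l, dist (u i) l @[i --> \oo] --> (0 : R),
      exists s : nat -> X, forall x (eps : R), 0 < eps ->
        exists i, dist x (s i) < eps &
      @measurable d X = <<s [set A | forall x, A x ->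
        exists2 eps : R, 0 < eps & forall y, dist x y < eps -> A y] >>].

(* conditional probability mu( . | D) *)
Definition cond_measure d (X : measurableType d) (mu : set X -> \bar R)
    (D : set X) : set X -> \bar R :=
  fun A => ((fine (mu D))^-1%:E * mu (A `&` D))%E.

Definition mutually_independent d (Omega : measurableType d)
    d' (S : measurableType d') (P : probability Omega R) (I : finType)
    (Z : I -> {RV P >-> S}) : Prop :=
  forall (J : {set I}) (A : I -> set S), (forall i, measurable (A i)) ->
  P (\bigcap_(i in [set` J]) (Z i @^-1` A i)) =
  (\prod_(i in J) P (Z i @^-1` A i))%E.

Context {d} {X : measurableType d}.

(* nu is the marginal on X, and rhoc the conditional distribution of y given x,
   of rho *)
Definition disintegration (rho : probability (X * R)%type R)
    (nu : probability X R) (rhoc : R.-pker X ~> R) : Prop :=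
  (forall A, measurable A -> nu A = rho (A `*` setT)) /\
  (forall A B, measurable A -> measurable B ->
    rho (A `*` B) = (\int[nu]_(x in A) rhoc x B)%E).

Definition risk (rho : probability (X * R)%type R) (f : X -> R) : \bar R :=
  (\int[rho]_z ((f z.1 - z.2) ^+ 2)%:E)%E.

Definition regression_fun (rhoc : R.-pker X ~> R) (x : X) : R :=
  \int[rhoc x]_y y.

Definition bernstein_noise (nu : probability X R) (rhoc : R.-pker X ~> R)
    (sigma M : R) : Prop :=
  forall k, (2 <= k)%N -> {ae nu, forall x,
    (\int[rhoc x]_y (`|y - regression_fun rhoc x| ^+ k)%:E <=
     (2^-1 * k`!%:R * sigma ^+ 2 * M ^+ (k - 2))%:E)%E}.

End probability_notions.

Section partitioned_kernels.
Context {R : realType} {d : measure_display} {X : measurableType d}.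

(* Functions on the cell C are extended by zero to X. *)
Definition zero_ext (C : set X) (g : C -> R) : X -> R := 'valL_(0 : R) g.

Definition ext_rkhs (C : set X) (H : rkhs R C) : rkhs R X := {|
  rk_car := [set zero_ext g | g in rk_car H] ;
  rk_ip := fun f g => rk_ip H (sigL C f) (sigL C g) ;
  rk_ker := fun x y => zero_ext (fun x' => zero_ext (rk_ker H x') y) x |}.

Definition cell_prob (nu : probability X R) m (C : 'I_m -> set X) (j : 'I_m) : R :=
  fine (nu (C j)).

Definition is_partition (nu : probability X R) m (C : 'I_m -> set X) : Prop :=
  [/\ forall j, measurable (C j) /\ C j !=set0,
      trivIset setT C,
      \bigcup_j C j = setT &
      forall j, 0 < cell_prob nu C j].

Definition local_spaces (kappa : R) m (C : 'I_m -> set X)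
    (H : forall j, rkhs R (C j)) : Prop :=
  forall j, [/\ is_rkhs (H j), rk_separable (H j),
    measurable_fun (C j `*` C j)
      (fun z : X * X => rk_ker (ext_rkhs (H j)) z.1 z.2) &
    forall x, rk_ker (H j) x x <= kappa ^+ 2].

(* The component of f on the j-th cell is f cut off outside C j. *)
Definition direct_sum (nu : probability X R) m (C : 'I_m -> set X)
    (H : forall j, rkhs R (C j)) : rkhs R X := {|
  rk_car := [set f | exists fs : 'I_m -> X -> R,
    (forall j, rk_car (ext_rkhs (H j)) (fs j)) /\
    f = (fun x => \sum_(j < m) fs j x)] ;
  rk_ip := fun f g => \sum_(j < m) cell_prob nu C j *
    rk_ip (ext_rkhs (H j)) (patch (fun=> 0) (C j) f) (patch (fun=> 0) (C j) g) ;
  rk_ker := fun x y =>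
    \sum_(j < m) (cell_prob nu C j)^-1 * rk_ker (ext_rkhs (H j)) x y |}.

(* T_j and T *)
Definition local_cov (nu : probability X R) m (C : 'I_m -> set X)
    (H : forall j, rkhs R (C j)) (j : 'I_m) : (X -> R) -> (X -> R) :=
  covariance_op (ext_rkhs (H j)) (cond_measure nu (C j)).

Definition global_cov (nu : probability X R) m (C : 'I_m -> set X)
    (H : forall j, rkhs R (C j)) : (X -> R) -> (X -> R) :=
  covariance_op (direct_sum nu H) nu.

(* The regression function is only defined up to a nu-null set (the choice of
   the conditional distribution), hence the almost everywhere identification
   with a member of the direct sum. *)
Definition two_level_regularity (nu : probability X R) m (C : 'I_m -> set X)
    (H : forall j, rkhs R (C j)) (E : {set 'I_m}) (frho : X -> R)
    (rl rh Rl Rh : R) : Prop :=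
  exists fs : 'I_m -> X -> R,
  [/\ forall j, rk_car (ext_rkhs (H j)) (fs j),
      {ae nu, forall x, frho x = \sum_(j < m) fs j x},
      forall j, j \in E ->
        source_condition (ext_rkhs (H j)) (local_cov nu H j) rl Rl (fs j) &
      forall j, j \notin E ->
        source_condition (ext_rkhs (H j)) (local_cov nu H j) rh Rh (fs j)].

Definition capacity (nu : probability X R) m (C : 'I_m -> set X)
    (H : forall j, rkhs R (C j)) (gamma c1 c2 : R) : Prop :=
  forall lam : R, 0 < lam ->
  (m%:R%:E * (\sum_(j < m) (cell_prob nu C j)%:E *
       effective_dim (ext_rkhs (H j)) (local_cov nu H j) lam) <=
     c1%:E * effective_dim (direct_sum nu H) (global_cov nu H) (m%:R * lam))%E /\
  (effective_dim (direct_sum nu H) (global_cov nu H) lam <=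
     (c2 * lam `^ (- gamma))%:E)%E.

(* k i.i.d. draws from rho( . | x in C j) for every cell j, independent over j *)
Definition local_samples (rho : probability (X * R)%type R) m
    (C : 'I_m -> set X) (k : nat) d' (Omega : measurableType d')
    (P : probability Omega R)
    (Z : 'I_m * 'I_k -> {RV P >-> (X * R)%type}) : Prop :=
  mutually_independent Z /\
  forall i A, measurable A ->
    P (Z i @^-1` A) = cond_measure rho (C i.1 `*` setT) A.

(* kernel regularized least squares on the data z_0, ..., z_{k-1} *)
Definition krls (K : X -> X -> R) k (z : 'I_k -> X * R) (lam : R) (x : X) : R :=
  let gram := \matrix_(i < k, l < k) K (z i).1 (z l).1 in
  let alpha := invmx (gram + (k%:R * lam)%:M) *m (\col_(i < k) (z i).2) in
  \sum_(i < k) alpha i 0 * K (z i).1 x.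

Definition partitioned_krls m (C : 'I_m -> set X) (H : forall j, rkhs R (C j))
    k (z : 'I_m * 'I_k -> X * R) (lam : R) (x : X) : R :=
  \sum_(j < m) krls (rk_ker (ext_rkhs (H j))) (fun i => z (j, i)) lam x.

End partitioned_kernels.

(* Main.v *)
From HB Require Import structures.
Require Import Defs.
From mathcomp Require Import all_boot all_order all_algebra.
From mathcomp Require Import all_classical all_reals all_analysis.
From mathcomp Require Import measurable_realfun ring lra.
Set Implicit Arguments.
Unset Strict Implicit.
Unset Printing Implicit Defensive.
Import Order.TTheory GRing.Theory Num.Theory.
Import numFieldNormedType.Exports.
Local Open Scope classical_set_scope.
Local Open Scope ring_scope.

(** The error of each local estimator is bounded by exchangeability alone, with
    no concentration inequality.  Let [k] be the local sample size, [s = k lam],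
    and let [A] be the sum of [K_x (x) K_x] over the [k] sample points and one
    fresh point, plus [s].  Leave-one-out writes the residual of the estimator
    at the fresh point [x0] as [<f, A^-1 K_x0>] times a scale in
    [[s, s + kappa^2]], and the expectation of [<f, A^-1 K_x0>^2] equals its
    average over all [k + 1] points, at most [<f, A^-1 f> / (k + 1)].

    Bias: with [w = (T + lam)^-1 f] one splits [f = T w + lam w].  The part
    [lam w] is handled by [A >= s].  For [T w], which is an average of
    [w(x) K_x], a second use of leave-one-out bounds the expectation of
    [<T w, A^-1 T w>] by a multiple of [E w^2 / (k + 1)] plus half of itself.
    Altogether the bias is of order [lam^2 <f, (T + lam)^-1 f>], which the
    source condition bounds by [lam^(2 r + 1) R^2].

    Variance: the noise is integrated out one observation at a time; what
    remains is the leverage of the fresh point, whose expectation is [1/(k + 1)]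
    times that of [Trace (G (G + s)^-1)], [G] the Gram matrix.  Expanding the
    trace in an orthonormal basis and using that [<e, B (B + t)^-1 e>] is a
    minimum over [u] of expressions linear in [B] bounds it by the effective
    dimension. *)

(** The growth condition on [m] enters only through [s]: the leave-one-out constants are powers of
    [1 + kappa^2 / s], and the bound on [alpha] keeps [s] away from 0. This replaces any statement
    that empirical covariances are close to [T].

    The operators of the theorem are obtained by arbitrary choice ([xget]), so they are awkward to
    manipulate. Resolvents are therefore solutions of weak equations between bilinear forms, and
    [A^-1] is never built: [<f, A^-1 K_x>] and [s <f, A^-1 f>] are the finite-dimensional
    expressions [ridge] and [ridge_val] in the Gram matrix. This also reduces measurability in the
    sample to that of determinants.

    The final exponents come from balancing the bias [lam^(2 r_h + 1)] against the variance
    [lam^(- gamma) / n]. A cell of [E] only has bias [lam^(2 r_l + 1)]; the total mass of [E], of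
    order [lam^(2 (r_h - r_l))], makes up exactly the missing factor. *)

Section forms.
Context {R : realType} {T : Type}.
Implicit Types (f g h u v : T -> R) (a c : R) (V : set (T -> R)).

(** Closedness is algebraic only: [V] is a linear subspace that need not be complete, such as the
    finite kernel combinations. *)
Definition lin_closed V := V (fun=> 0) /\
  forall a f g, V f -> V g -> V (fun x => a * f x + g x).

(** The laws are relative to [V] because [rk_ip] means nothing off the carrier. Degenerate forms are
    allowed, since the covariance form may vanish on nonzero functions. *)
Record psd_form V (b : (T -> R) -> (T -> R) -> R) : Prop := PsdForm {
  form_lin : forall a f g h, V f -> V g -> V h ->
    b (fun x => a * f x + g x) h = a * b f h + b g h ;
  form_sym : forall f g, V f -> V g -> b f g = b g f ;
  form_ge0 : forall f, V f -> 0 <= b f f }.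

Section lin_closed_theory.
Variable V : set (T -> R).
Hypothesis linV : lin_closed V.

Lemma lin_closed0 : V (fun=> 0). Proof. by case: linV. Qed.

Lemma lin_closedZ a f : V f -> V (fun x => a * f x).
Proof.
move=> Vf; have := linV.2 a _ _ Vf lin_closed0.
by under eq_fun do rewrite addr0.
Qed.

Lemma lin_closedD f g : V f -> V g -> V (fun x => f x + g x).
Proof.
move=> Vf Vg; have := linV.2 1 _ _ Vf Vg.
by under eq_fun do rewrite mul1r.
Qed.

Lemma lin_closedB f g : V f -> V g -> V (fun x => f x - g x).
Proof.
move=> Vf Vg; have := linV.2 (-1) _ _ Vg Vf.
by under eq_fun do rewrite mulN1r addrC.
Qed.

Lemma lin_closed_sum (I : Type) (s : seq I) (F : I -> T -> R) :
  (forall i, V (F i)) -> V (fun x => \sum_(i <- s) F i x).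
Proof.
move=> VF; elim: s => [|i s IH].
  by under eq_fun do rewrite big_nil; exact: lin_closed0.
under eq_fun do rewrite big_cons.
exact: lin_closedD (VF _) IH.
Qed.

Variable b : (T -> R) -> (T -> R) -> R.
Hypothesis bV : psd_form V b.

Lemma form0l g : V g -> b (fun=> 0) g = 0.
Proof.
move=> Vg; have := form_lin bV 1 lin_closed0 lin_closed0 Vg.
under eq_fun do rewrite mulr0 addr0.
by rewrite mul1r; lra.
Qed.

Lemma formZl a f g : V f -> V g -> b (fun x => a * f x) g = a * b f g.
Proof.
move=> Vf Vg; have := form_lin bV a Vf lin_closed0 Vg.
by under eq_fun do rewrite addr0; rewrite form0l // addr0.
Qed.

Lemma formDl f g h : V f -> V g -> V h ->
  b (fun x => f x + g x) h = b f h + b g h.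
Proof.
move=> Vf Vg Vh; have := form_lin bV 1 Vf Vg Vh.
by under eq_fun do rewrite mul1r; rewrite mul1r.
Qed.

Lemma formBl f g h : V f -> V g -> V h ->
  b (fun x => f x - g x) h = b f h - b g h.
Proof.
move=> Vf Vg Vh; have := form_lin bV (-1) Vg Vf Vh.
by under eq_fun do rewrite mulN1r addrC; rewrite mulN1r addrC.
Qed.

Lemma formZr a f g : V f -> V g -> b g (fun x => a * f x) = a * b g f.
Proof.
move=> Vf Vg; rewrite (form_sym bV) ?formZl //; last exact: lin_closedZ.
by rewrite (form_sym bV).
Qed.

Lemma formDr f g h : V f -> V g -> V h ->
  b h (fun x => f x + g x) = b h f + b h g.
Proof.
move=> Vf Vg Vh; rewrite (form_sym bV) ?formDl //; last exact: lin_closedD.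
by rewrite (form_sym bV Vf) ?(form_sym bV Vg).
Qed.

Lemma formBr f g h : V f -> V g -> V h ->
  b h (fun x => f x - g x) = b h f - b h g.
Proof.
move=> Vf Vg Vh; rewrite (form_sym bV) ?formBl //; last exact: lin_closedB.
by rewrite (form_sym bV Vf) ?(form_sym bV Vg).
Qed.

Lemma form_suml (I : Type) (s : seq I) (F : I -> T -> R) g :
  (forall i, V (F i)) -> V g ->
  b (fun x => \sum_(i <- s) F i x) g = \sum_(i <- s) b (F i) g.
Proof.
move=> VF Vg; elim: s => [|i s IH].
  by under eq_fun do rewrite big_nil; rewrite big_nil form0l.
under eq_fun do rewrite big_cons; rewrite big_cons -IH formDl //.
exact: lin_closed_sum.
Qed.

Lemma form_sumr (I : Type) (s : seq I) (F : I -> T -> R) g :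
  (forall i, V (F i)) -> V g ->
  b g (fun x => \sum_(i <- s) F i x) = \sum_(i <- s) b g (F i).
Proof.
move=> VF Vg; rewrite (form_sym bV) ?form_suml //; last exact: lin_closed_sum.
by apply: eq_bigr => i _; rewrite (form_sym bV).
Qed.

Lemma form_sqrD a f g : V f -> V g ->
  b (fun x => f x + a * g x) (fun x => f x + a * g x) =
  b f f + 2 * a * b f g + a ^+ 2 * b g g.
Proof.
move=> Vf Vg; have Vag := lin_closedZ a Vg.
rewrite formDl ?formDr ?formZl ?formZr //; try exact: lin_closedD.
rewrite (form_sym bV Vg Vf); ring.
Qed.

Lemma form_sqrB f g : V f -> V g ->
  b (fun x => f x - g x) (fun x => f x - g x) = b f f - 2 * b f g + b g g.
Proof.
move=> Vf Vg.
have := form_sqrD (-1) Vf Vg; under eq_fun do rewrite mulN1r.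
by move=> ->; ring.
Qed.

(** The quadratic [b (f + a g) (f + a g)] is nonnegative in [a]. If [b g g = 0] it is affine, and a
    nonzero slope would let it take the value -1; otherwise it is evaluated at its minimum. *)
Lemma form_CS f g : V f -> V g -> b f g ^+ 2 <= b f f * b g g.
Proof.
move=> Vf Vg; have f0 := form_ge0 bV Vf; have g0 := form_ge0 bV Vg.
have H a : 0 <= b f f + 2 * a * b f g + a ^+ 2 * b g g.
  by rewrite -form_sqrD //; apply: (form_ge0 bV); apply: lin_closedD => //;
     exact: lin_closedZ.
have [g00|gN0] := eqVneq (b g g) 0.
  suff -> : b f g = 0 by rewrite expr0n /= mulr_ge0.
  apply/eqP; apply: contraT => fgN0.
  have := H (- (b f f + 1) / (2 * b f g)); rewrite g00 mulr0 addr0.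
  have -> : 2 * (- (b f f + 1) / (2 * b f g)) * b f g = - (b f f + 1) by field.
  by rewrite opprD addrA subrr sub0r lerNr oppr0 ler10.
have gt0 : 0 < b g g by rewrite lt_neqAle eq_sym gN0.
have := H (- b f g / b g g).
have -> : b f f + 2 * (- b f g / b g g) * b f g +
    (- b f g / b g g) ^+ 2 * b g g = b f f - b f g ^+ 2 / b g g by field.
by rewrite subr_ge0 ler_pdivrMr.
Qed.

Lemma form_sqrD_le f g : V f -> V g ->
  b (fun x => f x + g x) (fun x => f x + g x) <= 2 * b f f + 2 * b g g.
Proof.
move=> Vf Vg.
have := form_sqrD 1 Vf Vg; under eq_fun do rewrite mul1r.
move=> ->; have := form_ge0 bV (lin_closedB Vf Vg).
rewrite form_sqrB //; lra.
Qed.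

End lin_closed_theory.

Lemma psd_formS V V' b : V' `<=` V -> psd_form V b -> psd_form V' b.
Proof.
move=> VV' [l s p]; split.
- by move=> a f g h /VV' ? /VV' ? /VV' ?; exact: l.
- by move=> f g /VV' ? /VV' ?; exact: s.
- by move=> f /VV' ?; exact: p.
Qed.

Lemma psd_formD V b b' a : 0 <= a -> psd_form V b -> psd_form V b' ->
  psd_form V (fun f g => b f g + a * b' f g).
Proof.
move=> a0 [l s p] [l' s' p']; split.
- by move=> c f g h Vf Vg Vh; rewrite l ?l' //; ring.
- by move=> f g Vf Vg; rewrite (s f g) // (s' f g).
- by move=> f Vf; rewrite addr_ge0 ?p // mulr_ge0 ?p'.
Qed.

End forms.

(** * Variational problems in a Hilbert space of functions *)

Section rkhs_theory.
Context {R : realType} {T : Type}.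
Variable H : rkhs R T.
Hypothesis hH : is_rkhs H.
Implicit Types (f g h u v : T -> R) (a c : R) (V : set (T -> R)).

Lemma rk_lin_closed : lin_closed (rk_car H).
Proof. by split; [exact: rk_zero|exact: rk_lin]. Qed.

Lemma rk_psd_form : psd_form (rk_car H) (rk_ip H).
Proof. by split; [exact: rk_ip_lin|exact: rk_ip_sym|exact: rk_ip_ge0]. Qed.

Lemma rk_complete_sqr (u : nat -> T -> R) : (forall i, rk_car H (u i)) ->
  (forall eps : R, 0 < eps -> exists N, forall i j, (N <= i)%N -> (N <= j)%N ->
    rk_ip H (fun x => u i x - u j x) (fun x => u i x - u j x) < eps) ->
  exists2 f, rk_car H f & forall eps : R, 0 < eps ->
    exists N, forall i, (N <= i)%N ->
      rk_ip H (fun x => u i x - f x) (fun x => u i x - f x) < eps.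
Proof.
move=> cu cauchy.
have cB f g : rk_car H f -> rk_car H g -> rk_car H (fun x => f x - g x).
  exact: (lin_closedB rk_lin_closed).
have lt_norm f (e : R) : rk_car H f -> 0 < e ->
    (rk_norm H f < e) = (rk_ip H f f < e ^+ 2).
  move=> cf e0; rewrite /rk_norm -[in LHS](gtr0_norm e0) -sqrtr_sqr.
  by rewrite ltr_sqrt // exprn_gt0.
have [|f cf fP] := rk_complete hH cu.
  move=> e e0; have [N NP] := cauchy (e ^+ 2) (exprn_gt0 _ e0).
  by exists N => i j Ni Nj; rewrite lt_norm //; [exact: NP|exact: cB].
exists f => // e e0.
have s0 : 0 < Num.sqrt e by rewrite sqrtr_gt0.
have /cvgrPdist_lt/(_ _ s0) := fP.
move=> [N _ NP]; exists N => i Ni.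
have := NP i Ni; rewrite /= sub0r normrN ger0_norm ?sqrtr_ge0 // lt_norm //.
  by rewrite sqr_sqrtr // ltW.
exact: cB.
Qed.

(* The minimizing sequence of [b u u - 2 L u] over [V] is Cauchy by the
   parallelogram identity; this covers at once the Riesz representation, the
   orthogonal projection and the Lax-Milgram theorem. *)
Lemma variational_problem V (b : (T -> R) -> (T -> R) -> R) (L : (T -> R) -> R)
    (c C CL : R) :
  lin_closed V -> V `<=` rk_car H -> psd_form (rk_car H) b ->
  0 < c -> (forall f, rk_car H f -> c * rk_ip H f f <= b f f) ->
  (forall f, rk_car H f -> b f f <= C * rk_ip H f f) ->
  (forall a f g, rk_car H f -> rk_car H g ->
    L (fun x => a * f x + g x) = a * L f + L g) ->
  (forall f, rk_car H f -> L f ^+ 2 <= CL * rk_ip H f f) ->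
  exists (u_ : nat -> T -> R) u, [/\ forall i, V (u_ i), rk_car H u,
    (forall eps : R, 0 < eps -> exists N, forall i, (N <= i)%N ->
      rk_ip H (fun x => u_ i x - u x) (fun x => u_ i x - u x) < eps) &
    forall g, V g -> b u g = L g].
Proof.
move=> linV Vcar bform c0 cb bC Llin CLP.
have lc := rk_lin_closed; have ipf := rk_psd_form.
have bV : psd_form V b by exact: psd_formS bform.
have L0 : L (fun=> 0) = 0.
  have := Llin 1 _ _ (lin_closed0 lc) (lin_closed0 lc).
  by under eq_fun do rewrite mulr0 addr0; rewrite mul1r; lra.
have LZ a f : rk_car H f -> L (fun x => a * f x) = a * L f.
  move=> cf; have := Llin a _ _ cf (lin_closed0 lc).
  by under eq_fun do rewrite addr0; rewrite L0 addr0.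
have LD a f g : rk_car H f -> rk_car H g ->
    L (fun x => f x + a * g x) = L f + a * L g.
  move=> cf cg; have := Llin a _ _ cg cf.
  by under eq_fun do rewrite addrC; rewrite addrC.
pose J u := b u u - 2 * L u.
(* Coercivity dominates the linear part, which is at most [2 sqrt(|CL|) |u|] in absolute value. The
   absolute value is there because nothing fixes the sign of [CL]. *)
have Jge u : rk_car H u -> - (`|CL| / c) <= J u.
  move=> cu; have ip0 := form_ge0 ipf cu.
  have h1 : c * rk_ip H u u <= b u u by exact: cb.
  have h2 : L u ^+ 2 <= `|CL| * rk_ip H u u.
    by rewrite (le_trans (CLP _ cu)) // ler_wpM2r // ler_norm.
  rewrite -lerN2 opprK /J ler_pdivlMr //.
  have h3 : (2 * L u) * c <= `|CL| + c * (c * rk_ip H u u).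
    have [CL0|CLpos] := eqVneq `|CL| 0.
      have Lu0 : L u = 0.
        apply/eqP; rewrite -sqrf_eq0; apply/eqP/le_anti.
        by rewrite sqr_ge0 andbT (le_trans h2) // CL0 mul0r.
      by rewrite Lu0 CL0 mulr0 mul0r add0r !mulr_ge0 // ltW.
    have CLgt : 0 < `|CL| by rewrite lt_neqAle eq_sym CLpos normr_ge0.
    rewrite -(ler_pM2l CLgt).
    have : 0 <= (`|CL| - c * L u) ^+ 2 by exact: sqr_ge0.
    have : c ^+ 2 * L u ^+ 2 <= c ^+ 2 * (`|CL| * rk_ip H u u).
      by rewrite ler_wpM2l // sqr_ge0.
    rewrite !expr2; lra.
  have : c * (c * rk_ip H u u) <= c * b u u by rewrite ler_pM2l.
  lra.
pose A := [set J v | v in V].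
have Ainf : has_inf A.
  split; first by exists (J (fun=> 0)), (fun=> 0) => //; exact: lin_closed0.
  by exists (- (`|CL| / c)) => _ [v Vv <-]; apply: Jge; exact: Vcar.
have Jinf v : V v -> inf A <= J v.
  by move=> Vv; apply: ge_inf; [exact: Ainf.2|exists v].
have [iv [iv0 inv_small]] : exists iv : nat -> R, (forall n, 0 < iv n) /\
    forall eps : R, 0 < eps -> exists N, forall i, (N <= i)%N -> iv i < eps.
  exists (fun i => i.+1%:R^-1); split=> [n|e e0]; first by rewrite invr_gt0.
  have [N _ NP] := near_infty_natSinv_lt (PosNum e0).
  by exists N => i Ni; exact: NP.
have ex n : exists v, V v /\ J v < inf A + iv n.
  have [_ [v Vv <-] Jv] := inf_adherent (iv0 n) Ainf.
  by exists v.
have [u_ uP] := choice ex.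
have Vu i : V (u_ i) := (uP i).1.
have cu i : rk_car H (u_ i) := Vcar _ (Vu i).
(* The left side is [2 J(u_i) + 2 J(u_j) - 4 J(mid)], and the midpoint lies in [V], so that [J(mid)]
   is at least the infimum. *)
have par i j : b (fun x => u_ i x - u_ j x) (fun x => u_ i x - u_ j x) <=
    2 * iv i + 2 * iv j.
  have Vm : V (fun x => 2^-1 * (u_ i x + u_ j x)).
    by apply: (lin_closedZ linV); exact: (lin_closedD linV).
  have := Jinf _ Vm; rewrite /J.
  have cD : rk_car H (fun x => u_ i x + u_ j x) by exact: (lin_closedD lc).
  rewrite LZ // (formZl lc bform) //; last by exact: (lin_closedZ lc).
  rewrite (formZr lc bform) //.
  have -> : L (fun x => u_ i x + u_ j x) = L (u_ i) + L (u_ j).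
    by rewrite -[L (u_ j)]mul1r -LD //; congr L; apply/funext => x; rewrite mul1r.
  have := form_sqrD lc bform 1 (cu i) (cu j).
  under eq_fun do rewrite mul1r.
  move=> ->; rewrite (form_sqrB lc bform) //.
  have := (uP i).2; have := (uP j).2; rewrite /J => h1 h2 h3; lra.
have [|u cu' uu] := @rk_complete_sqr u_ cu.
  move=> eps e0.
  have [N NP] := inv_small (c * eps / 4) (divr_gt0 (mulr_gt0 c0 e0) (ltr0n _ 4)).
  exists N => i j Ni Nj; rewrite -(ltr_pM2l c0).
  have cij := lin_closedB lc (cu i) (cu j).
  rewrite (le_lt_trans (cb _ cij)) // (le_lt_trans (par i j)) //.
  by have := NP i Ni; have := NP j Nj; lra.
exists u_, u; split=> // g Vg.
have cg := Vcar _ Vg.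
pose M := b g g + 1.
have M0 : 0 < M by rewrite ltr_wpDl // (form_ge0 bform).
(* Approximate Euler equation: moving from [u_ i] by [- dl / M] along [g] cannot lower [J] by more
   than [iv i]. The [+ 1] in [M] makes the division legitimate when [b g g = 0]. *)
have dP i : (b (u_ i) g - L g) ^+ 2 <= M * iv i.
  set dl := b (u_ i) g - L g.
  have Vt t : V (fun x => u_ i x + t * g x).
    by apply: (lin_closedD linV) => //; exact: (lin_closedZ linV).
  have := Jinf _ (Vt (- dl / M)); rewrite /J LD // (form_sqrD lc bform) //.
  have := (uP i).2; rewrite /J => h1 h2.
  have : 0 <= 2 * (- dl / M) * dl + (- dl / M) ^+ 2 * b g g + iv i.
    by rewrite /dl in h1 h2 *; lra.
  have -> : 2 * (- dl / M) * dl + (- dl / M) ^+ 2 * b g g =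
      (- dl ^+ 2 - dl ^+ 2 / M) / M.
    have -> : b g g = M - 1 by rewrite /M; lra.
    by field; rewrite gt_eqF.
  move=> h3; have h4 : 0 <= dl ^+ 2 / M by rewrite divr_ge0 ?sqr_ge0 // ltW.
  rewrite -ler_pdivrMl // mulrC.
  have : (- dl ^+ 2 - dl ^+ 2 / M) / M <= - dl ^+ 2 / M.
    by rewrite ler_pM2r ?invr_gt0 // gerBl.
  lra.
(* The limit [u] may leave [V], so the Euler equation is carried over from [u_ i] by the continuity
   of [b], which is what [C] is for. *)
have bnd i : (b u g - L g) ^+ 2 <= 2 * (M * iv i) +
   2 * ((C * b g g) * rk_ip H (fun x => u_ i x - u x) (fun x => u_ i x - u x)).
  have cd := lin_closedB lc (cu i) cu'.
  have : b (fun x => u_ i x - u x) g ^+ 2 <= (C * b g g) *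
      rk_ip H (fun x => u_ i x - u x) (fun x => u_ i x - u x).
    rewrite (le_trans (form_CS lc bform cd cg)) // mulrAC ler_wpM2r //.
      exact: (form_ge0 bform).
    exact: bC.
  rewrite (formBl bform) // => h1; have h2 := dP i.
  have : (b u g - L g) ^+ 2 <= 2 * (b (u_ i) g - L g) ^+ 2 + 2 * (b (u_ i) g - b u g) ^+ 2.
    have : 0 <= (b (u_ i) g - L g + (b (u_ i) g - b u g)) ^+ 2 by exact: sqr_ge0.
    rewrite !expr2; lra.
  lra.
apply/eqP; rewrite -subr_eq0 -sqrf_eq0; apply/eqP/le_anti; rewrite sqr_ge0 andbT.
apply/ler_addgt0Pr => eps e0; rewrite add0r.
pose K := `|C * b g g| + 1.
have K0 : 0 < K by rewrite ltr_wpDl.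
have [N1 N1P] := inv_small (eps / (4 * M)) (divr_gt0 e0 (mulr_gt0 (ltr0n _ 4) M0)).
have [N2 N2P] := uu (eps / (4 * K)) (divr_gt0 e0 (mulr_gt0 (ltr0n _ 4) K0)).
pose i := maxn N1 N2.
have := N1P i (leq_maxl _ _); rewrite ltr_pdivlMr ?mulr_gt0 // => h1.
have := N2P i (leq_maxr _ _); rewrite ltr_pdivlMr ?mulr_gt0 // => h2.
have q0 : 0 <= rk_ip H (fun x => u_ i x - u x) (fun x => u_ i x - u x).
  by apply: (form_ge0 ipf); exact: (lin_closedB lc).
have : C * b g g * rk_ip H (fun x => u_ i x - u x) (fun x => u_ i x - u x) <=
  K * rk_ip H (fun x => u_ i x - u x) (fun x => u_ i x - u x).
  by rewrite ler_wpM2r // /K (le_trans (ler_norm _)) // lerDl.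
have := bnd i.
lra.
Qed.

End rkhs_theory.

(** * Density and orthonormal expansions *)

Section reproducing_kernel.
Context {R : realType} {T : Type}.
Variable H : rkhs R T.
Hypothesis hH : is_rkhs H.
Implicit Types (f g h u v : T -> R) (a : R) (V : set (T -> R)).

Let lc := rk_lin_closed hH.
Let ipf := rk_psd_form hH.

Lemma rk_kerE x y : rk_ker H x y = rk_ip H (rk_ker H x) (rk_ker H y).
Proof. by rewrite (rk_reproducing hH)//; exact: rk_ker_car. Qed.

Lemma rk_kerC x y : rk_ker H x y = rk_ker H y x.
Proof. by rewrite !rk_kerE (form_sym ipf) //; exact: rk_ker_car. Qed.

Lemma rk_ker_ge0 x : 0 <= rk_ker H x x.
Proof. by rewrite rk_kerE; apply: (form_ge0 ipf); exact: rk_ker_car. Qed.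

Lemma rk_eval_sqr f x : rk_car H f -> f x ^+ 2 <= rk_ker H x x * rk_ip H f f.
Proof.
move=> cf; rewrite -[f x](rk_reproducing hH) // mulrC (rk_kerE x x).
exact: (form_CS lc ipf cf (rk_ker_car hH x)).
Qed.

(** With the inner product as form and [<., f>] as functional, the limit [u] is the projection of
    [f] on the closure of [V]. Then [f - u] is orthogonal to [V], hence 0, and the minimizing
    sequence in [V] converges to [f]. *)
Lemma rk_density V f : lin_closed V -> V `<=` rk_car H ->
  (forall g, rk_car H g -> (forall v, V v -> rk_ip H g v = 0) -> g = (fun=> 0)) ->
  rk_car H f -> forall eps : R, 0 < eps -> exists2 v, V v &
    rk_ip H (fun x => f x - v x) (fun x => f x - v x) < eps.
Proof.
move=> linV Vc total cf eps e0.
have [||||u_ [u [Vu cu uu uP]]] := @variational_problem _ _ _ hH V (rk_ip H)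
    (fun g => rk_ip H g f) 1 1 (rk_ip H f f) linV Vc ipf ltr01.
- by move=> g _; rewrite mul1r.
- by move=> g _; rewrite mul1r.
- by move=> a g h cg ch; rewrite (form_lin ipf).
- by move=> g cg; rewrite mulrC; exact: (form_CS lc ipf).
have fu : (fun x => f x - u x) = (fun=> 0).
  apply: total; first exact: (lin_closedB lc).
  move=> v Vv; rewrite (formBl ipf) //; try exact: Vc.
  by rewrite uP // (form_sym ipf) ?subrr //; exact: Vc.
have [N NP] := uu _ e0; exists (u_ N) => //.
have := NP N (leqnn N).
have -> : f = u by apply/funext => x; apply/eqP; rewrite -subr_eq0 (congr1 (@^~ x) fu).
rewrite !(form_sqrB lc ipf) //; try exact: Vc.
rewrite (form_sym ipf (Vc _ (Vu N)) cu); lra.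
Qed.

Section parseval.
Variables (D : set nat) (e : nat -> T -> R).
Hypothesis onb : orthonormal_basis H D e.

(** Padding the basis by zero functions off [D] lets every expansion run over initial segments of
    the naturals, in finite and infinite dimension alike. *)
Definition masked (i : nat) : T -> R := if i \in D then e i else (fun=> 0).

Lemma masked_car i : rk_car H (masked i).
Proof.
rewrite /masked; case: ifPn => [/set_mem Di|_]; last exact: lin_closed0 lc.
by case: onb => + _ _; exact.
Qed.

Lemma masked_ip i k :
  rk_ip H (masked i) (masked k) = ((i == k) && (i \in D))%:R.
Proof.
have [ce eij _] := onb.
rewrite /masked; case: ifPn => [/set_mem Di|nDi]; last first.
  rewrite andbF (form0l lc ipf) //; case: ifPn => [/set_mem|_]; first exact: ce.
  exact: (lin_closed0 lc).
case: ifPn => [/set_mem Dk|nDk]; first by rewrite eij // andbT.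
rewrite (form_sym ipf) ?(form0l lc ipf) //; try exact: ce; try exact: (lin_closed0 lc).
by case: eqVneq nDk => [<-|//]; rewrite mem_set.
Qed.

Lemma masked_sqr_ip f (c : R) i : rk_car H f ->
  c ^+ 2 * ((i \in D))%:R - 2 * c * rk_ip H f (masked i) >=
  - rk_ip H f (masked i) ^+ 2.
Proof.
move=> cf; rewrite /masked; case: ifPn => [_|_].
  by have := sqr_ge0 (c - rk_ip H f (e i)); rewrite mulr1 !expr2; lra.
rewrite (form_sym ipf) ?(form0l lc ipf) //; last exact: (lin_closed0 lc).
by rewrite !mulr0 expr0n /= subrr oppr0.
Qed.

Lemma partial_sum_dist f (c : nat -> R) M : rk_car H f ->
  rk_ip H (fun x => f x - \sum_(i < M) c i * masked i x)
          (fun x => f x - \sum_(i < M) c i * masked i x) =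
  rk_ip H f f + \sum_(i < M) (c i ^+ 2 * ((i : nat) \in D)%:R -
    2 * c i * rk_ip H f (masked i)).
Proof.
move=> cf.
have cm (i : 'I_M) : rk_car H (fun x => c i * masked i x).
  by apply: (lin_closedZ lc); exact: masked_car.
have cs : rk_car H (fun x => \sum_(i < M) c i * masked i x).
  by apply: (lin_closed_sum lc).
rewrite (form_sqrB lc ipf) // !(form_sumr lc ipf) //.
rewrite big_split /= sumrN mulr_sumr -addrA (addrC (- _)); congr (_ + (_ - _)).
  apply: eq_bigr => i _; rewrite (form_suml lc ipf) // (bigD1 i) //= big1.
    rewrite addr0 (formZl lc ipf) ?(formZr lc ipf) ?masked_ip ?eqxx /= //;
      try exact: masked_car.
    by rewrite expr2 mulrA.
  move=> k ki; rewrite (formZl lc ipf) ?(formZr lc ipf) ?masked_ip //;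
    try exact: masked_car.
  by rewrite (negPf (_ : (k : nat) != i)) ?mulr0.
apply: eq_bigr => i _; rewrite (formZr lc ipf) ?mulrA //; exact: masked_car.
Qed.

Lemma bessel f M : rk_car H f ->
  \sum_(i < M) rk_ip H f (masked i) ^+ 2 <= rk_ip H f f.
Proof.
move=> cf; rewrite -subr_ge0 -sumrN.
have := partial_sum_dist (fun i => rk_ip H f (masked i)) M cf.
rewrite (eq_bigr (fun i : 'I_M => - rk_ip H f (masked i) ^+ 2)) => [<-|i _].
  apply: (form_ge0 ipf); apply: (lin_closedB lc) => //; apply: (lin_closed_sum lc) => i.
  by apply: (lin_closedZ lc); exact: masked_car.
rewrite /masked; case: ifPn => _; first by rewrite mulr1 !expr2; lra.
rewrite (form_sym ipf) ?(form0l lc ipf) //; last exact: (lin_closed0 lc).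
by rewrite !mulr0 expr0n /= subrr oppr0.
Qed.

(** By density some finite combination of length [M] is within [eps] of [f]. The Fourier
    coefficients do at least as well for the same length, by completing the square in each
    coefficient, and longer sums only come closer. *)
Lemma parseval f : rk_car H f ->
  \sum_(i < M) rk_ip H f (masked i) ^+ 2 @[M --> \oo] --> rk_ip H f f.
Proof.
move=> cf; apply/cvgrPdist_lt => eps e0.
pose V : set (T -> R) := [set v | exists (c : nat -> R) M, v = fun x => \sum_(i < M) c i * masked i x].
have linV : lin_closed V.
  split; first by exists (fun=> 0), 0%N; apply/funext => x; rewrite big_ord0.
  move=> a _ _ [c [M ->]] [c' [M' ->]].
  (* The indicators cut each coefficient sequence at its own length before both are summed up to the
     larger one. *)
  exists (fun i => a * (c i * (i < M)%N%:R) + c' i * (i < M')%N%:R), (maxn M M').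
  have ext (d : nat -> R) N N' x : (N <= N')%N ->
      \sum_(i < N) d i * masked i x =
      \sum_(i < N') (d i * (i < N)%N%:R) * masked i x.
    move=> NN'; rewrite (big_ord_widen _ (fun i => d i * masked i x) NN').
    rewrite big_mkcond /=; apply: eq_bigr => i _.
    by case: ifP => _; rewrite ?mulr1 // mulr0 mul0r.
  apply/funext => x; rewrite (ext c _ _ x (leq_maxl M M')).
  rewrite (ext c' _ _ x (leq_maxr M M')) mulr_sumr -big_split /=.
  by apply: eq_bigr => i _; rewrite mulrDl !mulrA.
have [| |_ [c [M ->]] cM] := rk_density linV _ _ cf e0.
- move=> _ [c [M ->]]; apply: (lin_closed_sum lc) => i.
  by apply: (lin_closedZ lc); exact: masked_car.
- move=> g cg gV; case: onb => _ _; apply => // i Di.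
  have <- : masked i = e i by rewrite /masked mem_set.
  apply: gV; exists (fun k => (k == i)%:R), i.+1; apply/funext => x.
  rewrite (bigD1 ord_max) //= eqxx mul1r big1 ?addr0 // => k ki.
  by rewrite (negPf (_ : (k : nat) != i)) ?mul0r.
exists M => // N /= MN.
rewrite ger0_norm ?subr_ge0 ?bessel //.
rewrite (le_lt_trans _ cM) // partial_sum_dist // lerD2l -sumrN.
apply: (@le_trans _ _ (\sum_(i < M) - rk_ip H f (masked i) ^+ 2)).
  rewrite !sumrN lerN2 (big_ord_widen _ (fun i => rk_ip H f (masked i) ^+ 2) MN).
  rewrite big_mkcond /= ler_sum // => i _; case: ifP => // _; exact: sqr_ge0.
by apply: ler_sum => i _; exact: masked_sqr_ip.
Qed.

Lemma parseval2 f g : rk_car H f -> rk_car H g ->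
  \sum_(i < M) rk_ip H f (masked i) * rk_ip H g (masked i) @[M --> \oo]
    --> rk_ip H f g.
Proof.
move=> cf cg.
have cD := lin_closedD lc cf cg.
have -> : rk_ip H f g = 2^-1 * (rk_ip H (fun x => f x + g x) (fun x => f x + g x)
    - rk_ip H f f - rk_ip H g g).
  have := form_sqrD lc ipf 1 cf cg; under eq_fun do rewrite mul1r.
  by move=> ->; field.
have -> : (fun M => \sum_(i < M) rk_ip H f (masked i) * rk_ip H g (masked i)) =
  (fun M => 2^-1 * (\sum_(i < M) rk_ip H (fun x => f x + g x) (masked i) ^+ 2
    - \sum_(i < M) rk_ip H f (masked i) ^+ 2
    - \sum_(i < M) rk_ip H g (masked i) ^+ 2)).
  apply/funext => M; rewrite -!sumrB mulr_sumr; apply: eq_bigr => i _.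
  by rewrite (formDl ipf) //; [field|exact: masked_car].
apply: cvgMr; apply: cvgB; last exact: parseval.
by apply: cvgB; exact: parseval.
Qed.

End parseval.
End reproducing_kernel.

(** * The covariance form and its resolvent *)

Section covariance.
Context {R : realType} {d : measure_display} {X : measurableType d}.
Variables (H : rkhs R X) (mu : probability X R) (kappa : R).
Hypothesis hH : is_rkhs H.
Hypothesis mker : forall x, measurable_fun setT (rk_ker H x).
Hypothesis ker_le : forall x, rk_ker H x x <= kappa ^+ 2.
Implicit Types (f g h u v : X -> R) (a : R) (V : set (X -> R)).

Let lc := rk_lin_closed hH.
Let ipf := rk_psd_form hH.

(** Finite combinations of kernel sections are measurable, and they are dense since a function
    orthogonal to all sections vanishes by reproduction. Norm convergence implies pointwise
    convergence through [rk_eval_sqr]. *)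
Lemma rk_measurable f : rk_car H f -> measurable_fun setT f.
Proof.
move=> cf.
pose V : set (X -> R) := [set v | exists s : seq (R * X),
  v = fun x => \sum_(q <- s) q.1 * rk_ker H q.2 x].
have Vc : V `<=` rk_car H.
  move=> _ [s ->]; apply: (lin_closed_sum lc) => q.
  by apply: (lin_closedZ lc); exact: rk_ker_car.
have linV : lin_closed V.
  split; first by exists [::]; apply/funext => x; rewrite big_nil.
  move=> a _ _ [s ->] [s' ->]; exists ([seq (a * q.1, q.2) | q <- s] ++ s').
  apply/funext => x; rewrite big_cat big_map /= mulr_sumr; congr (_ + _).
  by apply: eq_bigr => q _; rewrite mulrA.
have total g : rk_car H g -> (forall v, V v -> rk_ip H g v = 0) -> g = (fun=> 0).
  move=> cg gV; apply/funext => x; rewrite -(rk_reproducing hH) //; apply: gV.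
  by exists [:: (1, x)]; apply/funext => y; rewrite big_seq1 mul1r.
have ex n : exists v, V v /\
    rk_ip H (fun x => f x - v x) (fun x => f x - v x) < n.+1%:R^-1.
  have n0 : 0 < n.+1%:R^-1 :> R by rewrite invr_gt0.
  by have [v Vv vP] := rk_density hH linV Vc total cf n0; exists v.
have [v vP] := choice ex.
apply: (@measurable_fun_cvg _ _ _ _ v).
  move=> n; have [s ->] := (vP n).1.
  by apply: measurable_sum => q; apply: measurable_funM => //; exact: measurable_cst.
move=> x _; apply/cvgrPdist_lt => eps e0.
pose K := rk_ker H x x + 1.
have K0 : 0 < K by rewrite ltr_wpDl // rk_ker_ge0.
have eK : 0 < eps ^+ 2 / K by rewrite divr_gt0 // exprn_gt0.
have [N _ NP] := near_infty_natSinv_lt (PosNum eK).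
exists N => // n /NP /= nN.
rewrite -(@ltr_pXn2r _ 2) ?nnegrE //; last exact: ltW.
rewrite real_normK ?num_real //.
have cd : rk_car H (fun x => f x - v n x) by apply: (lin_closedB lc) => //; exact: Vc (vP n).1.
apply: le_lt_trans (rk_eval_sqr hH x cd) _.
rewrite mulrC (le_lt_trans (_ : _ <= n.+1%:R^-1 * K)) -?ltr_pdivlMr //.
apply: ler_pM; [exact: form_ge0 ipf _ cd|exact: rk_ker_ge0|exact: ltW (vP n).2|].
by rewrite /K lerDl.
Qed.

Lemma rk_bounded f x : rk_car H f -> f x ^+ 2 <= kappa ^+ 2 * rk_ip H f f.
Proof.
move=> cf; apply: le_trans (rk_eval_sqr hH x cf) _.
by rewrite ler_wpM2r // (form_ge0 ipf).
Qed.

Lemma rk_integrable f g : rk_car H f -> rk_car H g ->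
  mu.-integrable setT (EFin \o (fun x => f x * g x)).
Proof.
move=> cf cg.
have mf := rk_measurable cf; have mg := rk_measurable cg.
apply: (@le_integrable _ _ _ mu setT measurableT _
  (EFin \o cst (kappa ^+ 2 * rk_ip H f f + kappa ^+ 2 * rk_ip H g g))).
- by apply/measurable_EFinP; exact: measurable_funM.
- move=> x _; rewrite /= lee_fin.
  have := rk_bounded x cf; have := rk_bounded x cg.
  have := sqr_ge0 (f x); have := sqr_ge0 (g x) => g0 f0 hg hf.
  rewrite [leRHS]ger0_norm; last by rewrite addr_ge0 // (le_trans _ hf, le_trans _ hg).
  rewrite ler_norml; have := sqr_ge0 (f x + g x); have := sqr_ge0 (f x - g x).
  by rewrite !expr2 in f0 g0 hf hg * => *; apply/andP; split; nra.
- exact: finite_measure_integrable_cst.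
Qed.

(** This is [<T f, g>] for the covariance operator [T]; working with the form postpones every appeal
    to the chosen operator. *)
Definition cov_form f g : R := \int[mu]_x (f x * g x).

Lemma cov_psd_form : psd_form (rk_car H) cov_form.
Proof.
split.
- move=> a f g h cf cg ch.
  rewrite /cov_form -RintegralZl //; last exact: rk_integrable.
  rewrite -RintegralD //; last 2 first.
  + have := integrableZl measurableT a (rk_integrable cf ch).
    by apply: eq_integrable.
  + exact: rk_integrable.
  by apply: eq_Rintegral => x _; ring.
- by move=> f g _ _; apply: eq_Rintegral => x _; rewrite mulrC.
- by move=> f cf; apply: Rintegral_ge0 => x _; rewrite -expr2 sqr_ge0.
Qed.

Lemma cov_form_le f : rk_car H f -> cov_form f f <= kappa ^+ 2 * rk_ip H f f.
Proof.
move=> cf; set c := _ * _.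
have -> : c = \int[mu]_x c.
  rewrite Rintegral_cst // -[LHS]mulr1; congr (_ * _).
  by rewrite [X in fine X]probability_setT.
apply: le_Rintegral => //; first exact: rk_integrable.
  exact: finite_measure_integrable_cst.
by move=> x _; rewrite -expr2 rk_bounded.
Qed.

(** The Riesz representation of the bounded functional [cov_form h] shows that the weak integral
    exists, so [xget] returns it and not its default 0. *)
Lemma covariance_opP h : rk_car H h ->
  rk_car H (covariance_op H mu h) /\
  forall g, rk_car H g -> rk_ip H (covariance_op H mu h) g = cov_form h g.
Proof.
move=> ch; rewrite /covariance_op /expectation_in.
set P := [set v | _].
suff : P (xget (fun=> 0) P).
  move=> [cv vP]; split=> // g cg; rewrite vP // /cov_form /Rintegral.
  congr fine; apply: eq_integral => x _; congr EFin.
  rewrite /tensor (formZl lc ipf) //; last exact: rk_ker_car.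
  rewrite (rk_reproducing hH) // (form_sym ipf) ?(rk_reproducing hH) //.
  exact: rk_ker_car.
apply: xgetPex.
have [||||u_ [u [Vu cu uu uP]]] := @variational_problem _ _ _ hH (rk_car H)
    (rk_ip H) (cov_form h) 1 1 (cov_form h h * kappa ^+ 2) lc (@subset_refl _ _) ipf ltr01.
- by move=> g _; rewrite mul1r.
- by move=> g _; rewrite mul1r.
- move=> a f g cf cg; rewrite (form_sym cov_psd_form) // ?(form_lin cov_psd_form) //.
    by congr (_ * _ + _); rewrite (form_sym cov_psd_form).
  exact: (rk_lin hH).
- move=> g cg; apply: le_trans (form_CS lc cov_psd_form ch cg) _.
  rewrite -mulrA ler_wpM2l //; first exact: form_ge0 cov_psd_form _ ch.
  exact: cov_form_le.
exists u; split=> // g cg; rewrite uP // /cov_form /Rintegral.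
congr fine; apply: eq_integral => x _; congr EFin.
rewrite /tensor (formZl lc ipf) //; last exact: rk_ker_car.
rewrite (rk_reproducing hH) // (form_sym ipf) ?(rk_reproducing hH) //.
exact: rk_ker_car.
Qed.

Section resolvent.
Variable lam : R.
Hypothesis lam0 : 0 < lam.

(** The form [cov + lam ip] is coercive with constant [lam]. This solves [(T + lam) w = f] and
    [(T + lam) u = T h] by the choice of [L]. *)
Lemma resolvent_exists (L : (X -> R) -> R) (CL : R) :
  (forall a f g, rk_car H f -> rk_car H g ->
    L (fun x => a * f x + g x) = a * L f + L g) ->
  (forall f, rk_car H f -> L f ^+ 2 <= CL * rk_ip H f f) ->
  exists2 w, rk_car H w &
    forall g, rk_car H g -> cov_form w g + lam * rk_ip H w g = L g.
Proof.
move=> Llin CLP.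
have [||||u_ [u [Vu cu uu uP]]] := @variational_problem _ _ _ hH (rk_car H)
    (fun f g => cov_form f g + lam * rk_ip H f g) L lam (kappa ^+ 2 + lam) CL lc
    (@subset_refl _ _) (psd_formD (ltW lam0) cov_psd_form ipf) lam0.
- by move=> f cf; rewrite lerDr (form_ge0 cov_psd_form).
- by move=> f cf; rewrite mulrDl lerD2r cov_form_le.
- exact: Llin.
- exact: CLP.
by exists u.
Qed.

Lemma tikhonov_exists f : rk_car H f -> exists2 w, rk_car H w &
  forall g, rk_car H g -> cov_form w g + lam * rk_ip H w g = rk_ip H f g.
Proof.
move=> cf; apply: (@resolvent_exists _ (rk_ip H f f)).
- move=> a g h cg ch; rewrite (form_sym ipf) ?(form_lin ipf) //.
    by congr (_ * _ + _); rewrite (form_sym ipf).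
  exact: (rk_lin hH).
- by move=> g cg; exact: (form_CS lc ipf).
Qed.

(** Here [u] is [(T + lam)^-1 T h]. The weak solution is turned into an equality of functions by
    testing against kernel sections, which gives [xget] a genuine preimage to choose. *)
Lemma op_invP h : rk_car H h ->
  let u := op_inv H (fun f x => covariance_op H mu f x + lam * f x)
    (covariance_op H mu h) in
  rk_car H u /\ forall g, rk_car H g ->
    cov_form u g + lam * rk_ip H u g = cov_form h g.
Proof.
move=> ch; rewrite /op_inv /=; set P := [set f | _].
have : P (xget (fun=> 0) P).
  apply: xgetPex.
  have [||w cw wP] := @resolvent_exists (cov_form h) (cov_form h h * kappa ^+ 2).
  - move=> a f g cf cg; rewrite (form_sym cov_psd_form) // ?(form_lin cov_psd_form) //.
      by congr (_ * _ + _); rewrite (form_sym cov_psd_form).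
    exact: (rk_lin hH).
  - move=> g cg; apply: le_trans (form_CS lc cov_psd_form ch cg) _.
    rewrite -mulrA ler_wpM2l //; first exact: form_ge0 cov_psd_form _ ch.
    exact: cov_form_le.
  exists w; split=> //; apply/funext => x.
  have ck := rk_ker_car hH x.
  have [cTw Tw] := covariance_opP cw; have [cTh Th] := covariance_opP ch.
  by rewrite -(rk_reproducing hH x cTw) -(rk_reproducing hH x cTh) Tw // Th //
    -[w in lam * w x]/(w) -(rk_reproducing hH x cw) wP.
move=> [cu uP]; split=> // g cg.
have [cTh Th] := covariance_opP ch; have [cTu Tu] := covariance_opP cu.
rewrite -Th // -Tu // -uP (formDl ipf) ?(formZl lc ipf) //.
exact: (lin_closedZ lc).
Qed.

End resolvent.

End covariance.

(** * Consequences of the source condition; the effective dimension *)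

Section spectral_estimates.
Context {R : realType} {d : measure_display} {X : measurableType d}.
Variables (H : rkhs R X) (mu : probability X R) (kappa lam : R).
Hypothesis hH : is_rkhs H.
Hypothesis mker : forall x, measurable_fun setT (rk_ker H x).
Hypothesis ker_le : forall x, rk_ker H x x <= kappa ^+ 2.
Hypothesis lam0 : 0 < lam.
Implicit Types (f g h u v w : X -> R).

Let lc := rk_lin_closed hH.
Let ipf := rk_psd_form hH.
Let covf := cov_psd_form mu hH mker ker_le.
Let cov f g := cov_form mu f g.

(** Since [t^(2 r) <= (t + lam)^(2 r)], the quotient is at most [(t + lam)^(2 r - 1)]. For
    [r <= 1/2] this exponent is nonpositive, so [t] may be dropped; here the range of the smoothness
    matters. *)
Lemma powR_filter_le (r t : R) : 0 < r -> r <= 2^-1 -> 0 <= t ->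
  t `^ r ^+ 2 / (t + lam) <= lam `^ (2 * r - 1).
Proof.
move=> r0 r2 t0; rewrite ler_pdivrMr ?ltr_wpDl //.
have -> : t `^ r ^+ 2 = t `^ (2 * r) by rewrite -powR_mulrn ?powR_ge0 // -powRrM mulrC.
have t10 : 0 < t + lam by rewrite ltr_wpDl.
apply: (@le_trans _ _ ((t + lam) `^ (2 * r - 1) * (t + lam))); last first.
  rewrite ler_wpM2r ?(ltW t10) //.
  have -> : 2 * r - 1 = - (1 - 2 * r) by ring.
  rewrite !powRN lef_pV2 ?posrE ?powR_gt0 //.
  by apply: ge0_ler_powR; rewrite ?nnegrE ?(ltW lam0) ?(ltW t10) ?lerDr //; lra.
rewrite -[X in _ `^ _ * X]powRr1 ?(ltW t10) // -powRD; last by rewrite (gt_eqF t10) implybT.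
rewrite subrK; apply: ge0_ler_powR; rewrite ?nnegrE ?(ltW t10) ?lerDl ?(ltW lam0) //; lra.
Qed.

(** In the eigenbasis supplied by the source condition, [<f, (T + lam)^-1 f>] is the sum of
    [mu_i^(2 r) / (mu_i + lam) <h, e_i>^2]. The filter bound and Bessel's inequality for [h]
    finish. *)
Lemma source_condition_le (r B : R) f w : 0 < r -> r <= 2^-1 ->
  source_condition H (covariance_op H mu) r B f -> rk_car H w ->
  (forall g, rk_car H g -> cov w g + lam * rk_ip H w g = rk_ip H f g) ->
  rk_ip H f w <= lam `^ (2 * r - 1) * B ^+ 2.
Proof.
move=> r0 r2 [h [ch hB [cf [D [e [m [onb eig coef]]]]]]] cw wP.
have hh : rk_ip H h h <= B ^+ 2.
  have h0 := form_ge0 ipf ch.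
  rewrite -(sqr_sqrtr h0) ler_sqr ?nnegrE ?sqrtr_ge0 //.
  exact: le_trans (sqrtr_ge0 _) hB.
have L0 : 0 <= lam `^ (2 * r - 1) by exact: powR_ge0.
apply: (@le_trans _ _ (lam `^ (2 * r - 1) * rk_ip H h h)); last by rewrite ler_wpM2l.
have cv := parseval2 hH onb cf cw.
rewrite -(cvg_lim (@Rhausdorff R) cv); apply: limr_le; first by apply/cvg_ex; eexists; exact: cv.
near=> M.
apply: le_trans (ler_wpM2l L0 (bessel hH onb M ch)).
rewrite mulr_sumr; apply: ler_sum => i _.
rewrite /masked; case: ifPn => [/set_mem Di|_]; last first.
  rewrite (form_sym ipf cf) ?(form0l lc ipf) //; last exact: (lin_closed0 lc).
  by rewrite mul0r mulr_ge0 // sqr_ge0.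
have [ce _ _] := onb; have cei := ce _ Di.
have [m0 Te] := eig _ Di.
have mlam : 0 < m i + lam by rewrite ltr_wpDl.
(* The weak equation for [w] tested against the eigenvector [e i]. *)
have we : rk_ip H w (e i) = m i `^ r * rk_ip H h (e i) / (m i + lam).
  apply: (canRL (mulfK (lt0r_neq0 mlam))); rewrite -coef // -wP // mulrC mulrDl.
  congr (_ + _); rewrite /cov (form_sym covf) //.
  have [cT <-] := covariance_opP mu hH mker ker_le cei; last exact: cw.
  by rewrite Te (formZl lc ipf) // (form_sym ipf).
rewrite coef // we.
have -> : m i `^ r * rk_ip H h (e i) * (m i `^ r * rk_ip H h (e i) / (m i + lam)) =
  (m i `^ r ^+ 2 / (m i + lam)) * rk_ip H h (e i) ^+ 2 by field; rewrite gt_eqF.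
by rewrite ler_wpM2r ?sqr_ge0 // powR_filter_le.
Unshelve. all: by end_near.
Qed.

(** The weak equation is tested against [h - u]. Divided by [lam], the identity says that
    [<h, T (T + lam)^-1 h>] is the value at [u] of an expression linear in [T], and in particular
    nonnegative. *)
Lemma resolvent_energy h u : rk_car H h -> rk_car H u ->
  (forall g, rk_car H g -> cov u g + lam * rk_ip H u g = cov h g) ->
  cov (fun x => h x - u x) (fun x => h x - u x) + lam * rk_ip H u u =
  lam * rk_ip H u h.
Proof.
move=> ch cu uP; have cd := lin_closedB lc ch cu.
have := uP _ cd; rewrite /cov (formBl covf) // (formBr lc ipf) // => E.
lra.
Qed.

(** The trace is attached to a basis of its own choosing, which is why [D] and [e] are produced
    here. The given basis only ensures that a choice exists; otherwise the trace would be the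
    default 0 and bound nothing. *)
Lemma effective_dim_basis D0 e0 : orthonormal_basis H D0 e0 ->
  exists D e (u : nat -> X -> R), [/\ orthonormal_basis H D e,
    forall i, rk_car H (u i) /\ (forall g, rk_car H g ->
      cov (u i) g + lam * rk_ip H (u i) g = cov (masked D e i) g),
    forall i, 0 <= rk_ip H (u i) (masked D e i) &
    forall M, (\sum_(i < M) (rk_ip H (u i) (masked D e i))%:E <=
      effective_dim H (covariance_op H mu) lam)%E].
Proof.
move=> onb0; rewrite /effective_dim /op_trace.
pose B h := op_inv H (fun f x => covariance_op H mu f x + lam * f x)
  (covariance_op H mu h).
set P := (X in xget _ X).
have : P (xget 0%E P) by apply: xgetPex; eexists; exists D0, e0.
move=> [D [e [onb ->]]].
have cm i : rk_car H (masked D e i) by exact: masked_car.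
have BP i := op_invP mu hH mker ker_le lam0 (cm i).
have pos i : 0 <= rk_ip H (B (masked D e i)) (masked D e i).
  have [cB BE] := BP i.
  rewrite -(pmulr_rge0 _ lam0) -(resolvent_energy (cm i) cB BE).
  rewrite addr_ge0 ?(form_ge0 covf) //; first exact: (lin_closedB lc).
  by rewrite mulr_ge0 ?(form_ge0 ipf) // ltW.
exists D, e, (fun i => B (masked D e i)); split=> // M.
rewrite esum_mkcond.
have -> : (fun i => if i \in D then (rk_ip H (B (e i)) (e i))%:E else 0%E) =
    (fun i => (rk_ip H (B (masked D e i)) (masked D e i))%:E).
  apply/funext => i; case: ifPn => iD.
    by have -> : masked D e i = e i by rewrite /masked iD.
  have E : masked D e i = (fun=> 0) by rewrite /masked (negPf iD).
  rewrite [X in rk_ip H _ X]E (form_sym ipf (BP i).1) ?(form0l lc ipf) //.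
  - exact: (BP i).1.
  - exact: (lin_closed0 lc).
rewrite -nneseries_esumT => [|i]; last by rewrite lee_fin.
rewrite -(big_mkord xpredT (fun i => (rk_ip H (B (masked D e i)) (masked D e i))%:E)).
by apply: nneseries_lim_ge => i _ _; rewrite lee_fin.
Qed.

End spectral_estimates.

Lemma cvg_sum_seq (R : realType) (I : Type) (r : seq I) (u : I -> nat -> R) (l : I -> R) :
  (forall i, u i M @[M --> \oo] --> l i) ->
  \sum_(i <- r) u i M @[M --> \oo] --> \sum_(i <- r) l i.
Proof.
move=> ul; elim: r => [|i r IH].
  by under eq_fun do rewrite big_nil; rewrite big_nil; exact: cvg_cst.
by under eq_fun do rewrite big_cons; rewrite big_cons; apply: cvgD.
Qed.

(** * Ridge regression on a fixed set of points *)

Section ridge_regression.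
Context {R : realType} {T : Type}.
Variables (H : rkhs R T) (s : R).
Hypothesis hH : is_rkhs H.
Hypothesis s0 : 0 < s.
Implicit Types (f g h u v : T -> R).

Let lc := rk_lin_closed hH.
Let ipf := rk_psd_form hH.
Let K := rk_ker H.

(** For [y = f \o p] the entry [i] is [<f, A^-1 K_(p i)>], where [A] is the sum of the
    [K_(p l) (x) K_(p l)] plus [s]. *)
Definition ridge n (p : 'I_n -> T) (y : 'I_n -> R) (i : 'I_n) : R :=
  (invmx ((\matrix_(i, l) rk_ker H (p i) (p l)) + s%:M) *m \col_i y i) i 0.

Definition kcomb n (p : 'I_n -> T) (c : 'I_n -> R) : T -> R :=
  fun x => \sum_i c i * rk_ker H (p i) x.

Lemma kcomb_car n (p : 'I_n -> T) c : rk_car H (kcomb p c).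
Proof.
by apply: (lin_closed_sum lc) => i; apply: (lin_closedZ lc); exact: rk_ker_car.
Qed.

#[local] Hint Resolve kcomb_car : core.

Lemma ip_kcomb n (p : 'I_n -> T) c f : rk_car H f ->
  rk_ip H f (kcomb p c) = \sum_i c i * f (p i).
Proof.
move=> cf; have ck i : rk_car H (rk_ker H (p i)) by exact: rk_ker_car.
rewrite (form_sumr lc ipf) // => [|i]; last exact: (lin_closedZ lc).
by apply: eq_bigr => i _; rewrite (formZr lc ipf) // (rk_reproducing hH).
Qed.

(** For [v] in the left kernel, [v (G + s) v^T] is the squared norm of a kernel combination plus
    [s |v|^2], so [v = 0]. *)
Lemma regularized_gram_unit n (p : 'I_n -> T) :
  (\matrix_(i, l) K (p i) (p l)) + s%:M \in unitmx.
Proof.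
rewrite -row_free_unit -kermx_eq0; apply/eqP/row_matrixP => i; rewrite row0.
set M := _ + _; set v := row i _.
have vM : v *m M = 0 by rewrite /v -row_mul mulmx_ker row0.
pose c l := v 0 l.
have : rk_ip H (kcomb p c) (kcomb p c) + s * \sum_l c l ^+ 2 = 0.
  transitivity ((v *m M *m v^T) 0 0); last by rewrite vM mul0mx mxE.
  rewrite ip_kcomb // mxE mulr_sumr -big_split /=; apply: eq_bigr => l _.
  rewrite [v^T l 0]mxE mxE /kcomb expr2 [RHS]mulrC mulrCA -mulrDr; congr (_ * _).
  rewrite [in RHS](eq_bigr (fun j => c j * K (p j) (p l) + c j * (s *+ (j == l)))).
    rewrite big_split /=; congr (_ + _).
    rewrite (bigD1 l) //= eqxx big1 ?addr0 1?mulrC // => j jl.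
    by rewrite (negPf jl) mulr0n mulr0.
  move=> j _; have -> : M j l = K (p j) (p l) + s *+ (j == l) by rewrite !mxE.
  exact: mulrDr.
have h1 : 0 <= rk_ip H (kcomb p c) (kcomb p c) by exact: (form_ge0 ipf).
have h2 : 0 <= s * \sum_l c l ^+ 2.
  by rewrite mulr_ge0 ?(ltW s0) // sumr_ge0 // => l _; exact: sqr_ge0.
move=> /eqP; rewrite paddr_eq0 //.
move=> /andP[_]; rewrite mulf_eq0 gt_eqF //= psumr_eq0; last first.
  by move=> l _; exact: sqr_ge0.
move=> /allP h; apply/rowP => l; rewrite [RHS]mxE; apply/eqP.
by have := h l (mem_index_enum _); rewrite /= sqrf_eq0.
Qed.

Lemma ridgeP n (p : 'I_n -> T) y i :
  \sum_l K (p i) (p l) * ridge p y l + s * ridge p y i = y i.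
Proof.
have := mulKVmx (regularized_gram_unit p) (\col_i y i).
move=> /colP/(_ i); rewrite [RHS]mxE => <-; rewrite mxE.
rewrite [in RHS](eq_bigr (fun j => K (p i) (p j) * ridge p y j + (s *+ (i == j)) * ridge p y j)).
  rewrite big_split /=; congr (_ + _).
  rewrite (bigD1 i) //= eqxx big1 ?addr0 // => j ji.
  by rewrite eq_sym (negPf ji) mulr0n mul0r.
by move=> j _; rewrite mxE [in X in X * _]mxE [in X in (_ + X) * _]mxE mulrDl.
Qed.

(** Linearity, relabelling and leave-one-out are all deduced by exhibiting a solution of the linear
    system, without handling inverse matrices. *)
Lemma ridge_unique n (p : 'I_n -> T) y (c : 'I_n -> R) :
  (forall i, \sum_l K (p i) (p l) * c l + s * c i = y i) -> c = ridge p y.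
Proof.
move=> cP; apply/funext => i.
rewrite /ridge; have -> : \col_i y i =
    ((\matrix_(i, l) K (p i) (p l)) + s%:M) *m (\col_i c i).
  apply/colP => j; rewrite mxE -cP mxE.
  rewrite [in RHS](eq_bigr (fun l => K (p j) (p l) * c l + (s *+ (j == l)) * c l)).
    rewrite big_split /=; congr (_ + _).
    rewrite (bigD1 j) //= eqxx big1 ?addr0 // => l lj.
    by rewrite eq_sym (negPf lj) mulr0n mul0r.
  by move=> l _; rewrite !mxE mulrDl.
by rewrite mulKmx ?regularized_gram_unit // mxE.
Qed.

Lemma ridgeD n (p : 'I_n -> T) a y y' :
  (fun i => a * ridge p y i + ridge p y' i) = ridge p (fun i => a * y i + y' i).
Proof.
apply: ridge_unique => i; rewrite -(ridgeP p y i) -(ridgeP p y' i).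
rewrite !mulrDr addrACA; congr (_ + _); last by ring.
by rewrite mulr_sumr -big_split /=; apply: eq_bigr => l _; ring.
Qed.

Lemma ridge0 n (p : 'I_n -> T) : ridge p (fun=> 0) = (fun=> 0).
Proof. by apply/esym/ridge_unique => i; rewrite big1 ?mulr0 ?addr0 // => l _; rewrite mulr0. Qed.

Lemma ridge_perm n (p : 'I_n -> T) y (t : 'I_n -> 'I_n) : injective t ->
  ridge (p \o t) (y \o t) = ridge p y \o t.
Proof.
move=> ti; apply/esym/ridge_unique => i /=; rewrite -(ridgeP p y (t i)); congr (_ + _).
by rewrite [RHS](reindex_inj ti).
Qed.

Definition unit_at n (l : 'I_n) : 'I_n -> R := fun i => (i == l)%:R.

Lemma ridgeE n (p : 'I_n -> T) y i :
  ridge p y i = \sum_l ridge p (unit_at l) i * y l.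
Proof.
suff <- : (fun i => \sum_l ridge p (unit_at l) i * y l) = ridge p y by [].
apply: ridge_unique => j; rewrite -[RHS]mul1r.
under eq_bigr do rewrite mulr_sumr.
rewrite exchange_big /= mulr_sumr -big_split /=.
rewrite (eq_bigr (fun l => (j == l)%:R * y l)).
  rewrite (bigD1 j) //= eqxx big1 ?addr0 // => l lj.
  by rewrite eq_sym (negPf lj) mul0r.
move=> l _; rewrite mulrA -(ridgeP p (unit_at l) j : _ = (j == l)%:R) mulrDl; congr (_ + _).
by rewrite mulr_suml; apply: eq_bigr => k _; rewrite mulrA.
Qed.

(** This is [s <f, A^-1 f>], and also the minimum over [c] of [ridge_obj p f c], where the penalty
    is on the coefficients and not on the norm of the combination. *)
Definition ridge_val n (p : 'I_n -> T) f :=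
  rk_ip H f f - \sum_i ridge p (f \o p) i * f (p i).

Definition ridge_obj n (p : 'I_n -> T) f c :=
  rk_ip H (fun x => f x - kcomb p c x) (fun x => f x - kcomb p c x) +
  s * \sum_i c i ^+ 2.

Lemma ridge_pairing n (p : 'I_n -> T) f (c : 'I_n -> R) :
  \sum_i c i * f (p i) = rk_ip H (kcomb p (ridge p (f \o p))) (kcomb p c) +
    s * \sum_i c i * ridge p (f \o p) i.
Proof.
rewrite ip_kcomb // mulr_sumr -big_split /=; apply: eq_bigr => i _.
rewrite -[f (p i)](ridgeP p (f \o p) i) mulrDr mulrCA; congr (_ * _ + _).
by apply: eq_bigr => l _; rewrite mulrC; congr (_ * _); exact: rk_kerC.
Qed.

Lemma ridge_pairing_diag n (p : 'I_n -> T) f :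
  \sum_i ridge p (f \o p) i * f (p i) =
  rk_ip H (kcomb p (ridge p (f \o p))) (kcomb p (ridge p (f \o p))) +
    s * \sum_i ridge p (f \o p) i ^+ 2.
Proof. exact: ridge_pairing. Qed.

Lemma ridge_obj_min n (p : 'I_n -> T) f : rk_car H f ->
  ridge_obj p f (ridge p (f \o p)) = ridge_val p f.
Proof.
move=> cf; rewrite /ridge_obj (form_sqrB lc ipf) // [rk_ip H f (kcomb _ _)]ip_kcomb //.
rewrite /ridge_val (ridge_pairing_diag p f); ring.
Qed.

(** The gap equals the squared norm of [kcomb p al - kcomb p c] plus [s |al - c|^2], with [al] the
    ridge coefficients of [f]. Upper bounds on [ridge_val] then come from trial coefficients. *)
Lemma ridge_val_le_obj n (p : 'I_n -> T) f c : rk_car H f ->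
  ridge_val p f <= ridge_obj p f c.
Proof.
move=> cf; rewrite /ridge_obj (form_sqrB lc ipf) // [rk_ip H f (kcomb _ _)]ip_kcomb //.
rewrite /ridge_val ridge_pairing_diag (ridge_pairing p f c).
set al := ridge p (f \o p).
have ge1 := form_ge0 ipf (lin_closedB lc (kcomb_car p al) (kcomb_car p c)).
rewrite (form_sqrB lc ipf) // in ge1.
have ge2 : 0 <= s * (\sum_i al i ^+ 2 - 2 * \sum_i c i * al i + \sum_i c i ^+ 2).
  rewrite mulr_ge0 ?(ltW s0) // mulr_sumr -sumrB -big_split /= sumr_ge0 // => i _.
  by have := sqr_ge0 (al i - c i); rewrite !expr2; lra.
lra.
Qed.

Lemma ridge_val_ge0 n (p : 'I_n -> T) f : rk_car H f -> 0 <= ridge_val p f.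
Proof.
move=> cf; rewrite -ridge_obj_min // addr_ge0 //.
  by apply: (form_ge0 ipf); apply: (lin_closedB lc) => //; exact: kcomb_car.
by rewrite mulr_ge0 ?(ltW s0) // sumr_ge0 // => i _; exact: sqr_ge0.
Qed.

Lemma ridge_sqr_le_val n (p : 'I_n -> T) f : rk_car H f ->
  s * \sum_i ridge p (f \o p) i ^+ 2 <= ridge_val p f.
Proof.
move=> cf; rewrite -ridge_obj_min // lerDr.
by apply: (form_ge0 ipf); apply: (lin_closedB lc) => //; exact: kcomb_car.
Qed.

Lemma ridge_val_le n (p : 'I_n -> T) f : rk_car H f -> ridge_val p f <= rk_ip H f f.
Proof.
move=> cf; apply: le_trans (ridge_val_le_obj p (fun=> 0) cf) _.
rewrite /ridge_obj big1 ?mulr0 ?addr0; last by move=> i _; rewrite expr0n.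
have -> // : (fun x => f x - kcomb p (fun=> 0) x) = f.
by apply/funext => x; rewrite /kcomb big1 ?subr0 // => i _; rewrite mul0r.
Qed.

Lemma ridge_valD n (p : 'I_n -> T) f g : rk_car H f -> rk_car H g ->
  ridge_val p (fun x => f x + g x) <= 2 * ridge_val p f + 2 * ridge_val p g.
Proof.
move=> cf cg; set al := ridge p (f \o p); set be := ridge p (g \o p).
have cD := lin_closedD lc cf cg.
apply: le_trans (ridge_val_le_obj p (fun i => al i + be i) cD) _.
rewrite -!ridge_obj_min // -/al -/be /ridge_obj.
have cfa := lin_closedB lc cf (kcomb_car p al).
have cgb := lin_closedB lc cg (kcomb_car p be).
have := form_sqrD_le lc ipf cfa cgb.
have -> : (fun x => f x - kcomb p al x + (g x - kcomb p be x)) =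
    (fun x => f x + g x - kcomb p (fun i => al i + be i) x).
  apply/funext => x; rewrite addrACA -opprD; congr (_ - _); rewrite /kcomb -big_split /=.
  by apply: eq_bigr => i _; rewrite mulrDl.
move=> h1.
have : s * \sum_i (al i + be i) ^+ 2 <= s * (2 * \sum_i al i ^+ 2 + 2 * \sum_i be i ^+ 2).
  rewrite ler_pM2l // !mulr_sumr -big_split /=; apply: ler_sum => i _.
  by have := sqr_ge0 (al i - be i); rewrite !expr2; lra.
lra.
Qed.

(** With [B] the sum of the [K_(p i) (x) K_(p i)], the left side is [<f, B (B + s)^-1 f>] and the
    right side is [<f - u, B (f - u)> / s + <u, u>]. The latter is linear in [B], so a fixed [u]
    allows its expectation to be taken; the proof completes two squares. *)
Lemma ridge_energy_le n (p : 'I_n -> T) f u : rk_car H f -> rk_car H u ->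
  \sum_i ridge p (f \o p) i * f (p i) <=
  s^-1 * \sum_i (f (p i) - u (p i)) ^+ 2 + rk_ip H u u.
Proof.
move=> cf cu; set al := ridge p (f \o p).
have E := ridge_pairing_diag p f; rewrite -/al in E.
have ge1 := form_ge0 ipf (lin_closedB lc cu (kcomb_car p al)).
rewrite (form_sqrB lc ipf) // ip_kcomb // in ge1.
have ge2 : 2 * \sum_i al i * (f (p i) - u (p i)) - s * \sum_i al i ^+ 2 <=
    s^-1 * \sum_i (f (p i) - u (p i)) ^+ 2.
  rewrite !mulr_sumr -sumrB; apply: ler_sum => i _.
  rewrite -subr_ge0; set t := f _ - _.
  have -> : s^-1 * t ^+ 2 - (2 * (al i * t) - s * al i ^+ 2) =
    s^-1 * (t - s * al i) ^+ 2 by field; rewrite gt_eqF.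
  by rewrite mulr_ge0 ?sqr_ge0 // invr_ge0 ltW.
have E2 : \sum_i al i * (f (p i) - u (p i)) =
    \sum_i al i * f (p i) - \sum_i al i * u (p i).
  by rewrite -sumrB; apply: eq_bigr => i _; rewrite mulrBr.
rewrite E2 in ge2; lra.
Qed.

Lemma ridge_energy_ge0 n (p : 'I_n -> T) f : rk_car H f ->
  0 <= \sum_i ridge p (f \o p) i * f (p i).
Proof. by move=> cf; have := ridge_val_le p cf; rewrite /ridge_val; lra. Qed.

(** The trace of [G (G + s)^-1], computed once in the function space and once by matrix entries: its
    diagonal entry is [1 - s (G + s)^-1_ii], and the kernel values are expanded by Parseval. *)
Lemma ridge_trace n (p : 'I_n -> T) D e : orthonormal_basis H D e ->
  \sum_(j < M) \sum_i ridge p (masked D e j \o p) i * masked D e j (p i) @[M --> \oo]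
  --> \sum_i (1 - s * ridge p (unit_at i) i).
Proof.
move=> onb.
have -> : \sum_i (1 - s * ridge p (unit_at i) i) =
    \sum_i \sum_l ridge p (unit_at i) l * K (p i) (p l).
  apply: eq_bigr => i _; have := ridgeP p (unit_at i) i.
  have -> : unit_at i i = 1 by rewrite /unit_at eqxx.
  move=> <-; rewrite addrK; apply: eq_bigr => l _; exact: mulrC.
have -> : (fun M => \sum_(j < M) \sum_i ridge p (masked D e j \o p) i * masked D e j (p i)) =
  (fun M => \sum_i \sum_l ridge p (unit_at i) l *
     \sum_(j < M) rk_ip H (rk_ker H (p i)) (masked D e j) * rk_ip H (rk_ker H (p l)) (masked D e j)).
  apply/funext => M.
  under [RHS]eq_bigr do under eq_bigr do rewrite mulr_sumr.
  under [RHS]eq_bigr do rewrite exchange_big /=.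
  rewrite [RHS]exchange_big /=; apply: eq_bigr => j _.
  have cm := masked_car hH onb j.
  under eq_bigr do rewrite ridgeE mulr_suml.
  rewrite exchange_big /=; apply: eq_bigr => i _; apply: eq_bigr => l _.
  rewrite !(form_sym ipf (rk_ker_car hH _) cm) !(rk_reproducing hH) //=.
  by rewrite mulrA.
have ck x : rk_car H (rk_ker H x) := rk_ker_car hH x.
apply: cvg_sum_seq => i; apply: cvg_sum_seq => l; apply: cvgMr.
by rewrite /K (rk_kerE hH); exact: (parseval2 hH onb).
Qed.

End ridge_regression.

(** * Leave-one-out identities; the index 0 is the fresh point *)

Section leave_one_out.
Context {R : realType} {T : Type}.
Variables (H : rkhs R T) (s kappa : R).
Hypothesis hH : is_rkhs H.
Hypothesis s0 : 0 < s.
Hypothesis ker_le : forall x, rk_ker H x x <= kappa ^+ 2.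
Implicit Types (f g h u v : T -> R).

Let lc := rk_lin_closed hH.
Let ipf := rk_psd_form hH.
Let K := rk_ker H.

(** Symmetry of [(G + s)^-1]. It moves the ridge solution from the outputs to the kernel section at
    the fresh point. *)
Lemma ridge_dual n (p : 'I_n -> T) y z :
  \sum_i ridge H s p y i * z i = \sum_i ridge H s p z i * y i.
Proof.
rewrite (eq_bigr (fun i => \sum_l ridge H s p y i * (K (p i) (p l) * ridge H s p z l) +
    s * (ridge H s p y i * ridge H s p z i))); last first.
  move=> i _; rewrite -{1}(ridgeP hH s0 p z i) mulrDr mulr_sumr; congr (_ + _); ring.
rewrite [RHS](eq_bigr (fun i => \sum_l ridge H s p z i * (K (p i) (p l) * ridge H s p y l) +
    s * (ridge H s p y i * ridge H s p z i))); last first.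
  move=> i _; rewrite -{1}(ridgeP hH s0 p y i) mulrDr mulr_sumr; congr (_ + _); ring.
rewrite !big_split /=; congr (_ + _); rewrite exchange_big /=.
apply: eq_bigr => i _; apply: eq_bigr => l _; rewrite {2}/K (rk_kerC hH) -/K; ring.
Qed.

Variable n : nat.
Implicit Types (p : 'I_n.+1 -> T) (y : 'I_n.+1 -> R).

Definition others (A : Type) (p : 'I_n.+1 -> A) : 'I_n -> A := p \o lift ord0.

(** The Schur complement of the old points in [G + s]; by [loo_scaleV] its inverse is the corner
    entry of [(G + s)^-1]. *)
Definition loo_scale p := s + ridge_val H s (others p) (K (p ord0)).

(** The weights of the old outputs in the prediction at the fresh point. They depend on the inputs
    only. *)
Definition loo_weight p := ridge H s (others p) (K (p ord0) \o others p).

Lemma loo_scale_ge p : s <= loo_scale p.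
Proof. by rewrite lerDl ridge_val_ge0 //; exact: rk_ker_car. Qed.

Lemma loo_scale_le p : loo_scale p <= s + kappa ^+ 2.
Proof.
rewrite lerD2l; apply: le_trans (ridge_val_le hH s0 _ (rk_ker_car hH _)) _.
by rewrite -(rk_kerE hH).
Qed.

(** Deleting the first row of the large system leaves the small system with outputs
    [y_i - a0 K(x0, x_i)]. By linearity the small solution differs from the large one by [a0] times
    the weights, and the first row collects the factor [loo_scale]. *)
Lemma loo_residual p y :
  y ord0 - \sum_i ridge H s (others p) (others y) i * K (p ord0) (others p i) =
  ridge H s p y ord0 * loo_scale p.
Proof.
set al := ridge H s p y; set a0 := al ord0.
have E : others al = ridge H s (others p)
    (fun i => - a0 * K (p ord0) (others p i) + others y i).
  apply: ridge_unique => // i; have := ridgeP hH s0 p y (lift ord0 i).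
  rewrite big_ord_recl -/al /others /= => <-.
  by rewrite -/a0 (rk_kerC hH _ (p ord0)) -/K; ring.
rewrite -(ridgeD hH s0) in E.
have := ridgeP hH s0 p y ord0; rewrite big_ord_recl -/al -/a0 => <-.
rewrite (eq_bigr (fun i => K (p ord0) (others p i) * others al i)) // E.
rewrite /loo_scale /ridge_val -(rk_kerE hH) -/K -/(loo_weight p).
rewrite (eq_bigr (fun i => - a0 * (loo_weight p i * K (p ord0) (others p i)) +
   ridge H s (others p) (others y) i * K (p ord0) (others p i))); last first.
  move=> i _; rewrite /loo_weight /comp; ring.
rewrite big_split /= -mulr_sumr; ring.
Qed.

Lemma loo_residual_fun p f :
  f (p ord0) - kcomb H (others p) (ridge H s (others p) (f \o others p)) (p ord0) =
  ridge H s p (f \o p) ord0 * loo_scale p.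
Proof.
rewrite -loo_residual; congr (_ - _); apply: eq_bigr => i _.
by rewrite (rk_kerC hH).
Qed.

Lemma loo_scaleV p : ridge H s p (unit_at ord0) ord0 * loo_scale p = 1.
Proof.
rewrite -loo_residual.
have -> : others (unit_at ord0) = (fun=> 0 : R) by apply/funext => i.
by rewrite ridge0 // big1 ?subr0 // => i _; rewrite mul0r.
Qed.

(** With [S] the scale, the leverage is [(S - s) / S], while [s] times the left side is at most
    [S - s]. The bound [S <= s + kappa^2] then gives the constant. *)
Lemma loo_weight_sqr_le p : \sum_i loo_weight p i ^+ 2 <=
  (1 + kappa ^+ 2 / s) * (1 - s * ridge H s p (unit_at ord0) ord0).
Proof.
have S0 : 0 < loo_scale p := lt_le_trans s0 (loo_scale_ge p).
have -> : ridge H s p (unit_at ord0) ord0 = (loo_scale p)^-1.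
  by apply: (mulIf (lt0r_neq0 S0)); rewrite loo_scaleV mulVf // gt_eqF.
rewrite -(ler_pM2l s0).
apply: le_trans (ridge_sqr_le_val hH s0 (others p) (rk_ker_car hH (p ord0))) _.
have -> : s * ((1 + kappa ^+ 2 / s) * (1 - s * (loo_scale p)^-1)) =
   (s + kappa ^+ 2) * (loo_scale p - s) / loo_scale p.
  by field; rewrite (gt_eqF s0) (gt_eqF S0).
rewrite ler_pdivlMr // mulrC; apply: ler_pM; rewrite ?(ltW S0) ?ridge_val_ge0 ?loo_scale_le //.
- exact: rk_ker_car.
- by rewrite /loo_scale addrC addKr.
Qed.

Lemma ridge_val_mono p f : rk_car H f ->
  ridge_val H s p f <= ridge_val H s (others p) f.
Proof.
move=> cf; set be := ridge H s (others p) (f \o others p).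
(* One more point only enlarges the set of competitors: the old minimizer is kept with coefficient 0
   at the new point. *)
pose c i := if unlift ord0 i is Some j then be j else 0.
have c0 : c ord0 = 0 by rewrite /c unlift_none.
have cS i : c (lift ord0 i) = be i by rewrite /c liftK.
apply: le_trans (ridge_val_le_obj hH s0 p c cf) _.
rewrite -ridge_obj_min // /ridge_obj big_ord_recl c0 expr0n add0r -/be.
have -> : kcomb H p c = kcomb H (others p) be.
  apply/funext => x; rewrite /kcomb big_ord_recl c0 mul0r add0r.
  by apply: eq_bigr => i _; rewrite cS.
by rewrite lerD2l; under eq_bigr do rewrite cS.
Qed.

End leave_one_out.

(** * Independent samples and their laws *)

Section iid_samples.
Context {R : realType} {d : measure_display} {S : measurableType d}.
Variable rho : probability S R.

(** Only a measure is asked for, so that the notion applies directly to products such as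
    [P \x rho]. *)
Definition iid {d'} {Omega : measurableType d'} (P : {measure set Omega -> \bar R})
    n (Z : Omega -> n.-tuple S) :=
  measurable_fun setT Z /\
  forall A : 'I_n -> set S, (forall i, measurable (A i)) ->
    P [set w | forall i, A i (tnth (Z w) i)] = (\prod_i rho (A i))%E.

Definition rectangle n (A : 'I_n -> set S) : set (n.-tuple S) :=
  [set t | forall i, A i (tnth t i)].

Lemma rectangle_bigcap n (A : 'I_n -> set S) :
  rectangle A = \bigcap_i ((fun t => tnth t i) @^-1` A i).
Proof. by apply/seteqP; split => t /= h i; [move=> _|]; apply: h. Qed.

Lemma measurable_rectangle n (A : 'I_n -> set S) :
  (forall i, measurable (A i)) -> measurable (rectangle A).
Proof.
move=> mA; rewrite rectangle_bigcap.
apply: fin_bigcap_measurable => // i _.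
by rewrite -[X in measurable X]setTI; exact: (measurable_tnth i).
Qed.

Lemma rectangle_generates n : @measurable _ (n.-tuple S) =
  <<s [set B | exists2 A : 'I_n -> set S, (forall i, measurable (A i)) & B = rectangle A] >>.
Proof.
apply/seteqP; split; last first.
  apply: smallest_sub; first exact: sigma_algebra_measurable.
  by move=> _ [A mA ->]; exact: measurable_rectangle.
apply: smallest_sub; first exact: smallest_sigma_algebra.
rewrite -bigcup_seq /=; apply: bigcup_sub => i _ _ [B mB <-].
apply: sub_sigma_algebra.
exists (fun l => if l == i then B else setT) => [l|]; first by case: ifP.
apply/seteqP; split => t /=.
  by move=> [_ Bt] l; case: ifPn => // /eqP ->.
by move=> /(_ i); rewrite eqxx.
Qed.

(** Rectangles are stable under intersection and generate, so the two samples have the same law.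
    Exchangeability and resampling both rest on this. *)
Lemma iid_integral_eq d1 (O1 : measurableType d1) d2 (O2 : measurableType d2)
  (P1 : {measure set O1 -> \bar R}) (P2 : {measure set O2 -> \bar R}) n
  (Z1 : O1 -> n.-tuple S) (Z2 : O2 -> n.-tuple S) (F : n.-tuple S -> \bar R) :
  iid P1 Z1 -> iid P2 Z2 -> measurable_fun setT F -> (forall t, 0 <= F t)%E ->
  (\int[P1]_w F (Z1 w) = \int[P2]_w F (Z2 w))%E.
Proof.
move=> [mZ1 Z1P] [mZ2 Z2P] mF F0.
rewrite -(ge0_integral_pushforward mZ1 P1 measurableT mF) //.
rewrite -(ge0_integral_pushforward mZ2 P2 measurableT mF) //.
apply: eq_measure_integral => A mA _.
pose G : set (set (n.-tuple S)) := [set B | exists2 A : 'I_n -> set S, (forall i, measurable (A i)) & B = rectangle A].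
apply: (measure_unique G (fun=> setT)) => //.
- exact: rectangle_generates.
- move=> _ _ [B mB ->] [C mC ->]; exists (fun i => B i `&` C i).
    by move=> i; exact: measurableI.
  by apply/seteqP; split => t /= h; [move=> i; split; [exact: h.1|exact: h.2]|split=> i; have [] := h i].
- by move=> _; exists (fun=> setT) => //; apply/seteqP; split.
- by apply/seteqP; split => // t _; exists 0%N.
- by move=> _ [B mB ->]; rewrite /= /pushforward Z1P // Z2P.
- move=> _; rewrite /= /pushforward preimage_setT.
  have := Z1P (fun=> setT) (fun=> measurableT); rewrite big1; last by move=> i _; exact: probability_setT.
  by rewrite (_ : [set w | _] = setT) => [->|]; [exact: ltry|apply/seteqP; split].
Qed.

Section operations.
Context {d'} {Omega : measurableType d'} (P : {measure set Omega -> \bar R}).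

Lemma iid_perm n (Z : Omega -> n.-tuple S) (t : 'I_n -> 'I_n) : injective t ->
  iid P Z -> iid P (fun w => [tuple tnth (Z w) (t i) | i < n]).
Proof.
move=> ti [mZ ZP]; split.
  apply/measurable_fun_tnthP => i; rewrite (_ : _ \o _ = fun w => tnth (Z w) (t i)).
    by move/measurable_fun_tnthP : mZ => /(_ (t i)).
  by apply/funext => w /=; rewrite tnth_mktuple.
move=> A mA; pose t' := invF ti.
rewrite (reindex_inj (can_inj (f_invF ti : cancel t' t))) /= -ZP => [|i]; last exact: mA.
congr (P _); apply/seteqP; split => w /= h i.
  by have := h (t' i); rewrite tnth_mktuple (f_invF ti).
by have := h (t i); rewrite tnth_mktuple /t' (invF_f ti).
Qed.

Lemma iid_cons n (Z : Omega -> n.-tuple S) : iid P Z ->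
  iid (P \x rho)%E (fun wz => [tuple of wz.2 :: Z wz.1]).
Proof.
move=> [mZ ZP]; split.
  apply/measurable_fun_tnthP => i; have [j ->|->] := unliftP ord0 i.
    rewrite (_ : _ \o _ = fun w => tnth (Z w.1) j).
      have h : measurable_fun setT (fun w => tnth (Z w) j).
        by move/measurable_fun_tnthP : mZ => /(_ j).
      exact: measurableT_comp h measurable_fst.
    by apply/funext => w /=; rewrite tnthS.
  rewrite (_ : _ \o _ = snd) //.
move=> A mA; rewrite big_ord_recl /=.
rewrite (_ : [set w | _] = [set w | forall i, A (lift ord0 i) (tnth (Z w) i)] `*` A ord0).
  rewrite product_measure1E //.
    by rewrite [RHS]muleC; congr (_ * _)%E; exact: (ZP (fun i => A (lift ord0 i))).
  have := measurable_rectangle (fun i => mA (lift ord0 i)).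
  by move=> /(mZ measurableT); rewrite setTI.
apply/seteqP; split => -[w z] /=.
  by move=> h; split; [move=> i; have := h (lift ord0 i); rewrite tnthS|exact: (h ord0)].
by move=> [h hz] i; have [j ->|->] := unliftP ord0 i; rewrite ?tnthS.
Qed.

(** A single coordinate can thus be redrawn without changing the law, which is how the noise at one
    index is integrated out while the rest of the sample stays fixed. *)
Lemma iid_resample n (Z : Omega -> n.-tuple S) (i : 'I_n) : iid P Z ->
  iid (P \x rho)%E (fun wz => [tuple if l == i then wz.2 else tnth (Z wz.1) l | l < n]).
Proof.
move=> [mZ ZP]; split.
  apply/measurable_fun_tnthP => l.
  rewrite (_ : _ \o _ = fun w => if l == i then w.2 else tnth (Z w.1) l); last first.
    by apply/funext => w /=; rewrite tnth_mktuple.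
  have [_|_] := eqVneq l i; first exact: measurable_snd.
  have h : measurable_fun setT (fun w => tnth (Z w) l).
    by move/measurable_fun_tnthP : mZ => /(_ l).
  exact: measurableT_comp h measurable_fst.
move=> A mA; pose A' l := if l == i then setT else A l.
have mA' l : measurable (A' l) by rewrite /A'; case: ifP.
rewrite (_ : [set w | _] = [set w | forall l, A' l (tnth (Z w) l)] `*` A i).
  rewrite [LHS]product_measure1E // ?ZP //; last first.
    by have := measurable_rectangle mA' => /(mZ measurableT); rewrite setTI.
  rewrite (bigD1 i) //= [RHS](bigD1 i) //= {1}/A' eqxx probability_setT mul1e muleC.
  by congr (_ * _)%E; apply: eq_bigr => l li; rewrite /A' (negPf li).
apply/seteqP; split => -[w z] /=.
  move=> h; split; last by have := h i; rewrite tnth_mktuple eqxx.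
  by move=> l; rewrite /A'; have := h l; rewrite tnth_mktuple; case: eqVneq.
move=> [h hz] l; rewrite tnth_mktuple; have := h l; rewrite /A'.
by case: eqVneq => // ->.
Qed.

End operations.
End iid_samples.

(** * Integration along a disintegration *)

Section disintegration_integral.
Context {R : realType} {d : measure_display} {X : measurableType d}.
Variables (mu : probability X R) (rhoc : R.-pker X ~> R).

(** The law of the pair [(x, y)] for fixed [x]. The [unit] factor is the dummy source needed to
    write [rho] as a composition of kernels. *)
Let pair_law (p : unit * X) : set (X * R) -> \bar R :=
  fun A => rhoc p.2 (xsection A p.2).

Let pair_law0 p : pair_law p set0 = 0%E.
Proof. by rewrite /pair_law xsection0 measure0. Qed.

Let pair_law_ge0 p A : (0 <= pair_law p A)%E.
Proof. exact: measure_ge0. Qed.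

Let pair_law_additive p : semi_sigma_additive (pair_law p).
Proof.
move=> F mF tF mUF; rewrite /pair_law xsection_bigcup.
apply: measure_semi_sigma_additive.
- by move=> n; exact: measurable_xsection.
- exact: trivIset_xsection.
- by rewrite -xsection_bigcup; exact: measurable_xsection.
Qed.

HB.instance Definition _ p := isMeasure.Build _ _ _ (pair_law p)
  (pair_law0 p) (pair_law_ge0 p) (@pair_law_additive p).

Let pair_kernel (p : unit * X) : {measure set (X * R) -> \bar R} := pair_law p.

Let measurable_pair_kernel U : measurable U ->
  measurable_fun [set: unit * X] (pair_kernel ^~ U).
Proof.
move=> mU; have h : measurable_fun [set: X] (fun x => rhoc x (xsection U x)).
  have [r hr] := measure_uub rhoc.
  by apply: measurable_fun_xsection_finite_kernel; rewrite inE.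
exact: measurableT_comp h measurable_snd.
Qed.

HB.instance Definition _ := @isKernel.Build _ _ _ _ R pair_kernel measurable_pair_kernel.

Let pair_kernel_prob p : pair_kernel p setT = 1%E.
Proof.
rewrite /pair_kernel /= /pair_law (_ : xsection _ _ = setT) ?prob_kernel //.
by apply/seteqP; split => // y _; rewrite /xsection /= inE.
Qed.

HB.instance Definition _ :=
  @Kernel_isProbability.Build _ _ _ _ R pair_kernel pair_kernel_prob.

Lemma integral_disintegration (rho : probability (X * R)%type R) (F : X * R -> \bar R) :
  (forall A B, measurable A -> measurable B ->
    rho (A `*` B) = (\int[mu]_(x in A) rhoc x B)%E) ->
  measurable_fun setT F -> (forall z, (0 <= F z)%E) ->
  (\int[rho]_z F z = \int[mu]_x \int[rhoc x]_y F (x, y))%E.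
Proof.
move=> rhoE mF F0.
pose l := @kprobability _ _ unit X R (fun=> mu) (measurable_cst _).
have mpair x : @measurable_fun _ _ R (X * R)%type setT (fun y => (x, y)) by apply: pair1_measurable.
transitivity (\int[kcomp l pair_kernel tt]_z F z)%E.
  apply: eq_measure_integral => A mA _.
  pose G : set (set (X * R)) := [set C | exists A B, [/\ measurable A, measurable B & C = A `*` B]].
  apply: (measure_unique G (fun=> setT)) => //.
  - rewrite measurable_prod_measurableType; congr (<<s _ >>).
    apply/seteqP; split => [C [U mU [V mV <-]]|C [U [V [mU mV ->]]]]; first by exists U, V.
    by exists U => //; exists V.
  - move=> _ _ [A1 [B1 [mA1 mB1 ->]]] [A2 [B2 [mA2 mB2 ->]]].
    exists (A1 `&` A2), (B1 `&` B2); split; [exact: measurableI|exact: measurableI|].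
    by rewrite setXI.
  - by move=> _; exists setT, setT; split => //; rewrite setXTT.
  - by apply/seteqP; split => // t _; exists 0%N.
  - move=> _ [U [V [mU mV ->]]].
    transitivity (\int[mu]_(x in U) rhoc x V)%E; first exact: rhoE.
    rewrite /= /kcomp /= integral_mkcond; apply: eq_integral => x _.
    rewrite /pair_kernel /= /pair_law patchE; case: ifPn => xU.
      by rewrite in_xsectionX.
    by rewrite notin_xsectionX // measure0.
  - by move=> _; rewrite [ltLHS]probability_setT ltry.
rewrite integral_kcomp //; apply: eq_integral => x _.
rewrite /pair_kernel /=.
transitivity (\int[pushforward (rhoc x) (fun y => (x, y))]_z F z)%E.
  by apply: eq_measure_integral => A mA _; rewrite /= /pair_law /pushforward xsectionE.
by rewrite ge0_integral_pushforward.
Qed.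

End disintegration_integral.

Section square_integrals.
Context {R : realType}.
Variable q : {measure set R -> \bar R}.
Hypothesis q1 : q setT = 1%E.

Let m : R := \int[q]_y y.

(** The cross term vanishes because [m] is the mean. Being a real-valued integral, [m] has that
    meaning only once [y] is integrable, which is first deduced from [|y - m| <= 1 + (y - m)^2]. *)
Lemma integral_sqr_affine (a b : R) :
  (\int[q]_y ((y - m) ^+ 2)%:E < +oo)%E ->
  (\int[q]_y ((a + b * (y - m)) ^+ 2)%:E =
   (a ^+ 2)%:E + (b ^+ 2)%:E * \int[q]_y ((y - m) ^+ 2)%:E)%E.
Proof.
move=> v_lty.
have mid : measurable_fun setT (fun y : R => y - m).
  by apply: measurable_funB => //; exact: measurable_cst.
have msq : measurable_fun setT (fun y : R => (y - m) ^+ 2) by exact: measurable_funX.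
have icst (c : R) : q.-integrable setT (EFin \o cst c).
  apply/integrableP; split; first exact/measurable_EFinP/measurable_cst.
  under eq_integral do rewrite /=.
  by rewrite integral_cst // q1 mule1 ltry.
have isq : q.-integrable setT (EFin \o (fun y => (y - m) ^+ 2)).
  apply/integrableP; split; first exact/measurable_EFinP.
  by under eq_integral do rewrite /= ger0_norm ?sqr_ge0 //.
have idf : q.-integrable setT (EFin \o (fun y => y - m)).
  apply: (@le_integrable _ _ _ q setT measurableT _ (EFin \o (fun y => 1 + (y - m) ^+ 2))).
  - exact/measurable_EFinP.
  - move=> y _; rewrite /= lee_fin [leRHS]ger0_norm ?addr_ge0 ?sqr_ge0 //.
    rewrite ler_norml; have := sqr_ge0 (y - m + 1); have := sqr_ge0 (y - m - 1).
    have := sqr_ge0 (y - m).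
    by rewrite !expr2 => *; apply/andP; split; lra.
  - by have := integrableD measurableT (icst 1) isq; apply: eq_integrable.
have iid : q.-integrable setT (EFin \o (fun y : R => y)).
  have := integrableD measurableT (icst m) idf; apply: eq_integrable => // y _.
  by rewrite /= -EFinD addrC subrK.
have zero : (\int[q]_y (y - m)%:E = 0)%E.
  transitivity (\int[q]_y ((EFin \o (fun y : R => y)) y - (EFin \o cst m) y))%E.
    by apply: eq_integral.
  rewrite (integralB measurableT iid (icst m)) /= integral_cst // q1 mule1 /m /Rintegral.
  by rewrite fineK ?subee //; exact: integrable_fin_num iid.
have i1 := integrableZl measurableT (2 * a * b) idf.
have i2 := integrableZl measurableT (b ^+ 2) isq.
transitivity (\int[q]_y ((EFin \o cst (a ^+ 2)%R) y +
    ((fun y => (2 * a * b)%R%:E * (EFin \o (fun y => (y - m)%R)) y) \+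
     (fun y => (b ^+ 2)%R%:E * (EFin \o (fun y => ((y - m) ^+ 2)%R)) y)) y))%E.
  by apply: eq_integral => y _ /=; rewrite -!EFinM -!EFinD; congr EFin; ring.
rewrite (integralD measurableT (icst _) (integrableD measurableT i1 i2)).
rewrite (integralD measurableT i1 i2) (integralZl measurableT idf) (integralZl measurableT isq).
by rewrite /= zero mule0 add0e integral_cst // q1 mule1.
Qed.

End square_integrals.

(** * Measurability of the ridge coefficients *)

Section measurable_ridge.
Context {R : realType} {d : measure_display} {X : measurableType d}.
Variables (H : rkhs R X) (s : R).
Hypothesis hH : is_rkhs H.
Hypothesis s0 : 0 < s.
Hypothesis mker : measurable_fun setT (fun z : X * X => rk_ker H z.1 z.2).
Context {d'} {Omega : measurableType d'}.

Lemma measurable_ker_section x : measurable_fun setT (rk_ker H x).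
Proof.
have -> : rk_ker H x = (fun z : X * X => rk_ker H z.1 z.2) \o (fun y => (x, y)) by [].
by apply: measurableT_comp => //; exact: pair1_measurable.
Qed.

Lemma measurable_det n (A : Omega -> 'M[R]_n) :
  (forall i j, measurable_fun setT (fun w => A w i j)) ->
  measurable_fun setT (fun w => \det (A w)).
Proof.
move=> mA; apply: measurable_sum => t.
by apply: measurable_funM => //; apply: measurable_prod => i _.
Qed.

Lemma measurable_invr (g : Omega -> R) : (forall w, g w != 0) ->
  measurable_fun setT g -> measurable_fun setT (fun w => (g w)^-1).
Proof.
move=> gN0 mg.
have -> : (fun w => (g w)^-1) = (fun w => g w * ((g w ^+ 2) `^ (-1))).
  apply/funext => w; rewrite powR_inv1 ?sqr_ge0 // expr2 invfM mulrA divff //.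
  by rewrite mul1r.
apply: measurable_funM => //.
have -> : (fun w => (g w ^+ 2) `^ (-1)) = ((@powR R)^~ (-1)) \o (fun w => g w ^+ 2) by [].
by apply: measurableT_comp; [exact: measurable_powR|exact: measurable_funX].
Qed.

(** Cramer's rule writes the coefficients as polynomials in the kernel values and outputs divided by
    a determinant that never vanishes. *)
Lemma measurable_ridge n (p : Omega -> 'I_n -> X) (y : Omega -> 'I_n -> R) i :
  (forall i, measurable_fun setT (fun w => p w i)) ->
  (forall i, measurable_fun setT (fun w => y w i)) ->
  measurable_fun setT (fun w => ridge H s (p w) (y w) i).
Proof.
move=> mp my.
pose G w : 'M[R]_n := (\matrix_(i, l) rk_ker H (p w i) (p w l)) + s%:M.
have GU w : G w \in unitmx by exact: regularized_gram_unit.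
have mG a b : measurable_fun setT (fun w => G w a b).
  rewrite (_ : (fun w => G w a b) = (fun w => rk_ker H (p w a) (p w b) + s *+ (a == b))).
    apply: measurable_funD; last exact: measurable_cst.
    have -> : (fun w => rk_ker H (p w a) (p w b)) =
      (fun z : X * X => rk_ker H z.1 z.2) \o (fun w => (p w a, p w b)) by [].
    by apply: measurableT_comp => //; exact: measurable_fun_pair.
  by apply/funext => w; rewrite /G !mxE.
have -> : (fun w => ridge H s (p w) (y w) i) =
    (fun w => \sum_j (\det (G w))^-1 * (\adj (G w)) i j * y w j).
  apply/funext => w; rewrite /ridge -/(G w) mxE; apply: eq_bigr => j _.
  by rewrite /invmx GU !mxE.
apply: measurable_sum => j; apply: measurable_funM => //; apply: measurable_funM.
  apply: measurable_invr; last exact: measurable_det.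
  by move=> w; have := GU w; rewrite unitmxE unitfE.
have -> : (fun w => (\adj (G w)) i j) =
   (fun w => (-1) ^+ (j + i) * \det (row' j (col' i (G w)))).
  by apply/funext => w; rewrite mxE.
apply: measurable_funM; first exact: measurable_cst.
apply: measurable_det => a b.
rewrite (_ : (fun w => _) = (fun w => G w (lift j a) (lift i b))) //.
by apply/funext => w; rewrite !mxE.
Qed.

End measurable_ridge.

(** * Exchangeability *)

Section exchangeability.
Context {R : realType} {d : measure_display} {S : measurableType d}.
Variable rho : probability S R.
Local Open Scope ereal_scope.

Definition swap_ord n (l i : 'I_n.+1) : 'I_n.+1 :=
  if i == ord0 then l else if i == l then ord0 else i.

Lemma swap_ordK n (l : 'I_n.+1) : involutive (swap_ord l).
Proof.
move=> i; rewrite /swap_ord; have [->|i0] := eqVneq i ord0.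
  by rewrite eqxx; case: eqVneq.
by have [->|il] := eqVneq i l; [rewrite eqxx|rewrite (negPf i0) (negPf il)].
Qed.

(** The transposition of 0 and [l] preserves the law and carries [F ord0] to [F l]. This is the only
    source of the gain [1 / (k + 1)]. *)
Lemma iid_exchange n d' (Omega : measurableType d') (Q : {measure set Omega -> \bar R})
    (Z : Omega -> n.+1.-tuple S) (F : 'I_n.+1 -> n.+1.-tuple S -> \bar R) :
  iid rho Q Z -> (forall l, measurable_fun setT (F l)) -> (forall l t, 0 <= F l t) ->
  (forall l t, F ord0 [tuple tnth t (swap_ord l i) | i < n.+1] = F l t) ->
  \int[Q]_w \sum_l F l (Z w) = (n.+1%:R)%:E * \int[Q]_w F ord0 (Z w).
Proof.
move=> ZQ mF F0 FE.
rewrite ge0_integral_sum // => [|l]; last exact: measurableT_comp (mF l) ZQ.1.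
rewrite (eq_bigr (fun=> \int[Q]_w F ord0 (Z w))) => [|l _].
  by rewrite mule_natl sumr_const card_ord.
under eq_integral do rewrite -FE.
apply: (iid_integral_eq (iid_perm (inv_inj (swap_ordK l)) ZQ) ZQ) => //.
Qed.

Section fresh.
Context {d'} {Omega : measurableType d'} (P : probability Omega R).
Variables (n : nat) (Z : Omega -> n.-tuple S).

Definition augment (wz : Omega * S) : n.+1.-tuple S := [tuple of wz.2 :: Z wz.1].

Lemma integral_fresh (g : S -> \bar R) : measurable_fun setT g -> (forall z, 0 <= g z) ->
  \int[(P \x rho)]_w g (tnth (augment w) ord0) = \int[rho]_z g z.
Proof.
move=> mg g0.
rewrite (@fubini_tonelli1 _ _ _ _ _ P rho (fun w => g (tnth (augment w) ord0))) //; last first.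
  exact: measurableT_comp mg measurable_snd.
rewrite /fubini_F /=; transitivity ((\int[rho]_z g z) * P setT).
  exact: (integral_cst P measurableT (\int[rho]_z g z)).
by rewrite probability_setT mule1.
Qed.

Lemma integral_old (g : n.-tuple S -> \bar R) : measurable_fun setT Z ->
  measurable_fun setT g -> (forall z, 0 <= g z) ->
  \int[(P \x rho)]_w g (Z w.1) = \int[P]_w g (Z w).
Proof.
move=> mZ mg g0.
have mgZ : measurable_fun setT (fun w => g (Z w)) by exact: measurableT_comp.
rewrite (@fubini_tonelli1 _ _ _ _ _ P rho (fun w => g (Z w.1))) //; last first.
  exact: measurableT_comp mgZ measurable_fst.
apply: eq_integral => w _.
rewrite /fubini_F /=; transitivity (g (Z w) * rho setT); first exact: (integral_cst rho measurableT (g (Z w))).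
by rewrite probability_setT mule1.
Qed.

End fresh.
End exchangeability.

(** * Expected bias and expected leverage *)

Section expected_residuals.
Context {R : realType} {d : measure_display} {X : measurableType d}.
Variables (mu : probability X R) (rhoc : R.-pker X ~> R).
Variable rho : probability (X * R)%type R.
Hypothesis rhoE : forall A B, measurable A -> measurable B ->
  rho (A `*` B) = (\int[mu]_(x in A) rhoc x B)%E.
Variables (H : rkhs R X) (kappa s : R).
Hypothesis hH : is_rkhs H.
Hypothesis mker : measurable_fun setT (fun z : X * X => rk_ker H z.1 z.2).
Hypothesis ker_le : forall x, rk_ker H x x <= kappa ^+ 2.
Hypothesis s0 : 0 < s.

Let lc := rk_lin_closed hH.
Let ipf := rk_psd_form hH.
Let msec := measurable_ker_section mker.

Definition inputs n (t : n.-tuple (X * R)) (i : 'I_n) : X := (tnth t i).1.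
Definition outputs n (t : n.-tuple (X * R)) (i : 'I_n) : R := (tnth t i).2.

Lemma measurable_inputs n (i : 'I_n) : measurable_fun setT (fun t => inputs t i).
Proof. exact: measurableT_comp measurable_fst (measurable_tnth i). Qed.

Lemma measurable_outputs n (i : 'I_n) : measurable_fun setT (fun t => outputs t i).
Proof. exact: measurableT_comp measurable_snd (measurable_tnth i). Qed.

Lemma measurable_fun_inputs n (g : X -> R) (i : 'I_n) : measurable_fun setT g ->
  measurable_fun setT (fun t => g (inputs t i)).
Proof. by move=> mg; exact: measurableT_comp mg (measurable_inputs i). Qed.

Lemma measurable_ridge_inputs n (g : X -> R) i : measurable_fun setT g ->
  measurable_fun setT (fun t : n.-tuple (X * R) =>
    ridge H s (inputs t) (g \o inputs t) i).
Proof.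
move=> mg; apply: measurable_ridge => // l; first exact: measurable_inputs.
exact: measurable_fun_inputs.
Qed.

Lemma measurable_ridge_val n f : rk_car H f ->
  measurable_fun setT (fun t : n.-tuple (X * R) => ridge_val H s (inputs t) f).
Proof.
move=> cf; have mf := rk_measurable hH msec cf.
apply: measurable_funB; first exact: measurable_cst.
apply: measurable_sum => i; apply: measurable_funM; first exact: measurable_ridge_inputs.
exact: measurable_fun_inputs.
Qed.

Lemma integral_marginal (g : X -> \bar R) : measurable_fun setT g ->
  (forall x, (0 <= g x)%E) -> (\int[rho]_z g z.1 = \int[mu]_x g x)%E.
Proof.
move=> mg g0; rewrite (@integral_disintegration _ _ _ mu rhoc rho (fun z => g z.1)) //; last first.
  exact: measurableT_comp mg measurable_fst.
apply: eq_integral => x _ /=.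
transitivity (g x * rhoc x setT)%E.
  exact: (integral_cst (rhoc x) measurableT (g x)).
by rewrite prob_kernel mule1.
Qed.

Section sample.
Context {d'} {Omega : measurableType d'} (P : probability Omega R).
Variables (n : nat) (Z : Omega -> n.-tuple (X * R)).
Hypothesis iidZ : iid rho P Z.

Let N : R := n.+1%:R.
Let N0 : 0 < N. Proof. by rewrite ltr0n. Qed.
Let Q : {measure set (Omega * (X * R)) -> \bar R} := (P \x rho)%E.
Let c := 1 + kappa ^+ 2 / s.
Let c0 : 0 < c. Proof. by rewrite ltr_wpDr // divr_ge0 ?sqr_ge0 // ltW. Qed.
Let iidQ : iid rho Q (augment Z) := iid_cons iidZ.
Let mZ : measurable_fun setT Z := iidZ.1.
Let mA : measurable_fun setT (augment Z) := iidQ.1.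

Lemma others_inputs w : others (inputs (augment Z w)) = inputs (Z w.1).
Proof. by apply/funext => i; rewrite /others /inputs /= tnthS. Qed.

Lemma inputs_swap (t : n.+1.-tuple (X * R)) l :
  inputs [tuple tnth t (swap_ord l i) | i < n.+1] = inputs t \o swap_ord l.
Proof. by apply/funext => i; rewrite /inputs tnth_mktuple. Qed.

(** By exchangeability [N] times the left side is the expected sum of all squared coefficients. That
    sum is at most [s^-1] times [ridge_val] on [n + 1] points, hence on the [n] old ones. *)
Lemma expected_coef_sqr f : rk_car H f ->
  (\int[Q]_w ((ridge H s (inputs (augment Z w)) (f \o inputs (augment Z w)) ord0) ^+ 2)%:E <=
   ((N * s)^-1)%:E * \int[P]_w (ridge_val H s (inputs (Z w)) f)%:E)%E.
Proof.
move=> cf; have mf := rk_measurable hH msec cf.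
pose F (l : 'I_n.+1) (t : n.+1.-tuple (X * R)) : \bar R :=
  ((ridge H s (inputs t) (f \o inputs t) l) ^+ 2)%:E.
have mF l : measurable_fun setT (F l).
  by apply/measurable_EFinP/measurable_funX; exact: measurable_ridge_inputs.
have mV : measurable_fun setT (fun t : n.-tuple (X * R) => (ridge_val H s (inputs t) f)%:E).
  by apply/measurable_EFinP; exact: measurable_ridge_val.
have F0 l t : (0 <= F l t)%E by rewrite lee_fin sqr_ge0.
have FE l t : F ord0 [tuple tnth t (swap_ord l i) | i < n.+1] = F l t.
  rewrite /F inputs_swap -[f \o (_ \o _)]/((f \o inputs t) \o swap_ord l).
  by rewrite ridge_perm //=; exact: inv_inj (@swap_ordK _ l).
have E := iid_exchange iidQ mF F0 FE.
have : (N%:E * \int[Q]_w F ord0 (augment Z w) <=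
    (s^-1)%:E * \int[P]_w (ridge_val H s (inputs (Z w)) f)%:E)%E.
  rewrite -E -ge0_integralZl //; last 3 first.
  - exact: measurableT_comp mV mZ.
  - by move=> w _; rewrite lee_fin ridge_val_ge0.
  - by rewrite lee_fin invr_ge0 ltW.
  have mV' : measurable_fun setT (fun t : n.-tuple (X * R) => ((s^-1)%:E * (ridge_val H s (inputs t) f)%:E)%E).
    exact: measurable_funeM.
  rewrite -(integral_old rho P mZ mV') => [|t]; last first.
    by rewrite mule_ge0 // lee_fin ?ridge_val_ge0 // invr_ge0 ltW.
  apply: ge0_le_integral => //.
  - by move=> w _; apply: sume_ge0 => l _; rewrite lee_fin sqr_ge0.
  - apply: emeasurable_sum => l; exact: measurableT_comp (mF l) mA.
  - have := measurableT_comp mV' mZ => h; exact: measurableT_comp h measurable_fst.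
  move=> w _; rewrite /F sumEFin -EFinM lee_fin -others_inputs.
  rewrite ler_pdivlMl //; apply: le_trans (ridge_sqr_le_val hH s0 _ cf) _.
  exact: ridge_val_mono.
move=> h; rewrite invfM EFinM -muleA.
rewrite -[leLHS]mul1e -(divff (lt0r_neq0 N0)) mulrC EFinM -muleA.
by rewrite lee_pmul2l // lte_fin invr_gt0.
Qed.

(** A real value is needed later, when half of this expectation is subtracted from both sides of an
    inequality. *)
Lemma expected_val_fin f : rk_car H f ->
  exists2 q : R, 0 <= q & (\int[P]_w (ridge_val H s (inputs (Z w)) f)%:E = q%:E)%E.
Proof.
move=> cf; have mV : measurable_fun setT (fun w => (ridge_val H s (inputs (Z w)) f)%:E).
  have h := @measurable_ridge_val n f cf.
  by apply/measurable_EFinP; exact: measurableT_comp h mZ.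
have I0 : (0 <= \int[P]_w (ridge_val H s (inputs (Z w)) f)%:E)%E.
  by apply: integral_ge0 => w _; rewrite lee_fin ridge_val_ge0.
have Ile : (\int[P]_w (ridge_val H s (inputs (Z w)) f)%:E <= (rk_ip H f f)%:E)%E.
  apply: (@le_trans _ _ (\int[P]_w (rk_ip H f f)%:E)%E).
    apply: ge0_le_integral => //.
    - by move=> w _; rewrite lee_fin ridge_val_ge0.
    - by move=> w _; rewrite lee_fin ridge_val_le.
  rewrite (integral_cst P measurableT (rk_ip H f f)%:E).
  by rewrite [X in (_ * X)%E]probability_setT mule1.
exists (fine (\int[P]_w (ridge_val H s (inputs (Z w)) f)%:E)); first exact: fine_ge0.
rewrite fineK // ge0_fin_numE //; exact: le_lt_trans Ile (ltry _).
Qed.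

Lemma measurable_fun_augment (F : n.+1.-tuple (X * R) -> R) : measurable_fun setT F ->
  measurable_fun setT (fun w => (F (augment Z w))%:E).
Proof. by move=> mF; apply/measurable_EFinP; exact: measurableT_comp mF mA. Qed.

(* For [f1 = T w] the objective value at [f1] is [<T w, r> = E (w r)], with [r]
   the residual of the fit of [f1], and leave-one-out gives
   [|r (x0)| <= (s + kappa^2) |coef|]. AM-GM then bounds the expected value by
   [s c^2 / N * E w^2] plus half of itself. *)
Lemma expected_val_cov f1 w : rk_car H f1 -> rk_car H w ->
  (forall g, rk_car H g -> rk_ip H f1 g = cov_form mu w g) ->
  (\int[P]_v (ridge_val H s (inputs (Z v)) f1)%:E <=
    (s * c ^+ 2 / N * cov_form mu w w)%:E)%E.
Proof.
move=> cf1 cw f1E.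
have mf1 := rk_measurable hH msec cf1; have mw := rk_measurable hH msec cw.
have [q q0 qE] := expected_val_fin cf1.
pose al (t : n.+1.-tuple (X * R)) := ridge H s (inputs t) (f1 \o inputs t) ord0.
(* [B] is set so that [B / (N s) = 1/2], the share to be absorbed. [A] is then forced by
   [4 A B = (s c)^2], which makes the difference in the inequality below a perfect square. *)
pose A := s * c ^+ 2 / (2 * N); pose B := s * N / 2.
have A0 : 0 <= A by apply: divr_ge0; apply: mulr_ge0; rewrite ?sqr_ge0 // ltW.
have B0 : 0 <= B by apply: divr_ge0 => //; apply: mulr_ge0; exact: ltW.
pose h (t : n.+1.-tuple (X * R)) : R := A * w (inputs t ord0) ^+ 2 + B * al t ^+ 2.
have h0 t : 0 <= h t by rewrite addr_ge0 // mulr_ge0 ?sqr_ge0.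
have mal : measurable_fun setT al by exact: measurable_ridge_inputs.
have mal2 : measurable_fun setT (fun t => al t ^+ 2) by exact: measurable_funX.
have mw0 : measurable_fun setT (fun t : n.+1.-tuple (X * R) => w (inputs t ord0) ^+ 2).
  by apply: measurable_funX; exact: measurable_fun_inputs.
have mh : measurable_fun setT h.
  by apply: measurable_funD; apply: measurable_funM => //; exact: measurable_funX.
have sc : s + kappa ^+ 2 = s * c by rewrite /c; field; rewrite gt_eqF.
have pointwise v : ((ridge_val H s (inputs (Z v)) f1)%:E <=
    \int[rho]_z (h (augment Z (v, z)))%:E)%E.
  pose be := ridge H s (inputs (Z v)) (f1 \o inputs (Z v)).
  pose r x := f1 x - kcomb H (inputs (Z v)) be x.
  have cr : rk_car H r by apply: (lin_closedB lc) => //; exact: kcomb_car.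
  have mr := rk_measurable hH msec cr.
  have -> : ridge_val H s (inputs (Z v)) f1 = cov_form mu w r.
    rewrite -f1E // /r (formBr lc ipf) //; last exact: kcomb_car.
    by rewrite ip_kcomb.
  have iwr := rk_integrable mu hH msec ker_le cw cr.
  rewrite /cov_form /Rintegral fineK; last exact: integrable_fin_num iwr.
  apply: (le_trans (lee_abs _)); apply: (le_trans (le_abse_integral mu measurableT _)).
    by apply/measurable_EFinP; exact: measurable_funM.
  have mabs : measurable_fun setT (fun x => `|(w x * r x)%:E|%E).
    by apply: measurableT_comp => //; apply/measurable_EFinP; exact: measurable_funM.
  rewrite -(integral_marginal mabs) //.
  have mhv : measurable_fun setT (fun z => (h (augment Z (v, z)))%:E).
    have hh := measurable_fun_augment mh.
    exact: measurableT_comp hh (@pair1_measurable _ _ Omega (X * R)%type v).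
  apply: ge0_le_integral => //.
  - exact: measurableT_comp mabs measurable_fst.
  - move=> z _; rewrite /= lee_fin.
    have rz : r z.1 = al (augment Z (v, z)) * loo_scale H s (inputs (augment Z (v, z))).
      by rewrite /al -(loo_residual_fun hH s0) others_inputs.
    rewrite normrM rz normrM.
    set S := loo_scale _ _ _; set a := al _.
    have S1 : `|S| <= s * c.
      rewrite ger0_norm ?(le_trans _ (loo_scale_ge hH s0 _)) ?(ltW s0) // -sc.
      exact: (loo_scale_le hH s0 ker_le).
    rewrite /h -/a -[inputs _ ord0]/z.1.
    apply: (@le_trans _ _ (`|w z.1| * (`|a| * (s * c)))).
      by rewrite ler_wpM2l // ler_wpM2l.
    rewrite -(real_normK (num_real (w z.1))) -(real_normK (num_real a)) -subr_ge0.
    have -> : A * `|w z.1| ^+ 2 + B * `|a| ^+ 2 - `|w z.1| * (`|a| * (s * c)) =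
      s / (2 * N) * (c * `|w z.1| - N * `|a|) ^+ 2.
      by rewrite /A /B; field; rewrite gt_eqF.
    by rewrite mulr_ge0 ?sqr_ge0 // divr_ge0 ?(ltW s0) // mulr_ge0 // ltW.
have step : (\int[P]_v (ridge_val H s (inputs (Z v)) f1)%:E <=
    \int[Q]_v (h (augment Z v))%:E)%E.
  have mhA := measurable_fun_augment mh.
  have h0' (x : Omega * (X * R)) : (0 <= (h (augment Z x))%:E)%E by rewrite lee_fin.
  rewrite (@fubini_tonelli1 _ _ _ _ _ P rho _ mhA h0').
  apply: ge0_le_integral => //.
  - by move=> v _; rewrite lee_fin ridge_val_ge0.
  - have hm := @measurable_ridge_val n f1 cf1.
    by apply/measurable_EFinP; exact: measurableT_comp hm mZ.
  - exact: measurable_fun_fubini_tonelli_F mhA h0'.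
have split : (\int[Q]_v (h (augment Z v))%:E =
    A%:E * (cov_form mu w w)%:E + B%:E * \int[Q]_v (al (augment Z v) ^+ 2)%:E)%E.
  under eq_integral do rewrite /h EFinD !EFinM.
  rewrite ge0_integralD //; last 4 first.
  - by move=> v _; rewrite -EFinM lee_fin mulr_ge0 ?sqr_ge0.
  - by apply: measurable_funeM; exact: measurable_fun_augment mw0.
  - by move=> v _; rewrite -EFinM lee_fin mulr_ge0 ?sqr_ge0.
  - by apply: measurable_funeM; apply: (measurable_fun_augment mal2).
  rewrite !ge0_integralZl //; last 4 first.
  - exact: (measurable_fun_augment mal2).
  - by move=> v _; rewrite lee_fin sqr_ge0.
  - exact: (measurable_fun_augment mw0).
  - by move=> v _; rewrite lee_fin sqr_ge0.
  congr (_ * _ + _)%E.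
  have mw2 : measurable_fun setT (fun x => (w x ^+ 2)%:E).
    by apply/measurable_EFinP; exact: measurable_funX.
  have mw2' : measurable_fun setT (fun z : X * R => (w z.1 ^+ 2)%:E).
    exact: measurableT_comp mw2 measurable_fst.
  rewrite (@integral_fresh _ _ _ rho _ _ P n Z (fun z => (w z.1 ^+ 2)%:E) mw2') => [|z]; last first.
    by rewrite lee_fin sqr_ge0.
  rewrite (integral_marginal mw2) => [|x]; last by rewrite lee_fin sqr_ge0.
  rewrite /cov_form /Rintegral fineK; last exact: integrable_fin_num (rk_integrable mu hH msec ker_le cw cw).
  by apply: eq_integral => x _; rewrite expr2.
have final : (q%:E <= A%:E * (cov_form mu w w)%:E + B%:E * (((N * s)^-1)%:E * q%:E))%E.
  rewrite -qE; apply: (le_trans step); rewrite split leeD2l // lee_wpmul2l ?lee_fin //.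
  exact: expected_coef_sqr.
rewrite qE; move: final; rewrite -!EFinM -EFinD !lee_fin => final.
have B2 : B * ((N * s)^-1 * q) = q / 2 by rewrite /B; field; rewrite !gt_eqF.
have -> : s * c ^+ 2 / N * cov_form mu w w = 2 * (A * cov_form mu w w).
  by rewrite /A; field; rewrite gt_eqF.
rewrite B2 in final; lra.
Qed.

Definition residual m f (p : 'I_m.+1 -> X) : R := f (p ord0) -
  kcomb H (others p) (ridge H s (others p) (f \o others p)) (p ord0).

Lemma measurable_residual m f : measurable_fun setT f ->
  measurable_fun setT (fun t : m.+1.-tuple (X * R) => residual f (inputs t)).
Proof.
move=> mf; apply: measurable_funB; first exact: measurable_fun_inputs.
apply: measurable_sum => i; apply: measurable_funM.
  apply: measurable_ridge => // l; first exact: measurable_inputs.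
  exact: (measurable_fun_inputs (lift ord0 l)).
have -> : (fun t : m.+1.-tuple (X * R) => rk_ker H (others (inputs t) i) (inputs t ord0)) =
  (fun z : X * X => rk_ker H z.1 z.2) \o (fun t => (inputs t (lift ord0 i), inputs t ord0)) by [].
by apply: measurableT_comp => //; apply: measurable_fun_pair; exact: measurable_inputs.
Qed.

(** One factor [c^2] comes from the scale in leave-one-out, the other from [expected_val_cov]
    applied to [f1 = T w]; the factor 2 comes from splitting [f] into [f1 + lam w]. The two
    contributions recombine into [<f, w> = cov w w + lam <w, w>]. *)
Lemma expected_residual_sqr f w lam : rk_car H f -> rk_car H w ->
  0 < lam -> s <= N * lam ->
  (forall g, rk_car H g -> cov_form mu w g + lam * rk_ip H w g = rk_ip H f g) ->
  (\int[Q]_v (residual f (inputs (augment Z v)) ^+ 2)%:E <=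
    (2 * c ^+ 4 * lam ^+ 2 * rk_ip H f w)%:E)%E.
Proof.
move=> cf cw lam0 sN wP.
have mf := rk_measurable hH msec cf.
have c1 : 1 <= c by rewrite lerDl divr_ge0 ?sqr_ge0 ?(ltW s0).
have sc : s + kappa ^+ 2 = s * c by rewrite /c; field; rewrite gt_eqF.
pose al (t : n.+1.-tuple (X * R)) := ridge H s (inputs t) (f \o inputs t) ord0.
have mal2 : measurable_fun setT (fun t => al t ^+ 2).
  by apply: measurable_funX; exact: measurable_ridge_inputs.
have cl : rk_car H (fun x => lam * w x) by exact: (lin_closedZ lc).
pose f1 x := f x - lam * w x.
have cf1 : rk_car H f1 by exact: (lin_closedB lc).
have f1E g : rk_car H g -> rk_ip H f1 g = cov_form mu w g.
  by move=> cg; rewrite /f1 (formBl ipf) // (formZl lc ipf) // -wP // addrK.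
have [q q0 qE] := expected_val_fin cf.
have [q1 q10 q1E] := expected_val_fin cf1.
have covw0 := form_ge0 (cov_psd_form mu hH msec ker_le) cw.
have ipw0 := form_ge0 ipf cw.
have q1le : q1 <= s * c ^+ 2 / N * cov_form mu w w.
  by rewrite -lee_fin -q1E; exact: expected_val_cov.
have mval g : rk_car H g -> measurable_fun setT (fun v => (ridge_val H s (inputs (Z v)) g)%:E).
  move=> cg; have hm := @measurable_ridge_val n g cg.
  by apply/measurable_EFinP; exact: measurableT_comp hm mZ.
have qle : q <= 2 * q1 + 2 * (lam ^+ 2 * rk_ip H w w).
  rewrite -lee_fin -qE EFinD EFinM -q1E.
  apply: (@le_trans _ _ (\int[P]_v (2%:E * (ridge_val H s (inputs (Z v)) f1)%:E +
     (2 * (lam ^+ 2 * rk_ip H w w))%:E))%E).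
    apply: ge0_le_integral => //.
    - by move=> v _; rewrite lee_fin ridge_val_ge0.
    - exact: mval.
    - by apply: emeasurable_funD => //; apply: measurable_funeM; exact: mval.
    move=> v _; rewrite -EFinM -EFinD lee_fin.
    have -> : f = (fun x => f1 x + lam * w x) by apply/funext => x; rewrite /f1 subrK.
    apply: (le_trans (ridge_valD hH s0 (inputs (Z v)) cf1 cl)).
    rewrite lerD2l ler_pM2l //; apply: (le_trans (ridge_val_le hH s0 (inputs (Z v)) cl)).
    by rewrite (formZl lc ipf) // (formZr lc ipf) // mulrA -expr2.
  rewrite ge0_integralD //; last 3 first.
  - by move=> v _; rewrite -EFinM lee_fin mulr_ge0 // ridge_val_ge0.
  - by apply: measurable_funeM; exact: mval.
  - move=> v _; rewrite lee_fin mulr_ge0 // mulr_ge0 ?sqr_ge0 //.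
  rewrite ge0_integralZl //; last 2 first.
  - exact: mval.
  - by move=> v _; rewrite lee_fin ridge_val_ge0.
  rewrite leeD2l // (integral_cst P measurableT (2 * (lam ^+ 2 * rk_ip H w w))%:E).
  by rewrite [X in (_ * X)%E]probability_setT mule1.
have step : (\int[Q]_v (residual f (inputs (augment Z v)) ^+ 2)%:E <=
    ((s * c) ^+ 2)%:E * (((N * s)^-1)%:E * q%:E))%E.
  apply: (@le_trans _ _ (\int[Q]_v (((s * c) ^+ 2)%:E * (al (augment Z v) ^+ 2)%:E))%E).
    apply: ge0_le_integral => //.
    - by move=> v _; rewrite lee_fin sqr_ge0.
    - have hm : measurable_fun setT (fun t : n.+1.-tuple (X * R) => residual f (inputs t) ^+ 2).
        by apply: measurable_funX; exact: measurable_residual.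
      exact: measurable_fun_augment hm.
    - by apply: measurable_funeM; exact: measurable_fun_augment mal2.
    move=> v _; rewrite -EFinM lee_fin /residual (loo_residual_fun hH s0) -/(al _).
    rewrite exprMn mulrC ler_wpM2r ?sqr_ge0 // -sc.
    have S0 := loo_scale_ge hH s0 (inputs (augment Z v)).
    rewrite ler_sqr ?nnegrE ?(le_trans (ltW s0) S0) //.
      exact: (loo_scale_le hH s0 ker_le).
    by rewrite addr_ge0 ?sqr_ge0 ?(ltW s0).
  rewrite ge0_integralZl //; last 3 first.
  - exact: measurable_fun_augment mal2.
  - by move=> v _; rewrite lee_fin sqr_ge0.
  - by rewrite lee_fin sqr_ge0.
  rewrite lee_wpmul2l ?lee_fin ?sqr_ge0 // -qE.
  exact: expected_coef_sqr.
apply: (le_trans step); rewrite -!EFinM lee_fin -wP //.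
have -> : (s * c) ^+ 2 * ((N * s)^-1 * q) = c ^+ 2 * (s / N) * q.
  by field; rewrite !gt_eqF.
pose t := s / N; have t0 : 0 <= t by rewrite /t divr_ge0 // ltW.
have tl : t <= lam by rewrite /t ler_pdivrMr // mulrC.
have q1le' : q1 <= t * c ^+ 2 * cov_form mu w w.
  by apply: (le_trans q1le); rewrite /t (mulrAC s).
set C := cov_form mu w w in covw0 q1le' *; set W := rk_ip H w w in ipw0 qle *.
have c20 : 0 <= c ^+ 2 by exact: sqr_ge0.
have c21 : 1 <= c ^+ 2 by rewrite exprn_ege1.
apply: (@le_trans _ _ (c ^+ 2 * lam * (2 * (lam * c ^+ 2 * C) + 2 * (lam ^+ 2 * W)))).
  rewrite -/t; apply: ler_pM => //; first exact: mulr_ge0.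
    by rewrite ler_wpM2l.
  apply: (le_trans qle); rewrite lerD2r ler_pM2l //; apply: (le_trans q1le').
  by rewrite ler_wpM2r // ler_wpM2r.
have -> : 2 * c ^+ 4 * lam ^+ 2 * (C + lam * W) =
   c ^+ 2 * lam * (2 * (lam * c ^+ 2 * C) + 2 * (c ^+ 2 * (lam ^+ 2 * W))) by ring.
apply: ler_wpM2l; first by rewrite mulr_ge0 // ltW.
rewrite lerD2l ler_pM2l // ler_peMl //.
by rewrite mulr_ge0 // sqr_ge0.
Qed.

Lemma unit_at_swap m (l : 'I_m.+1) : unit_at l \o swap_ord l = unit_at ord0 :> ('I_m.+1 -> R).
Proof.
apply/funext => i; rewrite /unit_at /swap_ord /=; congr (_%:R); congr nat_of_bool.
have [_|i0] := eqVneq i ord0; first by rewrite eqxx.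
have [il|il] := eqVneq i l; first by rewrite eq_sym -il (negPf i0).
by rewrite (negPf il).
Qed.

Lemma ridge_unit_swap m (p : 'I_m.+1 -> X) l :
  ridge H s (p \o swap_ord l) (unit_at ord0) ord0 = ridge H s p (unit_at l) l.
Proof.
rewrite -(unit_at_swap l) ridge_perm //=.
exact: inv_inj (@swap_ordK _ l).
Qed.

(** After moving the point [l] to the front this is [1 - s / S] for a scale [S >= s]. *)
Lemma leverage_ge0 m (p : 'I_m.+1 -> X) l : 0 <= 1 - s * ridge H s p (unit_at l) l.
Proof.
rewrite -ridge_unit_swap; set p' := p \o _.
have S1 := loo_scale_ge hH s0 p'.
have S0 : 0 < loo_scale H s p' := lt_le_trans s0 S1.
have -> : ridge H s p' (unit_at ord0) ord0 = (loo_scale H s p')^-1.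
  by apply: (mulIf (lt0r_neq0 S0)); rewrite loo_scaleV // mulVf // gt_eqF.
by rewrite subr_ge0 ler_pdivrMr // mul1r.
Qed.

Lemma measurable_ridge_unit m (l i : 'I_m) :
  measurable_fun setT (fun t : m.-tuple (X * R) => ridge H s (inputs t) (unit_at l) i).
Proof.
by apply: measurable_ridge => // k; exact: measurable_inputs.
Qed.

Lemma expected_sum_sqr (g : X -> R) : rk_car H g ->
  (\int[Q]_v (\sum_i g (inputs (augment Z v) i) ^+ 2)%:E = (N * cov_form mu g g)%:E)%E.
Proof.
move=> cg; have mg := rk_measurable hH msec cg.
pose F (l : 'I_n.+1) (t : n.+1.-tuple (X * R)) : \bar R := (g (inputs t l) ^+ 2)%:E.
have mF l : measurable_fun setT (F l).
  by apply/measurable_EFinP/measurable_funX; exact: measurable_fun_inputs.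
have F0 l t : (0 <= F l t)%E by rewrite lee_fin sqr_ge0.
have FE l t : F ord0 [tuple tnth t (swap_ord l i) | i < n.+1] = F l t.
  by rewrite /F inputs_swap /= /swap_ord eqxx.
have := iid_exchange iidQ mF F0 FE.
under eq_integral do rewrite /F sumEFin.
move=> ->.
have mg2 : measurable_fun setT (fun x => (g x ^+ 2)%:E).
  by apply/measurable_EFinP; exact: measurable_funX.
have mg2' : measurable_fun setT (fun z : X * R => (g z.1 ^+ 2)%:E).
  exact: measurableT_comp mg2 measurable_fst.
rewrite /F (@integral_fresh _ _ _ rho _ _ P n Z (fun z => (g z.1 ^+ 2)%:E) mg2') => [|z]; last first.
  by rewrite lee_fin sqr_ge0.
rewrite (integral_marginal mg2) => [|x]; last by rewrite lee_fin sqr_ge0.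
rewrite EFinM /cov_form /Rintegral fineK; last exact: integrable_fin_num (rk_integrable mu hH msec ker_le cg cg).
by congr (_ * _)%E; apply: eq_integral => x _; rewrite expr2.
Qed.

(** The squared weights are dominated by the leverage of the fresh point, whose expectation is
    [1 / N] times that of the trace. The hypothesis [N * lam <= 2 * s] converts the regularization
    [s] of a sum over points into that of an average, at the price of a factor 2. *)
Lemma expected_weight_sqr lam D0 e0 : 0 < lam -> N * lam <= 2 * s ->
  orthonormal_basis H D0 e0 ->
  (\int[Q]_v (\sum_i loo_weight H s (inputs (augment Z v)) i ^+ 2)%:E <=
    (2 * c / N)%:E * effective_dim H (covariance_op H mu) lam)%E.
Proof.
move=> lam0 sN onb0.
have [D [e [u [onb uP u0 uE]]]] := effective_dim_basis mu hH msec ker_le lam0 onb0.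
have cm i : rk_car H (masked D e i) by exact: masked_car.
pose ed := effective_dim H (covariance_op H mu) lam.
pose lev (l : 'I_n.+1) (t : n.+1.-tuple (X * R)) := 1 - s * ridge H s (inputs t) (unit_at l) l.
have mlev l : measurable_fun setT (lev l).
  apply: measurable_funB; first exact: measurable_cst.
  by apply: measurable_funM; [exact: measurable_cst|exact: measurable_ridge_unit].
pose en j (t : n.+1.-tuple (X * R)) :=
  \sum_i ridge H s (inputs t) (masked D e j \o inputs t) i * masked D e j (inputs t i).
have en0 j t : 0 <= en j t by exact: (ridge_energy_ge0 hH s0).
have men j : measurable_fun setT (en j).
  have mm := rk_measurable hH msec (cm j).
  apply: measurable_sum => i; apply: measurable_funM; first exact: measurable_ridge_inputs.
  exact: measurable_fun_inputs.
(* The trial function is the deterministic [u j = (T + lam)^-1 T e_j]. After expectation the bound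
   is the population one, up to [N lam / s <= 2], and [resolvent_energy] evaluates it. *)
have enle j : (\int[Q]_v (en j (augment Z v))%:E <= (2 * rk_ip H (u j) (masked D e j))%:E)%E.
  have [cu uj] := uP j; pose g x := masked D e j x - u j x.
  have cg : rk_car H g by exact: (lin_closedB lc).
  have mg := rk_measurable hH msec cg.
  have ipu := form_ge0 ipf cu.
  have msum : measurable_fun setT (fun t : n.+1.-tuple (X * R) => \sum_i g (inputs t i) ^+ 2).
    by apply: measurable_sum => i; apply: measurable_funX; exact: measurable_fun_inputs.
  apply: (@le_trans _ _ (\int[Q]_v ((s^-1)%:E * (\sum_i g (inputs (augment Z v) i) ^+ 2)%:E +
      (rk_ip H (u j) (u j))%:E))%E).
    apply: ge0_le_integral => //.
    - by move=> v _; rewrite lee_fin.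
    - exact: measurable_fun_augment.
    - by apply: emeasurable_funD => //; apply: measurable_funeM; exact: measurable_fun_augment msum.
    by move=> v _; rewrite -EFinM -EFinD lee_fin; exact: (ridge_energy_le hH s0).
  have sum0 v : 0 <= \sum_i g (inputs (augment Z v) i) ^+ 2.
    by apply: sumr_ge0 => i _; exact: sqr_ge0.
  rewrite ge0_integralD //; last 2 first.
  - by move=> v _; rewrite -EFinM lee_fin mulr_ge0 // invr_ge0 ltW.
  - by apply: measurable_funeM; exact: measurable_fun_augment msum.
  rewrite ge0_integralZl //; last 3 first.
  - exact: measurable_fun_augment msum.
  - by move=> v _; rewrite lee_fin.
  - by rewrite lee_fin invr_ge0 ltW.
  rewrite expected_sum_sqr //.
  have -> : (\int[Q]_v (rk_ip H (u j) (u j))%:E = (rk_ip H (u j) (u j))%:E)%E.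
    rewrite (integral_cst Q measurableT (rk_ip H (u j) (u j))%:E).
    have := iidQ.2 (fun=> setT) (fun=> measurableT).
    rewrite big1 => [|i _]; last exact: probability_setT.
    by rewrite (_ : [set w | _] = setT) => [->|]; [rewrite mule1|apply/seteqP; split].
  rewrite -EFinM -EFinD lee_fin -(ler_pM2l lam0).
  have := resolvent_energy hH msec ker_le (cm j) cu uj.
  have C0 := form_ge0 (cov_psd_form mu hH msec ker_le) cg.
  rewrite -/g => E; set C := cov_form mu g g in C0 E *.
  have : lam * (s^-1 * (N * C)) <= 2 * C.
    have -> : lam * (s^-1 * (N * C)) = N * lam / s * C by ring.
    by rewrite ler_wpM2r // ler_pdivrMr.
  have : 0 <= lam * rk_ip H (u j) (u j) by rewrite mulr_ge0 // ltW.
  move: E; lra.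
have trace t : ((\sum_l lev l t)%:E = \sum_(0 <= j <oo) (en j t)%:E)%E.
  apply/esym/cvg_lim => //.
  have tr := @ridge_trace _ _ _ _ hH s0 _ (inputs t) _ _ onb.
  have -> : (fun M => \sum_(0 <= j < M) (en j t)%:E)%E = EFin \o (fun M => \sum_(j < M) en j t).
    by apply/funext => M /=; rewrite big_mkord sumEFin.
  by apply: cvg_EFin; [near=> M|exact: tr].
(* The basis expansion has nonnegative terms, so series and expectation are exchanged and only
   partial sums remain to be bounded. *)
have levsum : (\int[Q]_v (\sum_l lev l (augment Z v))%:E <= 2%:E * ed)%E.
  under eq_integral do rewrite trace.
  rewrite integral_nneseries //; last 2 first.
  - by move=> j; exact: measurable_fun_augment.
  - by move=> j v _; rewrite lee_fin.
  apply: lime_le.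
    by apply: is_cvg_nneseries => j _ _; apply: integral_ge0 => v _; rewrite lee_fin.
  near=> M.
  apply: (@le_trans _ _ (\sum_(0 <= j < M) (2 * rk_ip H (u j) (masked D e j))%:E)%E).
    by apply: lee_sum => j _.
  under eq_bigr do rewrite EFinM.
  rewrite -ge0_sume_distrr => [|j _]; last by rewrite lee_fin.
  by rewrite lee_wpmul2l // big_mkord.
have exch : (N%:E * \int[Q]_v (lev ord0 (augment Z v))%:E <= 2%:E * ed)%E.
  pose F l t : \bar R := (lev l t)%:E.
  have mF l : measurable_fun setT (F l) by apply/measurable_EFinP; exact: mlev.
  have F0 l t : (0 <= F l t)%E by rewrite lee_fin; exact: leverage_ge0.
  have FE l t : F ord0 [tuple tnth t (swap_ord l i) | i < n.+1] = F l t.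
    by rewrite /F /lev inputs_swap ridge_unit_swap.
  rewrite -(iid_exchange iidQ mF F0 FE).
  by under eq_integral do rewrite /F sumEFin.
apply: (@le_trans _ _ (\int[Q]_v (c%:E * (lev ord0 (augment Z v))%:E))%E).
  apply: ge0_le_integral => //.
  - by move=> v _; rewrite lee_fin sumr_ge0 // => i _; exact: sqr_ge0.
  - have mw : measurable_fun setT (fun t : n.+1.-tuple (X * R) => \sum_i loo_weight H s (inputs t) i ^+ 2).
      apply: measurable_sum => i; apply: measurable_funX.
      apply: measurable_ridge => // l; first exact: measurable_inputs.
      have -> : (fun t : n.+1.-tuple (X * R) => (rk_ker H (inputs t ord0) \o others (inputs t)) l) =
        (fun z : X * X => rk_ker H z.1 z.2) \o (fun t => (inputs t ord0, inputs t (lift ord0 l))) by [].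
      by apply: measurableT_comp => //; apply: measurable_fun_pair; exact: measurable_inputs.
    exact: measurable_fun_augment mw.
  - by apply: measurable_funeM; exact: measurable_fun_augment.
  by move=> v _; rewrite -EFinM lee_fin; exact: (loo_weight_sqr_le hH s0 ker_le).
rewrite ge0_integralZl //; last 3 first.
- exact: measurable_fun_augment.
- by move=> v _; rewrite lee_fin; exact: leverage_ge0.
- by rewrite lee_fin ltW.
have -> : (2 * c / N)%:E = (c%:E * ((N^-1)%:E * 2%:E))%E by rewrite -!EFinM; congr EFin; ring.
rewrite -!muleA lee_wpmul2l ?lee_fin ?(ltW c0) //.
have E1 (x : \bar R) : x = ((N^-1)%:E * (N%:E * x))%E.
  by rewrite muleA -EFinM (mulVf (lt0r_neq0 N0)) mul1e.
rewrite [leLHS]E1 lee_wpmul2l // lee_fin invr_ge0.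
exact: ltW.
Unshelve. all: by end_near.
Qed.

End sample.
End expected_residuals.

Section product_probability.
Context {R : realType} {d1 d2 : measure_display}.
Context {T1 : measurableType d1} {T2 : measurableType d2}.
Variables (P1 : probability T1 R) (P2 : probability T2 R).

(** Named so that the product can carry a probability structure, needed to eliminate the noise on
    the augmented sample space. *)
Definition product_probability : set (T1 * T2) -> \bar R := (P1 \x P2)%E.

HB.instance Definition _ := Measure.on product_probability.

Let product_probability_setT : product_probability setT = 1%E.
Proof.
rewrite /product_probability -setXTT product_measure1E //.
by rewrite [X in (X * _)%E]probability_setT [X in (_ * X)%E]probability_setT mule1.
Qed.

HB.instance Definition _ :=
  Measure_isProbability.Build _ _ _ product_probability product_probability_setT.

End product_probability.

(** * Integrating out the noise *)

Section noise.
Context {R : realType} {d : measure_display} {X : measurableType d}.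
Variables (mu : probability X R) (rhoc : R.-pker X ~> R).
Variable rho : probability (X * R)%type R.
Hypothesis rhoE : forall A B, measurable A -> measurable B ->
  rho (A `*` B) = (\int[mu]_(x in A) rhoc x B)%E.
Context {d'} {Omega : measurableType d'}.
Variables (Q : probability Omega R) (m : nat).
Variable Z : Omega -> m.-tuple (X * R).
Hypothesis iidZ : iid rho Q Z.

Definition replace (t : m.-tuple (X * R)) (i : 'I_m) (z : X * R) : m.-tuple (X * R) :=
  [tuple if l == i then z else tnth t l | l < m].

(** Coordinate [i] is redrawn independently of the others, so comparing the conditional integrals in
    its output alone is enough. *)
Lemma resample_le (F G : m.-tuple (X * R) -> \bar R) (i : 'I_m) :
  measurable_fun setT F -> measurable_fun setT G ->
  (forall t, 0 <= F t)%E -> (forall t, 0 <= G t)%E ->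
  {ae mu, forall x, forall t, (\int[rhoc x]_y F (replace t i (x, y)) <=
    \int[rhoc x]_y G (replace t i (x, y)))%E} ->
  (\int[Q]_w F (Z w) <= \int[Q]_w G (Z w))%E.
Proof.
move=> mF mG F0 G0 FG.
have iidr := iid_resample i iidZ.
have mr (K : m.-tuple (X * R) -> \bar R) : measurable_fun setT K ->
    measurable_fun setT (fun wz : Omega * (X * R) => K (replace (Z wz.1) i wz.2)).
  by move=> mK; exact: measurableT_comp mK iidr.1.
have E (K : m.-tuple (X * R) -> \bar R) : measurable_fun setT K -> (forall t, 0 <= K t)%E ->
    (\int[Q]_w K (Z w) = \int[Q]_w \int[rho]_z K (replace (Z w) i z))%E.
  move=> mK K0; rewrite (iid_integral_eq iidZ iidr mK K0).
  exact: (@fubini_tonelli1 _ _ _ _ _ Q rho _ (mr _ mK) (fun=> K0 _)).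
rewrite (E _ mF F0) (E _ mG G0); apply: ge0_le_integral => //.
- by move=> w _; apply: integral_ge0.
- exact: (@measurable_fun_fubini_tonelli_F _ _ _ _ _ rho _ (mr _ mF) (fun=> F0 _)).
- exact: (@measurable_fun_fubini_tonelli_F _ _ _ _ _ rho _ (mr _ mG) (fun=> G0 _)).
move=> w _.
have mw (K : m.-tuple (X * R) -> \bar R) : measurable_fun setT K ->
    measurable_fun setT (fun z => K (replace (Z w) i z)).
  by move=> mK; exact: measurableT_comp (mr _ mK) (@pair1_measurable _ _ Omega (X * R)%type w).
have D (K : m.-tuple (X * R) -> \bar R) : measurable_fun setT K -> (forall t, 0 <= K t)%E ->
    (\int[rho]_z K (replace (Z w) i z) =
     \int[mu]_x \int[rhoc x]_y K (replace (Z w) i (x, y)))%E.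
  by move=> mK K0; exact: (integral_disintegration rhoE (mw _ mK)).
have mI (K : m.-tuple (X * R) -> \bar R) : measurable_fun setT K -> (forall t, 0 <= K t)%E ->
    measurable_fun setT (fun x => \int[rhoc x]_y K (replace (Z w) i (x, y)))%E.
  move=> mK K0.
  exact: (measurable_fun_integral_finite_kernel (fun z => K (replace (Z w) i z)) rhoc
    (fun=> K0 _) (mw _ mK)).
rewrite (D _ mF F0) (D _ mG G0); apply: ae_ge0_le_integral => //.
- by move=> x _; exact: integral_ge0.
- exact: mI.
- by move=> x _; exact: integral_ge0.
- exact: mI.
by apply: filterS FG => x FGx _; exact: FGx.
Qed.

(** In the telescoping quantity [Phi j], noise terms of index below [j] still sit inside the square
    and the others are already replaced by their variance bound. Thus [Phi m] is the left integrand
    and [Phi 0] the right one. *)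
Lemma noise_elimination (f : X -> R) (sigma : R) (b : ('I_m -> X) -> R)
    (eta : ('I_m -> X) -> 'I_m -> R) :
  measurable_fun setT f ->
  {ae mu, forall x, regression_fun rhoc x = f x} ->
  {ae mu, forall x, (\int[rhoc x]_y ((y - regression_fun rhoc x) ^+ 2)%:E <= (sigma ^+ 2)%:E)%E} ->
  measurable_fun setT (fun t : m.-tuple (X * R) => b (inputs t)) ->
  (forall i, measurable_fun setT (fun t : m.-tuple (X * R) => eta (inputs t) i)) ->
  (\int[Q]_w ((b (inputs (Z w)) + \sum_i eta (inputs (Z w)) i *
     (outputs (Z w) i - f (inputs (Z w) i))) ^+ 2)%:E <=
   \int[Q]_w (b (inputs (Z w)) ^+ 2 + sigma ^+ 2 * \sum_i eta (inputs (Z w)) i ^+ 2)%:E)%E.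
Proof.
move=> mf regf var_le mb meta.
pose A j (t : m.-tuple (X * R)) := b (inputs t) +
  \sum_(i < m) (i < j)%N%:R * (eta (inputs t) i * (outputs t i - f (inputs t i))).
pose B j (t : m.-tuple (X * R)) := sigma ^+ 2 * \sum_(i < m) (j <= i)%N%:R * eta (inputs t) i ^+ 2.
pose Phi j t := A j t ^+ 2 + B j t.
have B0 j t : 0 <= B j t.
  by rewrite mulr_ge0 ?sqr_ge0 // sumr_ge0 // => i _; rewrite mulr_ge0 ?sqr_ge0.
have Phi0 j t : 0 <= Phi j t by rewrite addr_ge0 ?sqr_ge0.
have mPhi j : measurable_fun setT (fun t => (Phi j t)%:E).
  apply/measurable_EFinP; apply: measurable_funD.
    apply: measurable_funX; apply: measurable_funD => //.
    apply: measurable_sum => i; apply: measurable_funM; first exact: measurable_cst.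
    apply: measurable_funM => //; apply: measurable_funB; first exact: measurable_outputs.
    exact: measurable_fun_inputs.
  apply: measurable_funM; first exact: measurable_cst.
  apply: measurable_sum => i; apply: measurable_funM; first exact: measurable_cst.
  exact: measurable_funX.
suff main j : (j <= m)%N -> (\int[Q]_w (Phi j (Z w))%:E <= \int[Q]_w (Phi 0%N (Z w))%:E)%E.
  have := main m (leqnn m); congr (_ <= _)%E; apply: eq_integral => w _; congr EFin.
    rewrite /Phi /A /B [X in _ + sigma ^+ 2 * X]big1 ?mulr0 ?addr0.
      by congr ((_ + _) ^+ 2); apply: eq_bigr => i _; rewrite ltn_ord mul1r.
    by move=> i _; rewrite leqNgt ltn_ord mul0r.
  rewrite /Phi /A /B big1 ?addr0; last by move=> i _; rewrite mul0r.
  by congr (_ + _ * _); apply: eq_bigr => i _; rewrite mul1r.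
elim: j => // j IH jm; apply: le_trans (IH (ltnW jm)).
(* From [Phi j.+1] to [Phi j] only the output at [i0] is averaged. [A j] and both [B] terms do not
   see that output, so the square is affine in it and its cross term has mean zero. *)
pose i0 := Ordinal jm.
apply: (@resample_le (fun t => (Phi j.+1 t)%:E) (fun t => (Phi j t)%:E) i0) => //.
  by move=> t; rewrite lee_fin.
  by move=> t; rewrite lee_fin.
apply: filterS2 regf var_le => x regx varx t.
pose p l := if l == i0 then x else inputs t l.
have pi0 : p i0 = x by rewrite /p eqxx.
have inE y : inputs (replace t i0 (x, y)) = p.
  by apply/funext => l; rewrite /inputs tnth_mktuple /p; case: ifP.
have outE y l : outputs (replace t i0 (x, y)) l = if l == i0 then y else outputs t l.
  by rewrite /outputs tnth_mktuple; case: ifP.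
pose a := b p + \sum_(i < m) (i < j)%N%:R * (eta p i * (outputs t i - f (p i))).
pose be := sigma ^+ 2 * \sum_(i < m) (j < i)%N%:R * eta p i ^+ 2.
have be0 : 0 <= be.
  by rewrite mulr_ge0 ?sqr_ge0 // sumr_ge0 // => i _; rewrite mulr_ge0 ?sqr_ge0.
have aE y : A j (replace t i0 (x, y)) = a.
  rewrite /A inE; congr (_ + _); apply: eq_bigr => i _; rewrite outE.
  by case: eqVneq => // ->; rewrite /= ltnn !mul0r.
have aE1 y : A j.+1 (replace t i0 (x, y)) = a + eta p i0 * (y - regression_fun rhoc x).
  rewrite /A inE /a -addrA; congr (_ + _).
  rewrite (bigD1 i0) //= [in RHS](bigD1 i0) //= outE eqxx ltnSn ltnn mul0r add0r mul1r.
  rewrite [RHS]addrC regx pi0; congr (_ + _); apply: eq_bigr => i ii0.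
  rewrite outE (negPf ii0) ltnS leq_eqVlt.
  by rewrite (_ : (i : nat) == j = false) //; apply/negbTE.
have bE1 y : B j.+1 (replace t i0 (x, y)) = be by rewrite /B inE.
have bE y : B j (replace t i0 (x, y)) = be + sigma ^+ 2 * eta p i0 ^+ 2.
  rewrite /B inE /be -mulrDr; congr (_ * _).
  rewrite (bigD1 i0) //= [in RHS](bigD1 i0) //= leqnn ltnn mul1r mul0r add0r addrC.
  congr (_ + _); apply: eq_bigr => i ii0.
  rewrite [(j <= i)%N]leq_eqVlt (_ : (j == i :> nat) = false) //.
  by apply/negbTE; rewrite eq_sym.
under eq_integral do rewrite /Phi aE1 bE1 EFinD.
under [leRHS]eq_integral do rewrite /Phi aE bE.
have q1 : rhoc x setT = 1%E by exact: prob_kernel.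
have vlty : (\int[rhoc x]_y ((y - regression_fun rhoc x) ^+ 2)%:E < +oo)%E.
  exact: le_lt_trans varx (ltry _).
rewrite ge0_integralD //; last 2 first.
- by move=> y _; rewrite lee_fin sqr_ge0.
- apply/measurable_EFinP; apply: measurable_funX; apply: measurable_funD => //.
  by apply: measurable_funM => //; apply: measurable_funB => //; exact: measurable_cst.
rewrite [X in (X + _)%E](integral_sqr_affine q1 a (eta p i0) vlty).
rewrite (integral_cst (rhoc x) measurableT be%:E).
rewrite (integral_cst (rhoc x) measurableT (a ^+ 2 + (be + sigma ^+ 2 * eta p i0 ^+ 2))%:E).
rewrite q1 !mule1.
have -> : (a ^+ 2 + (be + sigma ^+ 2 * eta p i0 ^+ 2))%:E =
   ((a ^+ 2)%:E + (eta p i0 ^+ 2)%:E * (sigma ^+ 2)%:E + be%:E)%E.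
  by rewrite -EFinM -!EFinD; congr EFin; ring.
by rewrite leeD2r // leeD2l // lee_wpmul2l // lee_fin sqr_ge0.
Qed.

End noise.

(** * The error of one local estimator *)

Section local_error.
Context {R : realType} {d : measure_display} {X : measurableType d}.
Variables (mu : probability X R) (rhoc : R.-pker X ~> R).
Variable rho : probability (X * R)%type R.
Hypothesis rhoE : forall A B, measurable A -> measurable B ->
  rho (A `*` B) = (\int[mu]_(x in A) rhoc x B)%E.
Variables (H : rkhs R X) (kappa lam : R).
Hypothesis hH : is_rkhs H.
Hypothesis mker : measurable_fun setT (fun z : X * X => rk_ker H z.1 z.2).
Hypothesis ker_le : forall x, rk_ker H x x <= kappa ^+ 2.
Hypothesis lam0 : 0 < lam.
Context {d'} {Omega : measurableType d'} (P : probability Omega R).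
Variables (k : nat) (Z : Omega -> k.-tuple (X * R)).
Hypothesis iidZ : iid rho P Z.

Let lc := rk_lin_closed hH.
Let ipf := rk_psd_form hH.
Let msec := measurable_ker_section mker.
(* Without data the estimator is 0 whatever the ridge parameter. *)
Let s := (maxn k 1)%:R * lam.
Let c := 1 + kappa ^+ 2 / s.
Let N : R := k.+1%:R.

Let s0 : 0 < s. Proof. by rewrite mulr_gt0 // ltr0n leq_max orbT. Qed.

Lemma krls_kcomb (t : k.-tuple (X * R)) x :
  krls (rk_ker H) (fun i => tnth t i) lam x =
  kcomb H (inputs t) (ridge H s (inputs t) (outputs t)) x.
Proof.
rewrite /krls /kcomb /s; case: k t => [|k'] t; first by rewrite !big_ord0.
by rewrite (maxn_idPl _) //; apply: eq_bigr.
Qed.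

(** The weight is 0 at the fresh point, whose output is not observed by the estimator. *)
Let eta (p : 'I_k.+1 -> X) i := if unlift ord0 i is Some j then loo_weight H s p j else 0.

(** The prediction is linear in the outputs; [ridge_dual] exhibits its weights as functions of the
    inputs, as [noise_elimination] requires. Noiseless outputs leave minus the residual. *)
Lemma krls_error_decomposition f (t : k.+1.-tuple (X * R)) : rk_car H f ->
  kcomb H (others (inputs t)) (ridge H s (others (inputs t)) (others (outputs t)))
    (inputs t ord0) - f (inputs t ord0) =
  - residual H s f (inputs t) +
  \sum_i eta (inputs t) i * (outputs t i - f (inputs t i)).
Proof.
move=> cf; rewrite /residual; set p := inputs t.
have E y : kcomb H (others p) (ridge H s (others p) y) (p ord0) =
    \sum_i loo_weight H s p i * y i.
  transitivity (\sum_i ridge H s (others p) y i * (rk_ker H (p ord0) \o others p) i).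
    by apply: eq_bigr => i _; congr (_ * _); exact: rk_kerC.
  exact: (ridge_dual hH s0).
have -> : \sum_i eta p i * (outputs t i - f (p i)) =
    \sum_i loo_weight H s p i * others (outputs t) i -
    \sum_i loo_weight H s p i * (f \o others p) i.
  rewrite big_ord_recl {1}/eta unlift_none mul0r add0r -sumrB.
  by apply: eq_bigr => i _; rewrite /eta liftK mulrBr.
rewrite !E; ring.
Qed.

Let err f (t : k.+1.-tuple (X * R)) :=
  kcomb H (others (inputs t)) (ridge H s (others (inputs t)) (others (outputs t)))
    (inputs t ord0) - f (inputs t ord0).

Let measurable_err f : rk_car H f -> measurable_fun setT (err f).
Proof.
move=> cf; have mf := rk_measurable hH msec cf.
apply: measurable_funB; last exact: measurable_fun_inputs.
apply: measurable_sum => i; apply: measurable_funM.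
  apply: measurable_ridge => // l; first exact: measurable_inputs.
  exact: measurable_outputs.
have -> : (fun t : k.+1.-tuple (X * R) => rk_ker H (others (inputs t) i) (inputs t ord0)) =
  (fun z : X * X => rk_ker H z.1 z.2) \o (fun t => (inputs t (lift ord0 i), inputs t ord0)) by [].
by apply: measurableT_comp => //; apply: measurable_fun_pair; exact: measurable_inputs.
Qed.

Let measurable_err_sqr f : rk_car H f ->
  measurable_fun setT (fun v => (err f (augment Z v) ^+ 2)%:E).
Proof.
by move=> cf; exact: (measurable_fun_augment iidZ (measurable_funX 2 (measurable_err cf))).
Qed.

Let local_errorE f v : rk_car H f ->
  (\int[mu]_x ((krls (rk_ker H) (fun i => tnth (Z v) i) lam x - f x) ^+ 2)%:E =
   \int[rho]_z (err f (augment Z (v, z)) ^+ 2)%:E)%E.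
Proof.
move=> cf; have mf := rk_measurable hH msec cf.
have mk : measurable_fun setT (fun x => ((krls (rk_ker H) (fun i => tnth (Z v) i) lam x - f x) ^+ 2)%:E).
  apply/measurable_EFinP; apply: measurable_funX; apply: measurable_funB => //.
  have -> : krls (rk_ker H) (fun i => tnth (Z v) i) lam =
      kcomb H (inputs (Z v)) (ridge H s (inputs (Z v)) (outputs (Z v))).
    by apply/funext => x; exact: krls_kcomb.
  by apply: (rk_measurable hH msec); exact: kcomb_car.
rewrite -(integral_marginal rhoE mk) => [|x]; last by rewrite lee_fin sqr_ge0.
apply: eq_integral => z _; congr (_%:E); rewrite krls_kcomb /err others_inputs.
have -> // : others (outputs (augment Z (v, z))) = outputs (Z v).
by apply/funext => i; rewrite /others /outputs /= tnthS.
Qed.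

Lemma measurable_local_error f : rk_car H f -> measurable_fun setT (fun v =>
  \int[mu]_x ((krls (rk_ker H) (fun i => tnth (Z v) i) lam x - f x) ^+ 2)%:E)%E.
Proof.
move=> cf; under eq_fun do rewrite local_errorE //.
apply: (@measurable_fun_fubini_tonelli_F _ _ _ _ _ rho _ (measurable_err_sqr cf)).
by move=> v; rewrite lee_fin sqr_ge0.
Qed.

Lemma local_error_bound f w sigma D0 e0 :
  rk_car H f -> rk_car H w ->
  (forall g, rk_car H g -> cov_form mu w g + lam * rk_ip H w g = rk_ip H f g) ->
  orthonormal_basis H D0 e0 ->
  {ae mu, forall x, regression_fun rhoc x = f x} ->
  {ae mu, forall x, (\int[rhoc x]_y ((y - regression_fun rhoc x) ^+ 2)%:E <= (sigma ^+ 2)%:E)%E} ->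
  (\int[P]_v \int[mu]_x ((krls (rk_ker H) (fun i => tnth (Z v) i) lam x - f x) ^+ 2)%:E <=
   (2 * c ^+ 4 * lam ^+ 2 * rk_ip H f w)%:E +
   (sigma ^+ 2)%:E * ((2 * c / N)%:E * effective_dim H (covariance_op H mu) lam))%E.
Proof.
move=> cf cw wP onb0 regf var_le.
have mf := rk_measurable hH msec cf.
have iidQ := iid_cons iidZ.
have N0 : 0 < N by rewrite ltr0n.
(* With [N = k + 1], the two comparisons [s <= N lam <= 2 s] also hold for [k = 0], thanks to the
   maximum in [s]. *)
have sN : s <= N * lam.
  by rewrite ler_wpM2r ?(ltW lam0) // ler_nat geq_max leqnSn.
have Ns : N * lam <= 2 * s.
  rewrite mulrA ler_wpM2r ?(ltW lam0) // -natrM ler_nat.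
  by rewrite /N; case: k => // k'; rewrite (maxn_idPl _) // mul2n -addnn addnS ltnS leq_addr.
have merrA := measurable_err_sqr cf.
have err0 v : (0 <= (err f (augment Z v) ^+ 2)%:E)%E by rewrite lee_fin sqr_ge0.
have meta i : measurable_fun setT (fun t : k.+1.-tuple (X * R) => eta (inputs t) i).
  rewrite /eta; case: unlift => [j|]; last exact: measurable_cst.
  apply: measurable_ridge => // l; first exact: measurable_inputs.
  have -> : (fun t : k.+1.-tuple (X * R) => (rk_ker H (inputs t ord0) \o others (inputs t)) l) =
    (fun z : X * X => rk_ker H z.1 z.2) \o (fun t => (inputs t ord0, inputs t (lift ord0 l))) by [].
  by apply: measurableT_comp => //; apply: measurable_fun_pair; exact: measurable_inputs.
have mres : measurable_fun setT (fun t : k.+1.-tuple (X * R) => residual H s f (inputs t)).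
  exact: measurable_residual.
have -> : (\int[P]_v \int[mu]_x ((krls (rk_ker H) (fun i => tnth (Z v) i) lam x - f x) ^+ 2)%:E =
    \int[(P \x rho)]_v (err f (augment Z v) ^+ 2)%:E)%E.
  rewrite (@fubini_tonelli1 _ _ _ _ _ P rho _ merrA err0).
  by apply: eq_integral => v _; rewrite local_errorE.
have mb : measurable_fun setT (fun t : k.+1.-tuple (X * R) => - residual H s f (inputs t)).
  exact: measurable_funN.
have := @noise_elimination _ _ _ mu rhoc rho rhoE _ _ (product_probability P rho)
  _ _ iidQ f sigma
  (fun p => - residual H s f p) eta mf regf var_le mb meta.
under eq_integral do rewrite -krls_error_decomposition //.
move=> /le_trans; apply.
have mres2 := measurable_funX 2 mres.
have mw2 : measurable_fun setT (fun t : k.+1.-tuple (X * R) => \sum_i loo_weight H s (inputs t) i ^+ 2).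
  apply: measurable_sum => i; apply: measurable_funX.
  by have := meta (lift ord0 i); rewrite /eta liftK.
have sw0 v : 0 <= \sum_i loo_weight H s (inputs (augment Z v)) i ^+ 2.
  by apply: sumr_ge0 => i _; exact: sqr_ge0.
have -> : (\int[(P \x rho)]_w ((- residual H s f (inputs (augment Z w))) ^+ 2 +
      sigma ^+ 2 * \sum_i eta (inputs (augment Z w)) i ^+ 2)%:E =
    \int[(P \x rho)]_w ((residual H s f (inputs (augment Z w)) ^+ 2)%:E +
      (sigma ^+ 2)%:E * (\sum_i loo_weight H s (inputs (augment Z w)) i ^+ 2)%:E))%E.
  apply: eq_integral => v _; rewrite sqrrN EFinD EFinM big_ord_recl /eta unlift_none.
  by rewrite expr0n /= add0r; under eq_bigr do rewrite /eta liftK.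
rewrite ge0_integralD //; last 4 first.
- by move=> v _; rewrite lee_fin sqr_ge0.
- exact: (measurable_fun_augment iidZ mres2).
- by move=> v _; rewrite -EFinM lee_fin mulr_ge0 // sqr_ge0.
- by apply: measurable_funeM; exact: (measurable_fun_augment iidZ mw2).
rewrite ge0_integralZl //; last 3 first.
- exact: (measurable_fun_augment iidZ mw2).
- by move=> v _; rewrite lee_fin.
- by rewrite lee_fin sqr_ge0.
apply: leeD; first exact: (expected_residual_sqr rhoE).
rewrite lee_wpmul2l ?lee_fin ?sqr_ge0 //.
exact: (expected_weight_sqr rhoE _ _ _ _ _ _ _ onb0).
Qed.

End local_error.

(** * Extension by zero from a cell *)

Section zero_extension.
Context {R : realType} {d : measure_display} {X : measurableType d} (C : set X).
Implicit Types (g : C -> R) (H : rkhs R C).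

Lemma sigL_zero_ext g : sigL C (zero_ext g) = g.
Proof. exact: (valLK (0 : R) g). Qed.

Lemma zero_ext_notin g x : ~ C x -> zero_ext g x = 0.
Proof.
move=> nCx; rewrite /zero_ext /valL_ /= oinv_set_val insubN //.
by rewrite memNset.
Qed.

Lemma zero_ext_in g x (Cx : x \in C) : zero_ext g x = g (SigSub Cx).
Proof. by rewrite -[in RHS](sigL_zero_ext g) sigLE. Qed.

Lemma zero_ext_lin a g1 g2 :
  zero_ext (fun u => a * g1 u + g2 u) = fun x => a * zero_ext g1 x + zero_ext g2 x.
Proof.
apply/funext => x; have [Cx|nCx] := pselect (C x).
  by rewrite !(zero_ext_in _ (mem_set Cx)).
by rewrite !zero_ext_notin // mulr0 addr0.
Qed.

Lemma zero_ext0 : zero_ext ((fun=> 0) : C -> R) = (fun=> 0) :> (X -> R).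
Proof.
apply/funext => x; have [Cx|nCx] := pselect (C x).
  by rewrite (zero_ext_in _ (mem_set Cx)).
by rewrite zero_ext_notin.
Qed.

Lemma ext_ip H g1 g2 : rk_ip (ext_rkhs H) (zero_ext g1) (zero_ext g2) = rk_ip H g1 g2.
Proof. by rewrite /= !sigL_zero_ext. Qed.

Lemma ext_ker_in H x (Cx : x \in C) :
  rk_ker (ext_rkhs H) x = zero_ext (rk_ker H (SigSub Cx)).
Proof. by apply/funext => y; rewrite /= zero_ext_in. Qed.

Lemma ext_ker_notin H x : ~ C x -> rk_ker (ext_rkhs H) x = (fun=> 0).
Proof. by move=> nCx; apply/funext => y; rewrite /= zero_ext_notin. Qed.

Lemma ext_ker_out H x y : ~ C y -> rk_ker (ext_rkhs H) x y = 0.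
Proof.
move=> nCy; have [Cx|nCx] := pselect (C x); last by rewrite ext_ker_notin.
by rewrite (ext_ker_in _ (mem_set Cx)) zero_ext_notin.
Qed.

Lemma ext_is_rkhs H : is_rkhs H -> is_rkhs (ext_rkhs H).
Proof.
move=> hH; split.
- by exists (fun=> 0); [exact: rk_zero|exact: zero_ext0].
- move=> a _ _ [g1 c1 <-] [g2 c2 <-]; exists (fun u => a * g1 u + g2 u).
    exact: rk_lin.
  exact: zero_ext_lin.
- move=> a _ _ _ [g1 c1 <-] [g2 c2 <-] [g3 c3 <-].
  by rewrite -zero_ext_lin !ext_ip rk_ip_lin.
- by move=> _ _ [g1 c1 <-] [g2 c2 <-]; rewrite !ext_ip rk_ip_sym.
- by move=> _ [g cg <-]; rewrite ext_ip rk_ip_ge0.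
- by move=> _ [g cg <-]; rewrite ext_ip => /(rk_ip_def hH cg) ->; exact: zero_ext0.
- move=> u cu cauchy.
  have /choice[g gP] : forall i, exists g, rk_car H g /\ zero_ext g = u i.
    by move=> i; have [g cg gE] := cu i; exists g.
  have normE f1 f2 : rk_norm (ext_rkhs H) (zero_ext f1 \- zero_ext f2) = rk_norm H (f1 \- f2).
    rewrite /rk_norm; congr Num.sqrt.
    have -> : zero_ext f1 \- zero_ext f2 = zero_ext (f1 \- f2).
      have := zero_ext_lin (-1) f2 f1.
      have -> : (fun u => -1 * f2 u + f1 u) = f1 \- f2.
        by apply/funext => v /=; rewrite mulN1r addrC.
      by move=> ->; apply/funext => v /=; rewrite mulN1r addrC.
    exact: ext_ip.
  have [|f cf fP] := rk_complete hH (fun i => (gP i).1).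
    move=> e e0; have [N NP] := cauchy e e0; exists N => i j Ni Nj.
    by rewrite -normE (gP i).2 (gP j).2; exact: NP.
  exists (zero_ext f); first by exists f.
  have -> // : (fun i => rk_norm (ext_rkhs H) (u i \- zero_ext f)) =
    (fun i => rk_norm H (g i \- f)).
  by apply/funext => i; rewrite -normE (gP i).2.
- move=> x; have [Cx|nCx] := pselect (C x).
    rewrite (ext_ker_in _ (mem_set Cx)); exists (rk_ker H (SigSub (mem_set Cx))) => //.
    exact: rk_ker_car.
  by rewrite ext_ker_notin //; exists (fun=> 0); [exact: rk_zero|exact: zero_ext0].
- move=> _ x [g cg <-]; have [Cx|nCx] := pselect (C x).
    by rewrite (ext_ker_in _ (mem_set Cx)) ext_ip rk_reproducing // (zero_ext_in _ (mem_set Cx)).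
  rewrite ext_ker_notin // -zero_ext0 ext_ip zero_ext_notin // rk_ip_sym //; last exact: rk_zero.
  have := rk_ip_lin hH 1 (rk_zero hH) (rk_zero hH) cg.
  have -> : (fun x : C => 1 * 0 + 0) = (fun=> 0 : R) by apply/funext => v; rewrite mulr0 addr0.
  by rewrite mul1r; lra.
Qed.

Lemma ext_car_out H f x : rk_car (ext_rkhs H) f -> ~ C x -> f x = 0.
Proof. by move=> [g _ <-] nCx; exact: zero_ext_notin. Qed.

Lemma ext_ker_le H kappa x : (forall u, rk_ker H u u <= kappa ^+ 2) ->
  rk_ker (ext_rkhs H) x x <= kappa ^+ 2.
Proof.
move=> le; have [Cx|nCx] := pselect (C x); last by rewrite ext_ker_notin // sqr_ge0.
by rewrite (ext_ker_in _ (mem_set Cx)) (zero_ext_in _ (mem_set Cx)).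
Qed.

End zero_extension.

(** The extended kernel vanishes off [C x C], so it is its own restriction to a measurable
    rectangle. *)
Lemma measurable_ext_ker (R : realType) (d : measure_display) (X : measurableType d)
    (C : set X) (H : rkhs R C) : measurable C ->
  measurable_fun (C `*` C) (fun z : X * X => rk_ker (ext_rkhs H) z.1 z.2) ->
  measurable_fun setT (fun z : X * X => rk_ker (ext_rkhs H) z.1 z.2).
Proof.
move=> mC mK; set K := (fun z : X * X => _).
have -> : K = K \_ (C `*` C).
  apply/funext => -[x y]; rewrite patchE; case: ifPn => //.
  rewrite notin_setE => nC; rewrite -[LHS]/(rk_ker (ext_rkhs H) x y).
  have [Cx|nCx] := pselect (C x); last by rewrite ext_ker_notin.
  by rewrite ext_ker_out // => Cy; apply: nC.
by apply/measurable_restrict => //; [exact: measurableX|rewrite setTI].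
Qed.

(** * Conditioning on a cell *)

Section conditional_measure.
Context {R : realType} {d : measure_display} {X : measurableType d}.
Variables (nu : probability X R) (C : set X).
Hypotheses (mC : measurable C) (C0 : 0 < fine (nu C)).

(** [cond_measure] is a bare set function. Identifying it with a normalized restriction makes the
    measure theory applicable. *)
Lemma cond_measure_probability : exists q : probability X R,
  cond_measure nu C = q :> (set X -> \bar R).
Proof.
exists (mnormalize (mrestr nu mC) nu); apply/funext => A.
have nuC : nu C \is a fin_num by exact: fin_num_measure.
rewrite -[RHS]/(mnormalize (mrestr nu mC) nu A) /mnormalize /=.
have -> : mrestr nu mC setT = nu C by rewrite /mrestr setTI.
case: ifPn => [/orP[/eqP h|/eqP h]|_]; last by rewrite muleC.
- by move: C0; rewrite h ltxx.
- by move: nuC; rewrite h.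
Qed.

Variable q : probability X R.
Hypothesis qE : cond_measure nu C = q :> (set X -> \bar R).

Lemma cond_integral (g : X -> \bar R) : measurable_fun setT g ->
  (forall x, (0 <= g x)%E) ->
  (\int[q]_x g x = ((fine (nu C))^-1)%:E * \int[nu]_(x in C) g x)%E.
Proof.
move=> mg g0.
have k0 : 0 <= (fine (nu C))^-1 by rewrite invr_ge0 ltW.
pose nr := mrestr nu mC.
transitivity (\int[mscale (NngNum k0) nr]_x g x)%E.
  by apply: eq_measure_integral => A mA _; rewrite -[LHS]/(q A) -qE.
rewrite ge0_integral_mscale //=; congr (_ * _)%E.
have mCC : measurable (~` C) by exact: measurableC.
have nrC : nr (~` C) = 0%E by rewrite /nr /mrestr /= setICl measure0.
rewrite (ge0_negligible_integral mCC measurableT mg (fun x _ => g0 x) nrC).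
rewrite setTD setCK; apply: eq_measure_integral => A mA AC.
by rewrite -[LHS]/(nu (A `&` C)) setIidl.
Qed.

Lemma cond_ae (Q : X -> Prop) :
  {ae nu, forall x, C x -> Q x} -> {ae q, forall x, Q x}.
Proof.
move=> [B [mB B0 NB]]; exists (B `|` ~` C); split.
- by apply: measurableU => //; exact: measurableC.
- rewrite -[LHS]/(q (B `|` ~` C)) -qE /cond_measure setIUl setICl setU0.
  rewrite (_ : nu (B `&` C) = 0%E) ?mule0 //.
  by apply: (subset_measure0 _ mB) B0; [exact: measurableI|exact: subIsetl].
move=> x nQ; have [Cx|nCx] := pselect (C x); last by right.
by left; apply: NB => h; apply: nQ; exact: h.
Qed.

(** Conditioning on the input changes its marginal but not the law of the output given the input, so
    every cell keeps the kernel [rhoc]. *)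
Lemma cond_disintegration (rho : probability (X * R)%type R) (rhoc : R.-pker X ~> R) A B :
  disintegration rho nu rhoc -> measurable A -> measurable B ->
  cond_measure rho (C `*` setT) (A `*` B) = (\int[q]_(x in A) rhoc x B)%E.
Proof.
move=> [marg dis] mA mB.
have mk : measurable_fun setT (fun x => rhoc x B) by exact: measurable_kernel.
rewrite integral_mkcond cond_integral; last 2 first.
- by apply/measurable_restrict => //; rewrite setTI; exact: measurable_funTS.
- by move=> x; rewrite patchE; case: ifP.
rewrite /cond_measure -marg //; congr (_ * _)%E.
rewrite (_ : _ `&` _ = (C `&` A) `*` B); last first.
  apply/seteqP; split => -[x y] /=; first by move=> [[? ?] [? _]].
  by move=> [[? ?] ?].
rewrite dis //; last exact: measurableI.
by rewrite -integral_mkcondr.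
Qed.

End conditional_measure.

(** * Excess risk as a squared distance *)

Section excess_risk.
Context {R : realType} {d : measure_display} {X : measurableType d}.
Variables (nu : probability X R) (rhoc : R.-pker X ~> R).
Variable rho : probability (X * R)%type R.

Lemma measurable_regression_fun : measurable_fun setT (regression_fun rhoc).
Proof.
have mI (h : R -> \bar R) : measurable_fun setT h -> (forall y, (0 <= h y)%E) ->
    measurable_fun setT (fun x => \int[rhoc x]_y h y)%E.
  move=> mh h0; apply: measurable_fun_integral_kernel => // U mU.
  exact: measurable_kernel.
have mid : measurable_fun setT (EFin : R -> \bar R) by exact: EFin_measurable.
apply: (@measurableT_comp _ _ _ _ _ _ (@fine R)); first exact: fine_measurable.
rewrite (_ : (fun x => _) =
  (fun x => (\int[rhoc x]_y (EFin^\+ y) - \int[rhoc x]_y (EFin^\- y))%E)); last first.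
  by apply/funext => x; rewrite integralE.
apply: emeasurable_funB; apply: mI => //.
- exact: measurable_funepos.
- exact: measurable_funeneg.
Qed.

(** Pythagoras conditionally on [x]. The variance bound makes the risk of the regression function
    finite, so that the difference of extended reals cancels properly. *)
Lemma excess_risk (g : X -> R) (sigma : R) : disintegration rho nu rhoc ->
  measurable_fun setT g ->
  {ae nu, forall x, (\int[rhoc x]_y ((y - regression_fun rhoc x) ^+ 2)%:E <= (sigma ^+ 2)%:E)%E} ->
  (risk rho g - risk rho (regression_fun rhoc) =
    \int[nu]_x ((g x - regression_fun rhoc x) ^+ 2)%:E)%E.
Proof.
move=> [_ rhoE] mg var_le; set m := regression_fun rhoc.
have mm : measurable_fun setT m := measurable_regression_fun.
pose v x := (\int[rhoc x]_y ((y - m x) ^+ 2)%:E)%E.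
have m2 (h : X -> R) : measurable_fun setT h ->
    measurable_fun setT (fun z : X * R => ((h z.1 - z.2) ^+ 2)%:E).
  move=> mh; apply/measurable_EFinP; apply: measurable_funX; apply: measurable_funB => //.
  exact: measurableT_comp mh measurable_fst.
have sqC (x y : R) : (x - y) ^+ 2 = (y - x) ^+ 2 by rewrite -sqrrN opprB.
have riskE (h : X -> R) : measurable_fun setT h ->
    risk rho h = (\int[nu]_x \int[rhoc x]_y ((h x - y) ^+ 2)%:E)%E.
  move=> mh; rewrite /risk (integral_disintegration rhoE (m2 h mh)) // => z.
  by rewrite lee_fin sqr_ge0.
have mker (h : X -> R) : measurable_fun setT h ->
    measurable_fun setT (fun x => \int[rhoc x]_y ((h x - y) ^+ 2)%:E)%E.
  move=> mh; apply: (measurable_fun_integral_finite_kernel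
    (fun z : X * R => ((h z.1 - z.2) ^+ 2)%:E) rhoc) => [z|]; last exact: m2.
  by rewrite lee_fin sqr_ge0.
have vE x : v x = (\int[rhoc x]_y ((m x - y) ^+ 2)%:E)%E.
  by apply: eq_integral => y _; rewrite sqC.
have mv : measurable_fun setT v.
  have -> : v = (fun x => \int[rhoc x]_y ((m x - y) ^+ 2)%:E)%E by apply/funext.
  exact: mker.
have v0 x : (0 <= v x)%E by apply: integral_ge0 => y _; rewrite lee_fin sqr_ge0.
have rm : risk rho m = (\int[nu]_x v x)%E.
  by rewrite riskE //; apply: eq_integral => x _; rewrite vE.
have rmfin : risk rho m \is a fin_num.
  rewrite rm ge0_fin_numE; last by apply: integral_ge0.
  apply: (@le_lt_trans _ _ (\int[nu]_x (sigma ^+ 2)%:E)%E).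
    apply: ae_ge0_le_integral => //.
      by move=> x _; rewrite lee_fin sqr_ge0.
    by apply: filterS var_le => x vx _; exact: vx.
  by rewrite (integral_cst nu measurableT) [X in (_ * X)%E]probability_setT mule1 ltry.
have mgm : measurable_fun setT (fun x => ((g x - m x) ^+ 2)%:E).
  by apply/measurable_EFinP; apply: measurable_funX; exact: measurable_funB.
rewrite (_ : risk rho g = \int[nu]_x ((g x - m x) ^+ 2)%:E + risk rho m)%E ?addeK //.
rewrite rm -ge0_integralD //; last by move=> x _; rewrite lee_fin sqr_ge0.
rewrite riskE //; apply: ge0_ae_eq_integral => //.
- exact: mker.
- exact: emeasurable_funD.
- by move=> x _; apply: integral_ge0 => y _; rewrite lee_fin sqr_ge0.
- by move=> x _; rewrite adde_ge0 // lee_fin sqr_ge0.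
apply: filterS var_le => x vx _.
have vlty : (\int[rhoc x]_y ((y - m x) ^+ 2)%:E < +oo)%E by exact: le_lt_trans vx (ltry _).
have q1 : rhoc x setT = 1%E by exact: prob_kernel.
have := integral_sqr_affine q1 (g x - m x) (-1) vlty.
rewrite sqrrN expr1n mul1e => <-.
apply: eq_integral => y _.
by congr (_ ^+ 2)%:E; rewrite /m /regression_fun; ring.
Qed.

End excess_risk.

(** * Summation over the cells *)

Section partitioned_error.
Context {R : realType} {d : measure_display} {X : measurableType d}.
Variables (rho : probability (X * R)%type R) (nu : probability X R).
Variable rhoc : R.-pker X ~> R.
Variables (m : nat) (C : 'I_m -> set X) (H : forall j, rkhs R (C j)).
Hypothesis rho_dis : disintegration rho nu rhoc.
Hypothesis partC : is_partition nu C.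

Let mC j : measurable (C j). Proof. by case: partC => /(_ j)[]. Qed.
Let p0 j : 0 < cell_prob nu C j. Proof. by case: partC. Qed.

Lemma cell_unique i j x : C i x -> C j x -> i = j.
Proof.
case: partC => _ tC _ _ Cix Cjx; apply: contrapT => /eqP ij.
move/trivIsetP : tC => /(_ i j Logic.I Logic.I ij) /seteqP[+ _] => /(_ x); exact.
Qed.

Lemma cell_cover x : exists j, C j x.
Proof.
case: partC => _ _ cov _; have : (\bigcup_j C j) x by rewrite cov.
by move=> [j _ Cjx]; exists j.
Qed.

Lemma integral_partition (g : X -> \bar R) : measurable_fun setT g ->
  (forall x, (0 <= g x)%E) ->
  (\int[nu]_x g x = \sum_(j < m) \int[nu]_(x in C j) g x)%E.
Proof.
move=> mg g0; have cover : \big[setU/set0]_(j < m) C j = setT.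
  rewrite -bigcup_seq; apply/seteqP; split => // x _.
  by have [j Cjx] := cell_cover x; exists j => //=; exact: mem_index_enum.
rewrite -{1}cover ge0_integral_bigsetU //.
- exact: index_enum_uniq.
- by case: partC => _ tC _ _; apply: sub_trivIset tC.
- by rewrite cover.
Qed.

Lemma cell_iid k d' (Omega : measurableType d') (P : probability Omega R)
    (Z : 'I_m * 'I_k -> {RV P >-> (X * R)%type}) j (r : probability (X * R)%type R) :
  local_samples rho C Z ->
  cond_measure rho (C j `*` setT) = r :> (set (X * R) -> \bar R) ->
  iid r P (fun w => [tuple (Z (j, i) : Omega -> X * R) w | i < k]).
Proof.
move=> [indep law] rE; split.
  apply/measurable_fun_tnthP => i; rewrite (_ : _ \o _ = Z (j, i)) //.
  by apply/funext => w /=; rewrite tnth_mktuple.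
move=> A mA.
(* Joint independence is used for the observations of cell [j] only. *)
have := indep (finset (fun q : 'I_m * 'I_k => q.1 == j)) (fun q => A q.2) (fun q => mA q.2).
rewrite (_ : \bigcap_(i in _) _ = [set w | forall i : 'I_k,
    A i (tnth [tuple (Z (j, i) : Omega -> X * R) w | i < k] i)]); last first.
  apply/seteqP; split => w /= h.
    by move=> i; rewrite tnth_mktuple; apply: (h (j, i)); rewrite /= inE.
  by move=> [j' i]; rewrite /= inE /= => /eqP ->; have := h i; rewrite tnth_mktuple.
move=> E; etransitivity; first exact: E.
under eq_bigl do rewrite inE.
rewrite (reindex_onto (fun i => (j, i)) snd) /= => [|[j' i] /= /eqP -> //].
apply: eq_big => [i|i _]; first by rewrite !eqxx.
rewrite law; [exact: (congr1 (@^~ (A i)) rE)|exact: mA].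
Qed.

Variables (kappa lam sigma : R) (k : nat).
Hypothesis spaces : local_spaces kappa H.
Hypothesis lam0 : 0 < lam.
Hypothesis var_le : {ae nu, forall x,
  (\int[rhoc x]_y ((y - regression_fun rhoc x) ^+ 2)%:E <= (sigma ^+ 2)%:E)%E}.
Variables (fs : 'I_m -> X -> R) (r B : 'I_m -> R).
Hypothesis fs_car : forall j, rk_car (ext_rkhs (H j)) (fs j).
Hypothesis regE : {ae nu, forall x, regression_fun rhoc x = \sum_(j < m) fs j x}.
Hypothesis r0 : forall j, 0 < r j.
Hypothesis r2 : forall j, r j <= 2^-1.
Hypothesis source : forall j,
  source_condition (ext_rkhs (H j)) (local_cov nu H j) (r j) (B j) (fs j).
Context {d'} {Omega : measurableType d'} (P : probability Omega R).
Variable Z : 'I_m * 'I_k -> {RV P >-> (X * R)%type}.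
Hypothesis samples : local_samples rho C Z.

Let ext_rk j : is_rkhs (ext_rkhs (H j)).
Proof. by apply: ext_is_rkhs; case: (spaces j). Qed.

Let ext_mker j : measurable_fun setT (fun z : X * X => rk_ker (ext_rkhs (H j)) z.1 z.2).
Proof. by apply: measurable_ext_ker => //; case: (spaces j). Qed.

Let ext_le j x : rk_ker (ext_rkhs (H j)) x x <= kappa ^+ 2.
Proof. by apply: ext_ker_le; case: (spaces j). Qed.

Lemma sum_components j x : C j x -> \sum_(l < m) fs l x = fs j x.
Proof.
move=> Cjx; rewrite (bigD1 j) //= big1 ?addr0 // => l lj.
apply: (ext_car_out (fs_car l)) => Clx.
by move: lj; rewrite (cell_unique Clx Cjx) eqxx.
Qed.

Lemma partitioned_krls_cell (z : 'I_m * 'I_k -> X * R) j x : C j x ->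
  partitioned_krls H z lam x = krls (rk_ker (ext_rkhs (H j))) (fun i => z (j, i)) lam x.
Proof.
move=> Cjx; rewrite /partitioned_krls (bigD1 j) // big1 => [|l lj]; first exact: addr0.
rewrite /krls big1 // => i _; rewrite (@ext_ker_out _ _ _ _ (H l)) ?mulr0 // => Clx.
by move: lj; rewrite (cell_unique Clx Cjx) eqxx.
Qed.

Let c := 1 + kappa ^+ 2 / ((maxn k 1)%:R * lam).

Lemma partitioned_error_bound :
  (\int[P]_w (risk rho (partitioned_krls H (fun i => Z i w) lam)
              - risk rho (regression_fun rhoc)) <=
   \sum_(j < m) (cell_prob nu C j)%:E *
     ((2 * c ^+ 4 * lam ^+ 2 * (lam `^ (2 * r j - 1) * B j ^+ 2))%:E +
      (sigma ^+ 2)%:E * ((2 * c / k.+1%:R)%:E *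
        effective_dim (ext_rkhs (H j)) (local_cov nu H j) lam)))%E.
Proof.
have msec j := measurable_ker_section (ext_mker j).
have /choice[q qE] : forall j, exists q : probability X R,
    cond_measure nu (C j) = q :> (set X -> \bar R).
  by move=> j; exact: (cond_measure_probability (mC j) (p0 j)).
have rhoC j : rho (C j `*` setT) = nu (C j) by rewrite rho_dis.1.
have /choice[rr rrE] : forall j, exists r : probability (X * R)%type R,
    cond_measure rho (C j `*` setT) = r :> (set (X * R) -> \bar R).
  move=> j; apply: cond_measure_probability; first exact: measurableX.
  by rewrite rhoC; exact: p0.
have rrdis j A D : measurable A -> measurable D ->
    rr j (A `*` D) = (\int[q j]_(x in A) rhoc x D)%E.
  move=> mA mD; rewrite -[LHS]/((rr j : set (X * R) -> \bar R) (A `*` D)) -rrE.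
  exact: (cond_disintegration (mC j) (p0 j) (qE j) rho_dis).
pose Zt j (w : Omega) := [tuple (Z (j, i) : Omega -> X * R) w | i < k].
have Ziid j : iid (rr j) P (Zt j) by exact: cell_iid.
have covE j : local_cov nu H j = covariance_op (ext_rkhs (H j)) (q j).
  by rewrite /local_cov qE.
pose G j w := (\int[q j]_x ((krls (rk_ker (ext_rkhs (H j)))
  (fun i => tnth (Zt j w) i) lam x - fs j x) ^+ 2)%:E)%E.
have mG j : measurable_fun setT (G j).
  exact: (measurable_local_error (rrdis j) (ext_rk j) (ext_mker j) lam0 (Ziid j) (fs_car j)).
have G0 j w : (0 <= G j w)%E by apply: integral_ge0 => x _; rewrite lee_fin sqr_ge0.
have mfs j : measurable_fun setT (fs j) by exact: (rk_measurable (ext_rk j) (msec j)).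
have mreg := measurable_regression_fun rhoc.
have mkrls j (z : 'I_k -> X * R) : measurable_fun setT (krls (rk_ker (ext_rkhs (H j))) z lam).
  apply: measurable_sum => i; apply: measurable_funM; first exact: measurable_cst.
  exact: msec.
have mpk z : measurable_fun setT (partitioned_krls (k := k) H z lam).
  by apply: measurable_sum => j; exact: mkrls.
have riskE w : (risk rho (partitioned_krls H (fun i => Z i w) lam)
      - risk rho (regression_fun rhoc) =
    \sum_(j < m) (cell_prob nu C j)%:E * G j w)%E.
  rewrite (excess_risk rho_dis (mpk _) var_le).
  have msq (g : X -> R) : measurable_fun setT g ->
      measurable_fun setT (fun x => ((partitioned_krls H (fun i => Z i w) lam x - g x) ^+ 2)%:E).
    move=> mg; apply/measurable_EFinP; apply: measurable_funX; exact: measurable_funB.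
  have mF : measurable_fun setT (fun x => \sum_(j < m) fs j x) by exact: measurable_sum.
  transitivity (\int[nu]_x ((partitioned_krls H (fun i => Z i w) lam x - \sum_(j < m) fs j x) ^+ 2)%:E)%E.
    apply: ge0_ae_eq_integral => //; try exact: msq.
    - by move=> x _; rewrite lee_fin sqr_ge0.
    - by move=> x _; rewrite lee_fin sqr_ge0.
    by apply: filterS regE => x -> _.
  rewrite integral_partition; last 2 first.
  - exact: msq.
  - by move=> x; rewrite lee_fin sqr_ge0.
  apply: eq_bigr => j _.
  have mcell : measurable_fun setT (fun x => ((krls (rk_ker (ext_rkhs (H j)))
      (fun i => tnth (Zt j w) i) lam x - fs j x) ^+ 2)%:E).
    by apply/measurable_EFinP; apply: measurable_funX; exact: measurable_funB.
  have cell0 x : (0 <= ((krls (rk_ker (ext_rkhs (H j)))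
      (fun i => tnth (Zt j w) i) lam x - fs j x) ^+ 2)%:E)%E by rewrite lee_fin sqr_ge0.
  rewrite /G (cond_integral (mC j) (p0 j) (qE j) mcell cell0) muleA -EFinM.
  rewrite -/(cell_prob nu C j) divff ?gt_eqF // mul1e.
  apply: eq_integral => x /set_mem Cjx; congr (_%:E); congr (_ ^+ 2).
  rewrite (partitioned_krls_cell _ Cjx) (sum_components Cjx); congr (_ - _).
  by congr (krls _ _ _ _); apply/funext => i; rewrite tnth_mktuple.
under eq_integral do rewrite riskE.
rewrite ge0_integral_sum //; last 2 first.
- by move=> j; exact: measurable_funeM.
- by move=> j w _; rewrite mule_ge0 // lee_fin ltW.
apply: lee_sum => j _; rewrite ge0_integralZl //; last by rewrite lee_fin ltW.
rewrite lee_wpmul2l ?lee_fin ?(ltW (p0 j)) //.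
have [w cw wP] := tikhonov_exists (q j) (ext_rk j) (msec j) (ext_le j) lam0 (fs_car j).
have src := source j; rewrite covE in src.
have fw := source_condition_le (ext_rk j) (msec j) (ext_le j) lam0 (r0 j) (r2 j) src cw wP.
(* The eigenbasis in the source condition also witnesses that an orthonormal basis exists, which
   makes the effective dimension a true trace. *)
have [h [_ _ [_ [D [e [_ [onb _ _]]]]]]] := src.
have regj : {ae q j, forall x, regression_fun rhoc x = fs j x}.
  apply: (cond_ae (mC j) (qE j)); apply: filterS regE => x -> Cjx.
  exact: sum_components.
have varj : {ae q j, forall x,
    (\int[rhoc x]_y ((y - regression_fun rhoc x) ^+ 2)%:E <= (sigma ^+ 2)%:E)%E}.
  by apply: (cond_ae (mC j) (qE j)); apply: filterS var_le => x vx _.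
apply: le_trans (local_error_bound (rrdis j) (ext_rk j) (ext_mker j) (ext_le j) lam0
  (Ziid j) (fs_car j) cw wP onb regj varj) _.
rewrite covE leeD2r // lee_fin ler_wpM2l // mulr_ge0 ?sqr_ge0 // mulr_ge0 // exprn_ge0 //.
by rewrite addr_ge0 // divr_ge0 ?sqr_ge0 // mulr_ge0 // ltW.
Qed.

End partitioned_error.

(** * The capacity assumption summed over the cells *)

Section effective_dimension_sum.
Context {R : realType}.

Lemma op_trace_ge0 (T : Type) (H : rkhs R T) B : (0 <= op_trace H B)%E.
Proof.
rewrite /op_trace; set A := (X in xget _ X).
have [/xgetPex h|h] := pselect (exists t, A t).
  have [D [e [_ ->]]] := h 0%E; apply: ereal_sup_ubound; exists set0.
    exact: fsets_set0.
  by rewrite fsbig_set0.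
by rewrite xgetPN // => t At; apply: h; exists t.
Qed.

Lemma effective_dim_ge0 (T : Type) (H : rkhs R T) A lam : (0 <= effective_dim H A lam)%E.
Proof. exact: op_trace_ge0. Qed.

Context {d : measure_display} {X : measurableType d}.

Lemma partition_nonempty (nu : probability X R) m (C : 'I_m -> set X) :
  is_partition nu C -> (0 < m)%N.
Proof.
case=> _ _ cov _; case: m C cov => // C cov.
have := probability_setT nu; rewrite -cov bigcup0 => [|[]//].
by rewrite measure0 => /eqP; rewrite eq_sym onee_eq0.
Qed.

Lemma sum_cell_prob (nu : probability X R) m (C : 'I_m -> set X) :
  is_partition nu C -> \sum_j cell_prob nu C j = 1.
Proof.
move=> partC; have := integral_partition partC (measurable_cst (1%E : \bar R)) (fun=> lee01).
rewrite (integral_cst nu measurableT 1%E) [X in (_ * X)%E]probability_setT mule1.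
have mC j : measurable (C j) by case: partC => /(_ j)[].
rewrite (eq_bigr (fun j => (cell_prob nu C j)%:E)) => [|j _].
  by rewrite sumEFin => -[<-].
rewrite (integral_cst nu (mC j) 1%E) mul1e /cell_prob fineK //.
exact: fin_num_measure.
Qed.

(** The first capacity bound is used at [lam] and the second at [m lam]; then
    [(m lam)^(- gamma) <= lam^(- gamma)] as [m >= 1]. The gain [1 / m] compensates the local sample
    size [n / m] in the variance. Absolute values serve because [c1] and [c2] carry no sign. *)
Lemma capacity_sum_le (nu : probability X R) m (C : 'I_m -> set X)
    (H : forall j, rkhs R (C j)) gamma c1 c2 lam : (0 < m)%N -> 0 <= gamma -> 0 < lam ->
  capacity nu H gamma c1 c2 ->
  (\sum_(j < m) (cell_prob nu C j)%:E *
     effective_dim (ext_rkhs (H j)) (local_cov nu H j) lam <=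
   (m%:R^-1 * (`|c1| * `|c2| * lam `^ (- gamma)))%:E)%E.
Proof.
move=> m0 g0 lam0 cap; have mR : 0 < m%:R :> R by rewrite ltr0n.
have m1 : 1 <= m%:R :> R by rewrite ler1n.
have [cap1 _] := cap _ lam0; have [_ cap2] := cap _ (mulr_gt0 mR lam0).
set S := (\sum_(j < m) _)%E in cap1 *.
have h : (m%:R%:E * S <= (`|c1| * `|c2| * lam `^ (- gamma))%:E)%E.
  apply: (le_trans cap1).
  apply: (@le_trans _ _ (`|c1|%:E * effective_dim (direct_sum nu H) (global_cov nu H) (m%:R * lam))%E).
    by rewrite lee_wpmul2r ?effective_dim_ge0 // lee_fin ler_norm.
  rewrite -mulrA EFinM lee_wpmul2l ?lee_fin //; apply: (le_trans cap2); rewrite lee_fin.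
  apply: (@le_trans _ _ (`|c2| * (m%:R * lam) `^ (- gamma))).
    by rewrite ler_wpM2r ?powR_ge0 // ler_norm.
  rewrite ler_wpM2l // !powRN lef_pV2 ?posrE ?powR_gt0 // ?mulr_gt0 //.
  by apply: ge0_ler_powR; rewrite ?nnegrE ?mulr_ge0 ?(ltW lam0) // ler_peMl // ltW.
rewrite EFinM; apply: le_trans (lee_wpmul2l _ h); last by rewrite lee_fin invr_ge0 ltW.
by rewrite muleA -EFinM mulVf ?gt_eqF // mul1e.
Qed.

End effective_dimension_sum.

Lemma sample_size_le (n m : nat) : (0 < m)%N -> (n <= 2 * maxn (n %/ m) 1 * m)%N.
Proof.
move=> m0; have := ltn_ceil n m0 => h; apply: (leq_trans (ltnW h)).
rewrite leq_mul2r; apply/orP; right.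
by case: (n %/ m)%N => [//|q]; rewrite (maxn_idPl _) // mul2n -addnn addnS ltnS leq_addr.
Qed.

(** * Exponents and sample sizes *)

Section rates.
Context {R : realType}.
Variables (rh gamma alpha : R).
Hypotheses (rh0 : 0 < rh) (gamma0 : 0 < gamma).
Hypothesis alpha_le : alpha <= 2 * rh / (2 * rh + 1 + gamma).

Let D := 2 * rh + 1 + gamma.
Let D0 : 0 < D. Proof. by move: rh0 gamma0; rewrite /D; lra. Qed.

Definition rate (n : nat) : R := n%:R^-1 `^ D^-1.

Lemma rate_gt0 n : (0 < n)%N -> 0 < rate n.
Proof. by move=> n0; rewrite powR_gt0 // invr_gt0 ltr0n. Qed.

Lemma rate_powR n p : rate n `^ p = n%:R^-1 `^ (p / D).
Proof. by rewrite /rate -powRrM mulrC. Qed.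

Lemma rate_noninc n n' : (0 < n)%N -> (n <= n')%N -> rate n' <= rate n.
Proof.
move=> n0 nn'; have n'0 := leq_trans n0 nn'.
apply: ge0_ler_powR; rewrite ?nnegrE ?invr_ge0 ?ler0n // ?(ltW D0) //.
by rewrite lef_pV2 ?posrE ?ltr0n // ler_nat.
Qed.

(** The exponents agree because [1 - gamma / D = (2 r_h + 1) / D]. *)
Lemma rate_variance n : (0 < n)%N ->
  n%:R^-1 * rate n `^ (- gamma) = n%:R^-1 `^ ((2 * rh + 1) / D).
Proof.
move=> n0; have ni : 0 < n%:R^-1 :> R by rewrite invr_gt0 ltr0n.
rewrite rate_powR -[X in X * _](powRr1 (ltW ni)) -powRD; last by rewrite (gt_eqF ni) implybT.
by congr (_ `^ _); rewrite /D; field; rewrite gt_eqF.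
Qed.

(** Up to constants, [k lam] is at least [n^(1 - alpha) * rate n]. As
    [alpha <= 2 rh / D <= 1 - 1 / D], this does not tend to 0, and [1 + kappa^2 / s] stays bounded
    in [n]. *)
Lemma effective_regularization n (m : nat) lam c C : (0 < n)%N -> (0 < m)%N -> 0 < c ->
  c * rate n <= lam -> m%:R <= C * n%:R `^ alpha ->
  c / (2 * `|C|) <= (maxn (n %/ m) 1)%:R * lam.
Proof.
move=> n0 m0 c0 lam_ge m_le.
have n1 : 1 <= n%:R :> R by rewrite ler1n.
have nR : 0 < n%:R :> R by rewrite ltr0n.
have na0 : 0 < n%:R `^ alpha :> R by rewrite powR_gt0.
have mC : m%:R <= `|C| * n%:R `^ alpha.
  by apply: (le_trans m_le); rewrite ler_pM2r // ler_norm.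
have C0 : 0 < `|C|.
  rewrite -(pmulr_lgt0 _ na0); apply: lt_le_trans mC; by rewrite ltr0n.
set K := maxn _ _.
have nK : n%:R <= 2 * K%:R * m%:R :> R by rewrite -!natrM ler_nat sample_size_le.
have K0 : 0 < K%:R :> R by rewrite ltr0n leq_max orbT.
have main : n%:R `^ alpha <= n%:R * rate n :> R.
  have -> : n%:R * rate n = n%:R `^ (1 - D^-1) :> R.
    rewrite /rate -powR_inv1 ?ler0n // -powRrM mulN1r.
    rewrite -[X in X * _](powRr1 (ltW nR)) -powRD //; by rewrite (gt_eqF nR) implybT.
  apply: ler_powR => //; apply: (le_trans alpha_le).
  rewrite -/D ler_pdivrMr // mulrBl mulVf ?gt_eqF // mul1r; move: gamma0; rewrite /D; lra.
have h1 : n%:R `^ alpha * 1 <= n%:R `^ alpha * (2 * K%:R * `|C| * rate n).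
  rewrite mulr1; apply: (le_trans main).
  have -> : n%:R `^ alpha * (2 * K%:R * `|C| * rate n) =
    2 * K%:R * (`|C| * n%:R `^ alpha) * rate n by ring.
  rewrite ler_wpM2r ?(ltW (rate_gt0 n0)) //; apply: (le_trans nK).
  by rewrite ler_wpM2l // mulr_ge0 // ltW.
rewrite ler_pM2l // in h1.
rewrite ler_pdivrMr ?mulr_gt0 //.
apply: (@le_trans _ _ (c * (2 * K%:R * `|C| * rate n))).
  by rewrite ler_peMr // ltW.
have -> : c * (2 * K%:R * `|C| * rate n) = K%:R * (c * rate n) * (2 * `|C|) by ring.
by rewrite ler_wpM2r ?mulr_ge0 // ler_wpM2l // ltW.
Qed.

End rates.

Theorem theorem2 (R : realType)
    (r_l r_h gamma alpha kappa sigma M R_l R_h : R)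
    (c_lam C_lam C_m C_E C_1 C_2 : R) (n0 : nat) :
  0 < r_l -> r_l < r_h -> r_h <= 2^-1 ->
  0 < gamma -> gamma <= 1 ->
  alpha <= 2 * r_h / (2 * r_h + 1 + gamma) ->
  0 <= kappa -> 0 < sigma -> 0 < M -> 0 < R_l -> 0 < R_h -> 0 < c_lam ->
  exists C : R, forall (d : measure_display) (X : measurableType d)
    (rho : probability (X * R)%type R) (nu : probability X R)
    (rhoc : R.-pker X ~> R)
    (m : nat -> nat) (cell : forall n, 'I_(m n) -> set X)
    (H : forall n (j : 'I_(m n)), rkhs R (cell n j))
    (E : forall n, {set 'I_(m n)}) (lam : nat -> R)
    (d' : measure_display) (Omega : nat -> measurableType d')
    (P : forall n, probability (Omega n) R)
    (Z : forall n, 'I_(m n) * 'I_(n %/ m n) -> {RV (P n) >-> (X * R)%type}),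
  @standard_borel R d X ->
  disintegration rho nu rhoc ->
  bernstein_noise nu rhoc sigma M ->
  (forall n, (0 < n)%N -> is_partition nu (cell n)) ->
  (forall n, (0 < n)%N -> local_spaces kappa (H n)) ->
  (forall n, (0 < n)%N -> two_level_regularity nu (H n) (E n)
     (regression_fun rhoc) r_l r_h R_l R_h) ->
  (forall n, (0 < n)%N -> (n0 <= n)%N ->
     \sum_(j in E n) cell_prob nu (cell n) j <=
       C_E * (R_h / R_l) ^+ 2 * lam n `^ (2 * (r_h - r_l))) ->
  (forall n, (0 < n)%N -> capacity nu (H n) gamma C_1 C_2) ->
  (forall n, (0 < n)%N -> local_samples rho (cell n) (Z n)) ->
  (forall n, (0 < n)%N ->
     c_lam * n%:R^-1 `^ (2 * r_h + 1 + gamma)^-1 <= lam n /\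
     lam n <= C_lam * n%:R^-1 `^ (2 * r_h + 1 + gamma)^-1) ->
  (forall n, (0 < n)%N -> (m n)%:R <= C_m * n%:R `^ alpha) ->
  forall n, (0 < n)%N ->
  (\int[P n]_w (risk rho (partitioned_krls (H n) (fun i => Z n i w) (lam n))
                - risk rho (regression_fun rhoc)) <=
   (C * (R_h ^+ 2 *
      n%:R^-1 `^ ((2 * r_h + 1) / (2 * r_h + 1 + gamma))))%:E)%E.
Proof.
move=> rl0 rlh rh2 gamma0 gamma1 alpha_le kappa0 sigma0 M0 Rl0 Rh0 clam0.
have rh0 : 0 < r_h by exact: lt_trans rlh.
pose D := 2 * r_h + 1 + gamma.
pose cbar := 1 + kappa ^+ 2 / (c_lam / (2 * `|C_m|)).
pose rt := rate r_h gamma.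
(* The maximum excludes index 0, where [rate] would be 0. *)
pose n1 := maxn n0 1.
pose CE := `|C_E| + ((R_h / R_l) ^+ 2 * (c_lam * rt n1) `^ (2 * (r_h - r_l)))^-1.
(* The bias grows with [lam] and uses its upper constant; the variance constant [Kv] uses the lower
   one. In [CE + 1] the first term is for the cells of [E] and the 1 for all others. *)
pose Kb := 2 * cbar ^+ 4 * ((CE + 1) * R_h ^+ 2 * `|C_lam| `^ (2 * r_h + 1)).
pose Kv := sigma ^+ 2 * (2 * cbar) * (`|C_1| * `|C_2| * c_lam `^ (- gamma)).
exists ((Kb + Kv) / R_h ^+ 2) => d X rho nu rhoc m cell H E lam d' Omega P Z.
move=> _ dis bern part spaces reg expE cap samples lamE mE n n_gt0.
have partn := part _ n_gt0; have [lam_ge lam_le] := lamE _ n_gt0.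
have m0 := partition_nonempty partn.
have rt0 : 0 < rt n by exact: rate_gt0.
have lam0 : 0 < lam n by apply: lt_le_trans lam_ge; rewrite mulr_gt0.
(* The Bernstein condition at [k = 2], where [2^-1 * 2! = 1] and the power of [M] is trivial. *)
have var_le : {ae nu, forall x,
    (\int[rhoc x]_y ((y - regression_fun rhoc x) ^+ 2)%:E <= (sigma ^+ 2)%:E)%E}.
  have := bern 2%N (leqnn 2); apply: filterS => x.
  rewrite expr0 mulr1 (_ : 2^-1 * _ = 1) ?mul1r; last by rewrite mulVf.
  by under eq_integral do rewrite real_normK ?num_real //.
have [fs [cfs regE srcl srch]] := reg _ n_gt0.
pose r j := if j \in E n then r_l else r_h.
pose B j := if j \in E n then R_l else R_h.
have r0 j : 0 < r j by rewrite /r; case: ifP.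
have r2 j : r j <= 2^-1 by rewrite /r; case: ifP => // _; rewrite (le_trans (ltW rlh)).
have src j : source_condition (ext_rkhs (H n j)) (local_cov nu (H n) j) (r j) (B j) (fs j).
  by rewrite /r /B; case: ifPn => [/srcl|/srch].
have := partitioned_error_bound dis partn (spaces _ n_gt0) lam0 var_le cfs regE r0 r2 src
  (samples _ n_gt0).
move=> /le_trans; apply.
set k := (n %/ m n)%N; set c := 1 + _ / _.
have c1 : 1 <= c.
  by rewrite lerDl divr_ge0 ?sqr_ge0 // mulr_ge0 // ltW.
have cbar_ge : c <= cbar.
  have Cm0 : 0 < `|C_m|.
    rewrite normr_gt0; apply/eqP => Cm0; have := mE _ n_gt0.
    by rewrite Cm0 mul0r leNgt ltr0n m0.
  have dl : 0 < c_lam / (2 * `|C_m|) by rewrite divr_gt0 // mulr_gt0.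
  have h := effective_regularization rh0 gamma0 alpha_le n_gt0 m0 clam0 lam_ge (mE _ n_gt0).
  rewrite lerD2l ler_wpM2l ?sqr_ge0 // lef_pV2 ?posrE //.
  exact: lt_le_trans dl h.
have cbar1 : 1 <= cbar := le_trans c1 cbar_ge.
have c4 : c ^+ 4 <= cbar ^+ 4.
  by rewrite lerXn2r // nnegrE; [exact: le_trans ler01 c1|exact: le_trans ler01 cbar1].
pose p j := cell_prob nu (cell n) j.
have p0 j : 0 < p j by case: partn.
have sum_p : \sum_j p j = 1 by exact: sum_cell_prob.
(* For [n < n0] there is no hypothesis on [E]. The mass is then at most 1 while [lam n] is at least
   [c_lam * rt n1], and the second term of [CE] is the reciprocal needed. *)
have sum_E : \sum_(j in E n) p j <= CE * (R_h / R_l) ^+ 2 * lam n `^ (2 * (r_h - r_l)).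
  have q0 : 0 < (R_h / R_l) ^+ 2 by rewrite exprn_gt0 // divr_gt0.
  have [nn0|nn0] := leqP n0 n.
    apply: (le_trans (expE _ n_gt0 nn0)); rewrite ler_wpM2r ?powR_ge0 //.
    rewrite ler_wpM2r ?(ltW q0) // /CE (le_trans (ler_norm _)) // lerDl invr_ge0.
    by rewrite mulr_ge0 ?powR_ge0 ?(ltW q0).
  have t0 : 0 < (c_lam * rt n1) `^ (2 * (r_h - r_l)).
    by rewrite powR_gt0 // mulr_gt0 // rate_gt0 // leq_max orbT.
  apply: (@le_trans _ _ 1).
    rewrite -sum_p [leRHS](bigID (mem (E n))) /= lerDl sumr_ge0 // => j _.
    exact: ltW.
  apply: (@le_trans _ _ (((R_h / R_l) ^+ 2 * (c_lam * rt n1) `^ (2 * (r_h - r_l)))^-1 *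
      (R_h / R_l) ^+ 2 * (c_lam * rt n1) `^ (2 * (r_h - r_l)))).
    by rewrite -mulrA mulVf // gt_eqF // mulr_gt0.
  have tle : (c_lam * rt n1) `^ (2 * (r_h - r_l)) <= lam n `^ (2 * (r_h - r_l)).
    apply: ge0_ler_powR; rewrite ?nnegrE ?(ltW lam0) //.
    - by rewrite mulr_ge0 // subr_ge0 ltW.
    - by rewrite mulr_ge0 // ltW // rate_gt0 // leq_max orbT.
    apply: le_trans lam_ge; rewrite ler_pM2l //; apply: rate_noninc => //.
    by rewrite leq_max (ltnW nn0).
  apply: ler_pM => //; rewrite ?(ltW t0) //.
    by rewrite mulr_ge0 ?(ltW q0) // invr_ge0 mulr_ge0 // ltW.
  by rewrite ler_wpM2r ?(ltW q0) // /CE lerDr.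
pose L := lam n `^ (2 * r_h + 1).
have L0 : 0 <= L by exact: powR_ge0.
have lamD t : lam n ^+ 2 * lam n `^ (2 * t - 1) = lam n `^ (2 * t + 1).
  rewrite -powR_mulrn ?(ltW lam0) // -powRD; last by rewrite (gt_eqF lam0) implybT.
  by congr (_ `^ _); ring.
pose bias := \sum_j p j * (2 * c ^+ 4 * lam n ^+ 2 * (lam n `^ (2 * r j - 1) * B j ^+ 2)).
have bias_le : bias <= 2 * c ^+ 4 * ((CE + 1) * R_h ^+ 2 * L).
  have -> : bias = 2 * c ^+ 4 * (\sum_(j in E n) p j * (lam n `^ (2 * r_l + 1) * R_l ^+ 2) +
      \sum_(j | j \notin E n) p j * (L * R_h ^+ 2)).
    rewrite /bias (bigID (mem (E n))) /= mulrDr !mulr_sumr; congr (_ + _).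
      by apply: eq_bigr => j jE; rewrite /r /B jE -lamD; ring.
    by apply: eq_bigr => j jE; rewrite /r /B (negPf jE) /L -lamD; ring.
  rewrite ler_wpM2l ?mulr_ge0 ?exprn_ge0 ?(le_trans ler01 c1) //.
  rewrite -!mulr_suml.
  (* The mass of [E] trades [R_l] for [R_h] and raises the exponent from [2 r_l + 1] to
     [2 r_h + 1]. *)
  have e1 : (\sum_(j in E n) p j) * (lam n `^ (2 * r_l + 1) * R_l ^+ 2) <= CE * R_h ^+ 2 * L.
    have -> : CE * R_h ^+ 2 * L = CE * (R_h / R_l) ^+ 2 * lam n `^ (2 * (r_h - r_l)) *
        (lam n `^ (2 * r_l + 1) * R_l ^+ 2).
      have -> : L = lam n `^ (2 * (r_h - r_l)) * lam n `^ (2 * r_l + 1).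
        rewrite -powRD; last by rewrite (gt_eqF lam0) implybT.
        by congr (_ `^ _); ring.
      by field; rewrite gt_eqF.
    by rewrite ler_wpM2r // mulr_ge0 ?powR_ge0 ?sqr_ge0.
  have e2 : (\sum_(j | j \notin E n) p j) * (L * R_h ^+ 2) <= 1 * (L * R_h ^+ 2).
    apply: ler_wpM2r; first by rewrite mulr_ge0 // sqr_ge0.
    rewrite -sum_p [leRHS](bigID (mem (E n))) /=.
    by rewrite lerDr sumr_ge0 // => j _; exact: ltW.
  lra.
pose N := k.+1%:R : R.
have N0 : 0 < N by rewrite ltr0n.
pose ed j := effective_dim (ext_rkhs (H n j)) (local_cov nu (H n) j) (lam n).
have ed0 j : (0 <= ed j)%E by exact: effective_dim_ge0.
have c0 : 0 < c := lt_le_trans ltr01 c1.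
have sv0 : 0 <= sigma ^+ 2 * (2 * c / N).
  by rewrite mulr_ge0 ?sqr_ge0 // divr_ge0 ?(ltW N0) // mulr_ge0 // ltW.
apply: (@le_trans _ _ (bias%:E + (sigma ^+ 2 * (2 * c / N))%:E *
    (((m n)%:R)^-1 * (`|C_1| * `|C_2| * lam n `^ (- gamma)))%:E)%E).
  apply: le_trans (leeD (le_refl _) (lee_wpmul2l _ (capacity_sum_le m0 (ltW gamma0) lam0 (cap _ n_gt0)))); last first.
    by rewrite lee_fin.
  rewrite le_eqVlt; apply/orP; left; apply/eqP.
  rewrite ge0_sume_distrr => [|j _]; last first.
    by apply: mule_ge0; [rewrite lee_fin; exact/ltW/p0|exact: effective_dim_ge0].
  rewrite /bias -sumEFin -big_split /=; apply: eq_bigr => j _.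
  rewrite -/(p j) -/(ed j) ge0_muleDr //; last 2 first.
  - rewrite lee_fin; apply: mulr_ge0; last by rewrite mulr_ge0 ?powR_ge0 ?sqr_ge0.
    by apply: mulr_ge0; [rewrite mulr_ge0 // exprn_ge0 // ltW|exact: sqr_ge0].
  - apply: mule_ge0; first by rewrite lee_fin sqr_ge0.
    apply: mule_ge0 => //; rewrite lee_fin; apply: divr_ge0; last exact: ltW.
    by rewrite mulr_ge0 // ltW.
  congr (_ + _)%E; rewrite !muleA -!EFinM; congr (_%:E * _)%E; rewrite -/N; ring.
rewrite -EFinM -EFinD lee_fin.
have target : n%:R^-1 `^ ((2 * r_h + 1) / (2 * r_h + 1 + gamma)) = rt n `^ (2 * r_h + 1).
  by rewrite /rt rate_powR.
have -> : (Kb + Kv) / R_h ^+ 2 * (R_h ^+ 2 *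
    n%:R^-1 `^ ((2 * r_h + 1) / (2 * r_h + 1 + gamma))) =
  Kb * rt n `^ (2 * r_h + 1) + Kv * n%:R^-1 `^ ((2 * r_h + 1) / (2 * r_h + 1 + gamma)).
  by rewrite target; field; rewrite gt_eqF.
have CE0 : 0 <= CE + 1.
  rewrite addr_ge0 // /CE addr_ge0 // invr_ge0 mulr_ge0 ?sqr_ge0 ?powR_ge0 //.
have L_le : L <= `|C_lam| `^ (2 * r_h + 1) * rt n `^ (2 * r_h + 1).
  rewrite -powRM //; last exact: ltW.
  apply: ge0_ler_powR; rewrite ?nnegrE ?(ltW lam0) //; first by lra.
    by rewrite mulr_ge0 // ltW.
  by apply: (le_trans lam_le); rewrite ler_wpM2r ?ler_norm // ltW.
apply: lerD.
  apply: (le_trans bias_le).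
  have c40 : 0 <= c ^+ 4 by rewrite exprn_ge0 // ltW.
  have x0 : 0 <= (CE + 1) * R_h ^+ 2 * L by rewrite mulr_ge0 // mulr_ge0 ?sqr_ge0.
  have y0 : 0 <= (CE + 1) * R_h ^+ 2 by rewrite mulr_ge0 ?sqr_ge0.
  rewrite /Kb -!(mulrA 2) ler_pM2l // -[leRHS]mulrA.
  apply: ler_pM => //; rewrite -[leRHS]mulrA.
  by rewrite ler_wpM2l.
rewrite -(rate_variance rh0 gamma0 n_gt0) -/rt.
have nR : 0 < n%:R :> R by rewrite ltr0n.
have mR : 0 < (m n)%:R :> R by rewrite ltr0n.
(* The fresh point pays for the rounding: [(n %/ m + 1) m] exceeds [n], without a further
   constant. *)
have Nm : N^-1 * (m n)%:R^-1 <= n%:R^-1.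
  rewrite -invfM lef_pV2 ?posrE ?mulr_gt0 // -natrM ler_nat ltnW //.
  exact: ltn_ceil.
have lam_var : lam n `^ (- gamma) <= c_lam `^ (- gamma) * rt n `^ (- gamma).
  rewrite -powRM ?(ltW clam0) ?(ltW rt0) // !powRN lef_pV2 ?posrE ?powR_gt0 ?mulr_gt0 //.
  apply: ge0_ler_powR; rewrite ?nnegrE ?(ltW lam0) ?(ltW gamma0) //.
  by rewrite mulr_ge0 // ltW.
have -> : sigma ^+ 2 * (2 * c / N) * ((m n)%:R^-1 * (`|C_1| * `|C_2| * lam n `^ (- gamma))) =
  (sigma ^+ 2 * 2 * (`|C_1| * `|C_2|)) * (c * (N^-1 * (m n)%:R^-1) * lam n `^ (- gamma)) by ring.
have -> : Kv * (n%:R^-1 * rt n `^ (- gamma)) =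
  (sigma ^+ 2 * 2 * (`|C_1| * `|C_2|)) * (cbar * n%:R^-1 * (c_lam `^ (- gamma) * rt n `^ (- gamma))).
  by rewrite /Kv; ring.
have nm0 : 0 <= N^-1 * (m n)%:R^-1 by rewrite -invfM invr_ge0 mulr_ge0 // ltW.
apply: ler_wpM2l.
  by apply: mulr_ge0; [rewrite mulr_ge0 ?sqr_ge0|rewrite mulr_ge0].
apply: ler_pM; [by apply: mulr_ge0 => //; exact: ltW|exact: powR_ge0| |exact: lam_var].
by apply: ler_pM => //; exact: ltW.
Qed.
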